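(* Let $T>0$ and let $A:[0,T]\times[0,T]\to\mathbb{R}^{n\times n}$, $B:[0,T]\times[0,T]\to\mathbb{R}^{n\times m}$, $Q:[0,T]\times[0,T]\to\mathcal S^n$, $R:[0,T]\times[0,T]\to\mathcal S^m$, $G:[0,T]\to\mathcal S^n$ be continuous. Assume there are constants $L,\delta>0$ such that for all $s,t,r\in[0,T]$ $$\|A(t,s)-A(r,s)\|+\|B(t,s)-B(r,s)\|+\|Q(t,s)-Q(r,s)\|+\|R(t,s)-R(r,s)\|+\|G(t)-G(r)\|\le L|t-r|,$$ that $Q(t,s)\ge0$, $G(t)\ge0$, $R(t,s)\ge\delta I$ for all $t,s\in[0,T]$, and that $$G(t)\le G(r),\quad Q(t,s)\le Q(r,s),\quad R(t,s)\le R(r,s),\qquad\forall\,0\le t\le r\le s\le T.$$ Write $A(s)=A(s,s)$, $B(s)=B(s,s)$, $R(s)=R(s,s)$. Suppose that the system of forward-backward Volterra integral equations $$\Phi(s;t)=I+\int_t^s\big[A(r)-B(r)R(r)^{-1}B(r)^{\top}P(r)\big]\Phi(r;t)\,dr,\qquad 0\le t\le s\le T,$$ $$P(t)=\Phi(T;t)^{\top}G(t)\Phi(T;t)+\int_t^T\Big[\Phi(r;t)^{\top}Q(t,r)\Phi(r;t)+\Phi(r;t)^{\top}P(r)B(r)R(r)^{-1}R(t,r)R(r)^{-1}B(r)^{\top}P(r)\Phi(r;t)\Big]dr,\quad t\in[0,T],$$ admits a unique solution $(\Phi(\cdot\,;\cdot),P(\cdot))$ with $P:[0,T]\to\mathcal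 S^n$ continuous and $\Phi$ continuous on $\{0\le t\le s\le T\}$. Let $x\in\mathbb{R}^n$ and $$\bar X(s)=\Phi(s;0)x,\qquad \bar u(s)=-R(s)^{-1}B(s)^{\top}P(s)\Phi(s;0)x,\qquad s\in[0,T].$$ Then, with $P^\Delta,\Phi^\Delta,\bar X^\Delta,\bar u^\Delta,J_k^\Delta$ as defined in the context for partitions $\Delta$ of $[0,T]$ and $\|\cdot\|$ denoting the supremum norm, $$\lim_{\|\Delta\|\to0}\|P^\Delta-P\|=0,\qquad \lim_{\|\Delta\|\to0}\|\Phi^\Delta-\Phi\|=0,\qquad \lim_{\|\Delta\|\to0}\big\{\|\bar X^\Delta-\bar X\|+\|\bar u^\Delta-\bar u\|\big\}=0,$$ and $\bar u$ is an equilibrium control of Problem (LQ) for $x$: for every $\varepsilon>0$ there is $\delta'>0$ such that for every partition $\Delta$ of $[0,T]$ with $\|\Delta\|<\delta'$ and every player index $k$ of $\Delta$, $$J_k^\Delta(\bar u)\le J_k^\Delta(\bar u^\Delta)+K\|\Delta\|<J_k^\Delta(\bar u^\Delta)+\varepsilon,$$ where $K>0$ is a constant independent of $\Delta$ and $k$.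
   Context: $\mathcal S^n$ is the space of real symmetric $n\times n$ matrices; $M\le M'$ means $M'-M$ is positive semidefinite; $^{\top}$ is transpose. $\mathcal U[a,b]=L^2([a,b];\mathbb{R}^m)$. For a partition $\Delta:0=t_0<t_1<\cdots<t_N=T$, $\|\Delta\|=\max_{1\le k\le N}(t_k-t_{k-1})$, and for $s\in[t_{k-1},t_k)$ ($1\le k\le N$; for $k=N$ the point $s=T$ is included) $$A^\Delta(s)=A(t_{k-1},s),\quad B^\Delta(s)=B(t_{k-1},s),\quad Q^\Delta(s)=Q(t_{k-1},s),\quad R^\Delta(s)=R(t_{k-1},s).$$ **Definition of $P^\Delta,\Phi^\Delta,\Psi^\Delta$.** They form the unique solution, obtained backward interval by interval, of: for $1\le k\le N$, $$\dot P^\Delta+P^\Delta A^\Delta+(A^\Delta)^{\top}P^\Delta+Q^\Delta-P^\Delta B^\Delta(R^\Delta)^{-1}(B^\Delta)^{\top}P^\Delta=0\quad\text{on }(t_{k-1},t_k),$$ $$P^\Delta(t_k-0)=\Phi^\Delta(t_N;t_k)^{\top}G(t_{k-1})\Phi^\Delta(t_N;t_k)+\int_{t_k}^{t_N}\Big(\Phi^\Delta(s;t_k)^{\top}Q(t_{k-1},s)\Phi^\Delta(s;t_k)+\Psi^\Delta(s;t_k)^{\top}R(t_{k-1},s)\Psi^\Delta(s;t_k)\Big)ds,$$ where for $0\le t\le s\le T$ $$\Phi^\Delta_s(s;t)=\big[A^\Delta(s)-B^\Delta(s)R^\Delta(s)^{-1}B^\Delta(s)^{\top}P^\Delta(s)\big]\Phi^\Delta(s;t),\quad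 \Phi^\Delta(t;t)=I,$$ $$\Psi^\Delta(s;t)=-R^\Delta(s)^{-1}B^\Delta(s)^{\top}P^\Delta(s)\Phi^\Delta(s;t).$$ $P^\Delta$ may jump at $t_1,\dots,t_{N-1}$ (its value there may be taken to be the right limit; $P^\Delta(T)$ is the left limit). **Equilibrium pair for $\Delta$.** For $x\in\mathbb{R}^n$: $\bar X^\Delta(s)=\Phi^\Delta(s;0)x$ and $\bar u^\Delta(s)=\Psi^\Delta(s;0)x$, $s\in[0,T]$. (This is the equilibrium pair of the $N$-person hierarchical game in which Player $k$ controls the system on $[t_{k-1},t_k)$ and minimizes the cost $J^\Delta_k$ below, knowing that later players respond optimally to the state they inherit.) **Costs.** For $u\in\mathcal U[0,T]$ let $X$ solve $\dot X(s)=A^\Delta(s)X(s)+B^\Delta(s)u(s)$ on $[0,T]$, $X(0)=x$. The cost of Player $k$, $1\le k\le N$, is $$J_k^\Delta(u)=\langle G(t_{k-1})X(T),X(T)\rangle+\int_{t_{k-1}}^T\big[\langle Q(t_{k-1},s)X(s),X(s)\rangle+\langle R(t_{k-1},s)u(s),u(s)\rangle\big]ds.$$ **Problem (LQ).** A control $\bar u\in\mathcal U[0,T]$ is an equilibrium control of Problem (LQ) for $x$ if for every $\varepsilon>0$ there is $\delta'>0$ such that for every partition $\Delta$ of $[0,T]$ with $\|\Delta\|<\delta'$ one has $J^\Delta_k(\bar u)\le J^\Delta_k(\bar u^\Delta)+\varepsilon$ for all players $k$ of $\Delta$. *)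

(* Defs.v *)
From HB Require Import structures.
From mathcomp Require Export all_boot all_order all_algebra.
From mathcomp Require Export all_classical all_reals all_analysis.
Export Order.TTheory GRing.Theory Num.Theory.
Export numFieldNormedType.Exports.

Set Implicit Arguments.
Unset Strict Implicit.
Unset Printing Implicit Defensive.

Local Open Scope classical_set_scope.
Local Open Scope ring_scope.

Section Matrices.
Variable K : realType.

Definition symm (n : nat) (M : 'M[K]_n) : Prop := M^T = M.

Definition qform (n : nat) (M : 'M[K]_n) (v : 'cV[K]_n) : K :=
  ((M *m v)^T *m v) 0 0.

Definition psd_le (n : nat) (M M' : 'M[K]_n) : Prop :=
  forall v : 'cV[K]_n, 0 <= qform (M' - M) v.

Definition mxint (p q : nat) (a b : K) (F : K -> 'M[K]_(p, q)) : 'M[K]_(p, q) :=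
  \matrix_(i, j) \int[@lebesgue_measure K]_(r in `[a, b]) (F r i j).

(* Valued in the extended reals, so that it is +oo on an unbounded function. *)
Definition supnorm (I : Type) (p q : nat) (D : set I) (f : I -> 'M[K]_(p, q))
    : \bar K :=
  ereal_sup [set (`|f i|)%:E | i in D].

Definition square (T : K) : set (K * K) := `[0, T] `*` `[0, T].

(* The pairs (s, t) with 0 <= t <= s <= T. *)
Definition triangle (T : K) : set (K * K) :=
  [set p | 0 <= p.2 /\ p.2 <= p.1 /\ p.1 <= T].

(* U[0,T] = L^2([0,T]; R^m), through representatives. *)
Definition admissible (m : nat) (T : K) (u : K -> 'cV[K]_m) : Prop :=
  forall i : 'I_m,
    measurable_fun (`[0, T] : set K) (fun s => u s i 0) /\
    (@lebesgue_measure K).-integrable `[0, T] (fun s => ((u s i 0) ^+ 2)%:E).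

End Matrices.

(* A partition 0 = t_0 < t_1 < ... < t_N = T is the list D = [:: t_1; ...; t_N]
   with [itv_partition 0 T D], so that N = size D. *)
Section Partitions.
Variable K : realType.

Definition node (D : seq K) (k : nat) : K := nth 0 (0 :: D) k.

Definition mesh (D : seq K) : K :=
  \big[Num.max/0]_(k < size D) (node D k.+1 - node D k).

Definition mesh_to0 (T : K) : set_system (seq K) :=
  filter_from [set d : K | 0 < d]
    (fun d => [set D | itv_partition 0 T D /\ mesh D < d]).

(* The largest of t_0, ..., t_(N-1) not exceeding s: it is t_(k-1) for
   s in [t_(k-1), t_k[, and t_(N-1) for s = T. *)
Definition left_node (D : seq K) (s : K) : K :=
  \big[Num.max/0]_(k < size D | node D k <= s) node D k.

Definition frozen (V : Type) (D : seq K) (F : K -> K -> V) (s : K) : V :=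
  F (left_node D s) s.

End Partitions.

Section LQ.
Variables (K : realType) (n m : nat) (T : K).
Variables (A : K -> K -> 'M[K]_n) (B : K -> K -> 'M[K]_(n, m)).
Variables (Q : K -> K -> 'M[K]_n) (R : K -> K -> 'M[K]_m) (G : K -> 'M[K]_n).

(* In every state transition map below, [Phi s t] stands for Phi(s; t). *)

Definition gain (P : K -> 'M[K]_n) (r : K) : 'M[K]_(m, n) :=
  invmx (R r r) *m (B r r)^T *m P r.

Definition volterra_sol (Phi : K -> K -> 'M[K]_n) (P : K -> 'M[K]_n) : Prop :=
  [/\ forall t, t \in `[0, T] -> symm (P t),
      {within `[0, T], continuous P},
      {within triangle T, continuous (fun p : K * K => Phi p.1 p.2)},
      forall s t, 0 <= t -> t <= s -> s <= T ->
        Phi s t = 1%:M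
          + mxint t s (fun r => (A r r - B r r *m gain P r) *m Phi r t)
    & forall t, t \in `[0, T] ->
        P t = (Phi T t)^T *m G t *m Phi T t
          + mxint t T (fun r =>
              (Phi r t)^T *m Q t r *m Phi r t
              + (Phi r t)^T *m P r *m B r r *m invmx (R r r) *m R t r
                *m invmx (R r r) *m (B r r)^T *m P r *m Phi r t)].

Section OnePartition.
Variable D : seq K.
Let AD := frozen D A.
Let BD := frozen D B.
Let QD := frozen D Q.
Let RD := frozen D R.

Definition psi_of (P : K -> 'M[K]_n) (Phi : K -> K -> 'M[K]_n) (s t : K)
    : 'M[K]_(m, n) :=
  - (invmx (RD s) *m (BD s)^T *m P s *m Phi s t).

(* The prescribed value of P(t_k - 0). *)
Definition end_value (P : K -> 'M[K]_n) (Phi : K -> K -> 'M[K]_n) (k : nat)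
    : 'M[K]_n :=
  let tk := node D k in
  let tk1 := node D k.-1 in
  (Phi T tk)^T *m G tk1 *m Phi T tk
  + mxint tk T (fun s =>
      (Phi s tk)^T *m Q tk1 s *m Phi s tk
      + (psi_of P Phi s tk)^T *m R tk1 s *m psi_of P Phi s tk).

(* The equation for Phi has coefficients that jump at the nodes, so it is
   required off the nodes, together with continuity of Phi(.; t). *)
Definition game_sol (PPhi : (K -> 'M[K]_n) * (K -> K -> 'M[K]_n)) : Prop :=
  let: (P, Phi) := PPhi in
  [/\ forall k, (0 < k <= size D)%N ->
        [/\ forall s, node D k.-1 < s < node D k ->
              derivable P s 1 /\
              derive1 P s + P s *m AD s + (AD s)^T *m P s + QD s
                - P s *m BD s *m invmx (RD s) *m (BD s)^T *m P s = 0,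
            P r @[r --> (node D k.-1)^'+] --> P (node D k.-1)
          & P r @[r --> (node D k)^'-] --> end_value P Phi k],
      P r @[r --> T^'-] --> P T
    & forall t, t \in `[0, T] ->
        [/\ Phi t t = 1%:M,
            {within `[t, T], continuous (Phi ^~ t)}
          & forall s, t < s < T -> s \notin D ->
              derivable (Phi ^~ t) s 1 /\
              derive1 (Phi ^~ t) s
                = (AD s - BD s *m invmx (RD s) *m (BD s)^T *m P s) *m Phi s t]].

(* The solution of [game_sol]; only its values on [0, T] and on the triangle,
   where it is unique, are ever used. *)
Definition game_pair : (K -> 'M[K]_n) * (K -> K -> 'M[K]_n) := get game_sol.
Definition PD : K -> 'M[K]_n := game_pair.1.
Definition PhiD : K -> K -> 'M[K]_n := game_pair.2.
Definition PsiD : K -> K -> 'M[K]_(m, n) := psi_of PD PhiD.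

Variable x : 'cV[K]_n.

Definition XD (s : K) : 'cV[K]_n := PhiD s 0 *m x.
Definition uD (s : K) : 'cV[K]_m := PsiD s 0 *m x.

(* X' = AD X + BD u, X(0) = x, in the Caratheodory sense since u is only L^2. *)
Definition is_state (u : K -> 'cV[K]_m) (X : K -> 'cV[K]_n) : Prop :=
  {within `[0, T], continuous X} /\
  forall s, s \in `[0, T] ->
    X s = x + mxint 0 s (fun r => AD r *m X r + BD r *m u r).

Definition state (u : K -> 'cV[K]_m) : K -> 'cV[K]_n := get (is_state u).

Definition cost (k : nat) (u : K -> 'cV[K]_m) : K :=
  let tk1 := node D k.-1 in
  let X := state u in
  qform (G tk1) (X T)
  + \int[@lebesgue_measure K]_(s in `[tk1, T])
      (qform (Q tk1 s) (X s) + qform (R tk1 s) (u s)).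

End OnePartition.

Definition equilibrium_control (x : 'cV[K]_n) (u : K -> 'cV[K]_m) : Prop :=
  admissible T u /\
  forall e : K, 0 < e -> exists2 d : K, 0 < d &
    forall D, itv_partition 0 T D -> mesh D < d ->
    forall k, (0 < k <= size D)%N ->
      cost D x k u <= cost D x k (uD D x) + e.

End LQ.

(* Main.v *)
(* The equilibrium system and the game of a partition D are one and the same
   backward Volterra equation. Write Phi(s; t) = U(s) V(t) with
   U(T) = V(T) = I, U' = a U, V' = - V a, where
   a = A - B R^-1 B^T P. Then (U, V, P) is a fixed point of a Volterra operator
   whose coefficients are frozen at sigma(s): sigma = id gives the given system,
   sigma(s) = left_node D s gives the Riccati equations of the players, since
   differentiating P = V^T (G + int_t^T U^T (...) U) V yields them on each
   interval. Freezing moves the coefficients by O(mesh), so in a norm weighted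
   by exp(lam (T - t)) the frozen operator is a contraction of a small ball
   around the given solution: this produces, at once, a solution for D and its
   O(mesh) distance to the given one. Uniqueness of the solution for D is an
   ODE argument, interval by interval from T down. States and costs are then
   O(mesh)-close as well, which bounds the difference of the costs directly. *)

(* The product form removes the second time variable: the unknown depends on one time, all its
   integrals are tails over [t, T], and [V t] leaves the integral in the equation of P. Only the
   freezing keeps two times: sigma(t) for the weights of the player who pays from time t on, and
   sigma(r) for the feedback of the player who acts at time r. The first one makes P jump at the
   nodes, which is why the function space consists of bounded measurable functions rather than
   continuous ones. The operator is polynomial in the unknown, hence Lipschitz on bounded sets only.
   All a priori bounds are therefore borrowed from the given solution, and the mesh must be small
   enough for the iterates to stay in the ball where these bounds hold. For such partitions
   existence and uniqueness identify the pair selected by [get] with the fixed point. *)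
Require Import Defs.
From mathcomp Require Import measurable_realfun ring lra.

Set Implicit Arguments.
Unset Strict Implicit.
Unset Printing Implicit Defensive.

Local Open Scope classical_set_scope.
Local Open Scope ring_scope.

(** * Matrix norms and uniform estimates *)

Section MatrixNorm.
Context {K : realType}.

Lemma mx_entry_le p q (M : 'M[K]_(p, q)) i j : `|M i j| <= `|M|.
Proof.
by rewrite [leRHS]/Num.Def.normr/= mx_normrE; exact: (le_bigmax _ _ (i, j)).
Qed.

Lemma mx_norm_le p q (M : 'M[K]_(p, q)) c :
  0 <= c -> (forall i j, `|M i j| <= c) -> `|M| <= c.
Proof.
by move=> c0 Mc; rewrite [leLHS]/Num.Def.normr/= mx_normrE bigmax_le.
Qed.

Lemma mx_norm_tr p q (M : 'M[K]_(p, q)) : `|M^T| = `|M|.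
Proof.
apply/eqP; rewrite eq_le; apply/andP; split; apply: mx_norm_le => // i j.
  by rewrite mxE mx_entry_le.
by have := mx_entry_le M^T j i; rewrite mxE.
Qed.

(** The maximum norm is not submultiplicative: an entry of the product is a sum of [q] terms. Hence
    the dimension factors in all later constants. *)
Lemma mx_norm_mul p q r (A : 'M[K]_(p, q)) (B : 'M[K]_(q, r)) :
  `|A *m B| <= q%:R * (`|A| * `|B|).
Proof.
apply: mx_norm_le => [|i j]; first by rewrite !mulr_ge0.
rewrite mxE (le_trans (ler_norm_sum _ _ _))//.
rewrite (@le_trans _ _ (\sum_(k < q) `|A| * `|B|))//.
  by apply: ler_sum => k _; rewrite normrM ler_pM ?mx_entry_le.
by rewrite sumr_const card_ord mulr_natl.
Qed.

Lemma mx_norm_usub p1 p2 q (M : 'M[K]_(p1 + p2, q)) : `|usubmx M| <= `|M|.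
Proof. by apply: mx_norm_le => // i j; rewrite mxE mx_entry_le. Qed.

Lemma mx_norm_dsub p1 p2 q (M : 'M[K]_(p1 + p2, q)) : `|dsubmx M| <= `|M|.
Proof. by apply: mx_norm_le => // i j; rewrite mxE mx_entry_le. Qed.

Lemma mx_norm_col p1 p2 q (M1 : 'M[K]_(p1, q)) (M2 : 'M[K]_(p2, q)) c :
  `|M1| <= c -> `|M2| <= c -> `|col_mx M1 M2| <= c.
Proof.
move=> h1 h2; apply: mx_norm_le => [|i j]; first exact: le_trans h1.
by rewrite mxE; case: splitP => k _; exact: le_trans (mx_entry_le _ _ _) _.
Qed.

(* In the maximum norms this is |v|^2 <= v^T v, with v^T v <= v^T M v / delta. *)
Lemma coercive_norm_le m (M : 'M[K]_m) delta (v : 'cV[K]_m) : 0 < delta ->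
  psd_le delta%:M M -> `|v| <= m%:R / delta * `|M *m v|.
Proof.
move=> d0 /(_ v) Mv.
have vv : delta * (v^T *m v) 0 0 <= m%:R * (`|M *m v| * `|v|).
  have : delta * (v^T *m v) 0 0 <= qform M v.
    move: Mv; rewrite /qform mulmxBl mul_scalar_mx linearB/= linearZ/=.
    by rewrite mulmxBl -scalemxAl !mxE subr_ge0.
  move=> /le_trans; apply; apply: le_trans (ler_norm _) _.
  rewrite (le_trans (mx_entry_le _ _ _))// (le_trans (mx_norm_mul _ _))//.
  by rewrite mx_norm_tr.
have v2 : `|v| ^+ 2 <= (v^T *m v) 0 0.
  have vij i j : `|v i j| ^+ 2 <= (v^T *m v) 0 0.
    rewrite mxE (bigD1 i)//= mxE ord1 real_normK ?num_real// -expr2 lerDl.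
    by apply: sumr_ge0 => k _; rewrite mxE -expr2 sqr_ge0.
  have s0 : 0 <= (v^T *m v) 0 0.
    by rewrite mxE; apply: sumr_ge0 => k _; rewrite mxE -expr2 sqr_ge0.
  rewrite -(sqr_sqrtr s0) ler_sqr ?nnegrE ?sqrtr_ge0//.
  apply: mx_norm_le => [|i j]; first exact: sqrtr_ge0.
  by rewrite -ler_sqr ?nnegrE ?sqrtr_ge0// sqr_sqrtr// vij.
have [->|v0] := eqVneq v 0; first by rewrite normr0 mulr_ge0// divr_ge0// ltW.
have nv : 0 < `|v| by rewrite normr_gt0.
rewrite -(ler_pM2l nv) -(ler_pM2l d0).
have := le_trans (ler_wpM2l (ltW d0) v2) vv.
rewrite expr2 => /le_trans; apply; rewrite le_eqVlt; apply/orP; left; apply/eqP.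
by field; rewrite gt_eqF.
Qed.

(** By the coercivity bound a vector killed by [M] has norm 0; this is applied to the transposed
    rows of the left kernel of [M^T]. *)
Lemma coercive_unit m (M : 'M[K]_m) delta : 0 < delta ->
  psd_le delta%:M M -> M \in unitmx.
Proof.
move=> d0 Md; rewrite -unitmx_tr -row_free_unit -kermx_eq0; apply/eqP.
apply/row_matrixP => i; rewrite row0.
have h : M *m (row i (kermx M^T))^T = 0.
  apply: trmx_inj; rewrite trmx_mul trmxK -row_mul mulmx_ker row0.
  by rewrite trmx0.
have := coercive_norm_le (row i (kermx M^T))^T d0 Md.
rewrite h normr0 mulr0 normr_le0 => /eqP h0.
by rewrite -[LHS]trmxK h0 trmx0.
Qed.

(** The coercivity bound is applied to the columns of the inverse, which [M] sends to unit vectors.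
    Only [m] and [delta] enter, so the bound is uniform in both times. *)
Lemma coercive_inv_norm m (M : 'M[K]_m) delta : 0 < delta ->
  psd_le delta%:M M -> `|invmx M| <= m%:R / delta.
Proof.
move=> d0 Md; apply: mx_norm_le => [|i j].
  by rewrite divr_ge0// ltW.
have := coercive_norm_le (col j (invmx M)) d0 Md.
rewrite !colE mulmxA mulmxV ?(coercive_unit d0 Md)// mul1mx -colE => h.
apply: le_trans (le_trans h _).
  by have := mx_entry_le (col j (invmx M)) i 0; rewrite mxE.
rewrite ler_piMr// ?divr_ge0// ?(ltW d0)//.
apply: mx_norm_le => // k l; rewrite mxE.
by rewrite normr_nat lern1 leq_b1.
Qed.

(** Resolvent identity: together with the uniform bound on inverses it makes inversion Lipschitz on
    coercive matrices. *)
Lemma invmx_sub m (M1 M2 : 'M[K]_m) : M1 \in unitmx -> M2 \in unitmx ->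
  invmx M1 - invmx M2 = - (invmx M1 *m (M1 - M2) *m invmx M2).
Proof.
by move=> u1 u2; rewrite mulmxBr mulmxBl mulVmx// mul1mx mulmxK// opprB.
Qed.

End MatrixNorm.

Section UniformEstimates.
Context {K : realType} {I : Type} (Om : set I) (e : I -> K).

(** An index bundles times, partitions or candidate matrices, so that one constant serves them all;
    the independence of the final constant from the partition originates here. In [uclose], [e] is
    the common error scale. *)
Definition ubnd p q (f : I -> 'M[K]_(p, q)) : Prop :=
  exists2 C, 0 <= C & forall i, Om i -> `|f i| <= C.

Definition uclose p q (f g : I -> 'M[K]_(p, q)) : Prop :=
  exists2 C, 0 <= C & forall i, Om i -> `|f i - g i| <= C * e i.

Lemma ubnd_le p q (f : I -> 'M[K]_(p, q)) C :
  (forall i, Om i -> `|f i| <= C) -> ubnd f.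
Proof.
move=> fC; exists `|C| => // i /fC/le_trans; apply; exact: ler_norm.
Qed.

Lemma ubnd_cst p q (M : 'M[K]_(p, q)) : ubnd (fun=> M).
Proof. by exists `|M|. Qed.

Lemma ubnd_opp p q (f : I -> 'M[K]_(p, q)) : ubnd f -> ubnd (fun i => - f i).
Proof. by move=> [C C0 fC]; exists C => // i /fC; rewrite normrN. Qed.

Lemma ubnd_add p q (f g : I -> 'M[K]_(p, q)) :
  ubnd f -> ubnd g -> ubnd (fun i => f i + g i).
Proof.
move=> [C C0 fC] [C' C'0 gC]; exists (C + C') => [|i Oi].
  exact: addr_ge0.
by rewrite (le_trans (ler_normD _ _))// lerD ?fC ?gC.
Qed.

Lemma ubnd_tr p q (f : I -> 'M[K]_(p, q)) : ubnd f -> ubnd (fun i => (f i)^T).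
Proof. by move=> [C C0 fC]; exists C => // i /fC; rewrite mx_norm_tr. Qed.

Lemma ubnd_mul p q r (f : I -> 'M[K]_(p, q)) (g : I -> 'M[K]_(q, r)) :
  ubnd f -> ubnd g -> ubnd (fun i => f i *m g i).
Proof.
move=> [C C0 fC] [C' C'0 gC]; exists (q%:R * (C * C')) => [|i Oi].
  by rewrite !mulr_ge0.
rewrite (le_trans (mx_norm_mul _ _))// ler_wpM2l//.
by rewrite ler_pM ?fC ?gC.
Qed.

Lemma uclose_refl p q (f : I -> 'M[K]_(p, q)) : uclose f f.
Proof. by exists 0 => // i _; rewrite subrr normr0 mul0r. Qed.

Lemma uclose_sym p q (f g : I -> 'M[K]_(p, q)) : uclose f g -> uclose g f.
Proof. by move=> [C C0 h]; exists C => // i /h; rewrite distrC. Qed.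

Lemma uclose_opp p q (f g : I -> 'M[K]_(p, q)) :
  uclose f g -> uclose (fun i => - f i) (fun i => - g i).
Proof. by move=> [C C0 h]; exists C => // i /h; rewrite -opprD normrN. Qed.

Lemma uclose_add p q (f f' g g' : I -> 'M[K]_(p, q)) :
  uclose f f' -> uclose g g' ->
  uclose (fun i => f i + g i) (fun i => f' i + g' i).
Proof.
move=> [C C0 fC] [C' C'0 gC]; exists (C + C') => [|i Oi].
  exact: addr_ge0.
by rewrite opprD addrACA (le_trans (ler_normD _ _))// mulrDl lerD ?fC ?gC.
Qed.

Lemma uclose_tr p q (f g : I -> 'M[K]_(p, q)) :
  uclose f g -> uclose (fun i => (f i)^T) (fun i => (g i)^T).
Proof. by move=> [C C0 h]; exists C => // i /h; rewrite -linearB mx_norm_tr. Qed.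

(** The splitting f g - f' g' = f (g - g') + (f - f') g' uses a bound on one factor of each product:
    the left factor of the first, the right factor of the second. *)
Lemma uclose_mul p q r (f f' : I -> 'M[K]_(p, q)) (g g' : I -> 'M[K]_(q, r)) :
  ubnd f -> ubnd g' -> uclose f f' -> uclose g g' ->
  uclose (fun i => f i *m g i) (fun i => f' i *m g' i).
Proof.
move=> [C C0 fC] [C' C'0 gC] [D D0 ff] [D' D'0 gg].
exists (q%:R * (C * D') + q%:R * (D * C')) => [|i Oi].
  by rewrite addr_ge0// !mulr_ge0.
have -> : f i *m g i - f' i *m g' i
    = f i *m (g i - g' i) + (f i - f' i) *m g' i.
  by rewrite mulmxBr mulmxBl addrA subrK.
rewrite (le_trans (ler_normD _ _))// mulrDl lerD//.
  rewrite (le_trans (mx_norm_mul _ _))// -mulrA ler_wpM2l// -mulrA.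
  by rewrite ler_pM ?fC ?gg.
rewrite (le_trans (mx_norm_mul _ _))// -mulrA ler_wpM2l// mulrAC.
by rewrite ler_pM ?ff ?gC.
Qed.

(** Transfers boundedness from the limit objects to the perturbed ones when the error scale itself
    is bounded. *)
Lemma uclose_bnd p q (f g : I -> 'M[K]_(p, q)) b :
  (forall i, Om i -> e i <= b) -> ubnd f -> uclose f g -> ubnd g.
Proof.
move=> eb [C C0 fC] [D D0 fg]; apply: (@ubnd_le _ _ _ (C + D * b)) => i Oi.
rewrite -[g i](subKr (f i)) (le_trans (ler_normB _ _))// lerD ?fC//.
by rewrite (le_trans (fg _ Oi))// ler_wpM2l// eb.
Qed.

Lemma ubnd_inv m (f : I -> 'M[K]_m) delta : 0 < delta ->
  (forall i, Om i -> psd_le delta%:M (f i)) -> ubnd (fun i => invmx (f i)).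
Proof.
by move=> d0 h; apply: ubnd_le => i Oi; apply: coercive_inv_norm d0 (h i Oi).
Qed.

Lemma uclose_inv m (f g : I -> 'M[K]_m) delta : 0 < delta ->
  (forall i, Om i -> psd_le delta%:M (f i)) ->
  (forall i, Om i -> psd_le delta%:M (g i)) ->
  uclose f g -> uclose (fun i => invmx (f i)) (fun i => invmx (g i)).
Proof.
move=> d0 fd gd [C C0 fg].
have [D D0 fD] := ubnd_inv d0 fd; have [D' D'0 gD] := ubnd_inv d0 gd.
exists (m%:R * (m%:R * (D * C) * D')) => [|i Oi]; first by rewrite !mulr_ge0.
rewrite invmx_sub ?(coercive_unit d0)//; [|exact: fd|exact: gd].
rewrite normrN (le_trans (mx_norm_mul _ _))// -mulrA ler_wpM2l//.
rewrite mulrAC ler_pM ?gD// (le_trans (mx_norm_mul _ _))// -!mulrA ler_wpM2l//.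
by rewrite ler_pM ?fD ?fg.
Qed.

End UniformEstimates.

(** * Calculus of matrix functions *)

Section MatrixCalculus.
Context {K : realType}.

Lemma mx_cvgP {I : Type} (F : set_system I) {FF : Filter F} p q
    (f : I -> 'M[K]_(p, q)) (l : 'M[K]_(p, q)) :
  f @ F --> l <-> forall i j, (fun x => f x i j) @ F --> l i j.
Proof.
split=> [fl i j|fl].
  by apply: (@cvg_comp _ _ _ _ (fun M : 'M[K]_(p, q) => M i j) _ (nbhs l)) => //;
     exact: coord_continuous.
apply/cvgrPdist_le => e e0.
have : \forall x \near F, forall ij : 'I_p * 'I_q,
    `|l ij.1 ij.2 - f x ij.1 ij.2| <= e.
  apply: filter_forall => -[i j]; exact: ((cvgrPdist_le _ _).1 (fl i j)).
apply: filterS => x xe; apply: mx_norm_le => [|i j]; first exact: ltW.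
by have := xe (i, j); rewrite !mxE.
Qed.

Lemma mulmx_cvg {I : Type} (F : set_system I) {FF : Filter F} p q r
    (f : I -> 'M[K]_(p, q)) (g : I -> 'M[K]_(q, r))
    (l : 'M[K]_(p, q)) (l' : 'M[K]_(q, r)) :
  f @ F --> l -> g @ F --> l' -> (fun x => f x *m g x) @ F --> l *m l'.
Proof.
move=> /mx_cvgP fl /mx_cvgP gl; apply/mx_cvgP => i j; rewrite mxE.
under eq_fun do rewrite mxE.
by apply: cvg_big => [|k _]; [exact: add_continuous|apply: cvgM; [exact: fl|exact: gl]].
Qed.

Lemma mulmx_continuous_at (S : topologicalType) (x : S) p q r
    (f : S -> 'M[K]_(p, q)) (g : S -> 'M[K]_(q, r)) :
  {for x, continuous f} -> {for x, continuous g} ->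
  {for x, continuous (fun s => f s *m g s)}.
Proof. exact: mulmx_cvg. Qed.

Lemma trmx_cvg {I : Type} (F : set_system I) {FF : Filter F} p q
    (f : I -> 'M[K]_(p, q)) (l : 'M[K]_(p, q)) :
  f @ F --> l -> (fun x => (f x)^T) @ F --> l^T.
Proof.
move=> /mx_cvgP fl; apply/mx_cvgP => i j; rewrite mxE.
by under eq_fun do rewrite mxE; exact: fl.
Qed.

Lemma trmx_continuous_at (S : topologicalType) (x : S) p q
    (f : S -> 'M[K]_(p, q)) :
  {for x, continuous f} -> {for x, continuous (fun s => (f s)^T)}.
Proof. exact: trmx_cvg. Qed.

Lemma invmx_cvg {I : Type} (F : set_system I) {FF : Filter F} m
    (f : I -> 'M[K]_m) (l : 'M[K]_m) delta : 0 < delta ->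
  psd_le delta%:M l -> (\forall x \near F, psd_le delta%:M (f x)) ->
  f @ F --> l -> (fun x => invmx (f x)) @ F --> invmx l.
Proof.
(* [C] collects the bounds on the two inverses in the resolvent identity and the inner dimensions of
   its two products. *)
move=> d0 ld fd fl; set C := m%:R * (m%:R * (m%:R / delta)) * (m%:R / delta).
have C0 : 0 <= C by rewrite /C !mulr_ge0// invr_ge0 ltW.
apply/cvgrPdist_le => e e0.
have ep : 0 < e / (C + 1) by rewrite divr_gt0// ltr_wpDl.
have fle := (cvgrPdist_le _ _).1 fl _ ep.
near=> x.
have fdx : psd_le delta%:M (f x) by near: x.
have xe : `|l - f x| <= e / (C + 1) by near: x; exact: fle.
rewrite invmx_sub ?(coercive_unit d0)// normrN.
have h : `|invmx l *m (l - f x) *m invmx (f x)| <= C * `|l - f x|.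
  rewrite (le_trans (mx_norm_mul _ _))// /C.
  rewrite [leRHS](_ : _ = m%:R * ((m%:R * (m%:R / delta * `|l - f x|))
    * (m%:R / delta))); last by ring.
  rewrite ler_wpM2l// ler_pM ?(coercive_inv_norm d0)//.
  rewrite (le_trans (mx_norm_mul _ _))// ler_wpM2l//.
  by rewrite ler_wpM2r// (coercive_inv_norm d0).
apply: le_trans h _; apply: le_trans (ler_wpM2l C0 xe) _.
rewrite mulrA ler_pdivrMr ?ltr_wpDl// mulrC ler_wpM2l ?(ltW e0)//.
by rewrite lerDl.
Unshelve. all: by end_near. Qed.

Lemma is_derive_mxP p q (M : K -> 'M[K]_(p, q)) (t : K) (dM : 'M[K]_(p, q)) :
  is_derive t 1 M dM <-> forall i j, is_derive t 1 (fun x => M x i j) (dM i j).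
Proof.
split=> [h i j|h].
  have dMt : derivable M t 1 by [].
  apply: DeriveDef; first by move/derivable_mxP : dMt; exact.
  have <- : 'D_1 M t = dM by apply: derive_val.
  by rewrite derive_mx// mxE.
have dM' : derivable M t 1 by apply/derivable_mxP => i j; have := h i j => -[].
apply: DeriveDef => //; rewrite derive_mx//; apply/matrixP => i j; rewrite mxE.
by apply: derive_val.
Qed.

Lemma is_derive_mulmx p q r (f : K -> 'M[K]_(p, q)) (g : K -> 'M[K]_(q, r))
    (t : K) (df : 'M[K]_(p, q)) (dg : 'M[K]_(q, r)) : is_derive t 1 f df -> is_derive t 1 g dg ->
  is_derive t 1 (fun x => f x *m g x) (df *m g t + f t *m dg).
Proof.
move=> /is_derive_mxP hf /is_derive_mxP hg; apply/is_derive_mxP => i j.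
rewrite (_ : (fun x => _) = \sum_(k < q) (fun x => f x i k * g x k j)); last first.
  by apply/funext => x; rewrite mxE fct_sumE.
have h k : is_derive t 1 (fun x => f x i k * g x k j)
    (f t i k *: dg k j + g t k j *: df i k).
  by have fk := hf i k; have gk := hg k j; exact: is_deriveM.
apply: is_derive_eq (is_derive_sum h) _.
rewrite !mxE -big_split/=; apply: eq_bigr => k _.
by rewrite addrC; congr (_ + _); exact: mulrC.
Qed.

Lemma is_derive_trmx p q (f : K -> 'M[K]_(p, q)) (t : K) (df : 'M[K]_(p, q)) :
  is_derive t 1 f df -> is_derive t 1 (fun x => (f x)^T) df^T.
Proof.
move=> /is_derive_mxP hf; apply/is_derive_mxP => i j.
by rewrite mxE; under eq_fun do rewrite mxE; exact: hf.
Qed.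

Lemma lip_within_continuous (V : normedModType K) (a b : K) (f : K -> V) C :
  (forall s t, a <= s -> s <= t -> t <= b -> `|f s - f t| <= C * (t - s)) ->
  {within `[a, b], continuous f}.
Proof.
move=> fC; apply/subspace_continuousP => x /= xab.
have C0 : 0 <= `|C| + 1 by rewrite addr_ge0.
apply/cvgrPdist_le => e e0; rewrite near_withinE.
have ep : 0 < e / (`|C| + 1) by rewrite divr_gt0// ltr_wpDl.
near=> y => /= yab.
have xy : `|x - y| <= e / (`|C| + 1).
  by near: y; apply: (@cvgr_dist_le _ _ _ (nbhs x)).
move: xab yab; rewrite !in_itv/= => /andP[ax xb] /andP[ay yb].
have {}fC u v : a <= u -> u <= v -> v <= b -> `|f u - f v| <= (`|C| + 1) * `|u - v|.
  move=> au uv vb; rewrite (le_trans (fC _ _ au uv vb))// distrC [`|v - u|]ger0_norm ?subr_ge0//.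
  by rewrite ler_wpM2r ?subr_ge0// (le_trans (ler_norm _))// lerDl.
have h : `|f x - f y| <= (`|C| + 1) * `|x - y|.
  by have [xley|/ltW yx] := leP x y; [exact: fC|rewrite distrC [in leRHS]distrC fC].
apply: le_trans h _; rewrite mulrC -ler_pdivlMr// ltr_wpDl//.
Unshelve. all: by end_near. Qed.

End MatrixCalculus.

(** * Integration of bounded measurable matrix functions *)

Section BoundedMeasurable.
Context {K : realType}.

(** The function space of the fixed point arguments: it admits the jumps of frozen coefficients, is
    stable under matrix operations and uniform limits, and its entries are integrable on
    [[a, b]]. *)
Definition bmeas (a b : K) p q (F : K -> 'M[K]_(p, q)) : Prop :=
  (forall i j, measurable_fun (`[a, b] : set K) (fun r => F r i j)) /\
  exists C, forall r, r \in `[a, b] -> `|F r| <= C.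

Variables a b : K.
Local Notation bm := (bmeas a b).

Lemma bmeas_sub c d p q (F : K -> 'M[K]_(p, q)) :
  a <= c -> d <= b -> bm F -> bmeas c d F.
Proof.
move=> ac db [mF [C FC]].
have sub r : r \in `[c, d] -> r \in `[a, b].
  by rewrite !in_itv/= => /andP[cr rd]; rewrite (le_trans ac)// (le_trans rd).
split => [i j|]; last by exists C => r /sub/FC.
by apply: measurable_funS (mF i j) => // r; exact: sub.
Qed.

Lemma bmeas_ext p q (F G : K -> 'M[K]_(p, q)) :
  (forall r, r \in `[a, b] -> F r = G r) -> bm F -> bm G.
Proof.
move=> FG [mF [C FC]]; split => [i j|]; last by exists C => r rab; rewrite -FG// FC.
by apply: eq_measurable_fun (mF i j) => r; rewrite inE/= => rab; rewrite FG.
Qed.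

Lemma bmeas_cst p q (M : 'M[K]_(p, q)) : bm (fun=> M).
Proof. by split => [i j|]; [exact: measurable_cst|exists `|M|]. Qed.

Lemma bmeas_opp p q (F : K -> 'M[K]_(p, q)) : bm F -> bm (fun r => - F r).
Proof.
move=> [mF [C FC]]; split => [i j|]; last by exists C => r /FC; rewrite normrN.
have -> : (fun r => (- F r) i j) = (fun r => - F r i j).
  by apply/funext => r; rewrite mxE.
exact: measurableT_comp.
Qed.

Lemma bmeas_add p q (F G : K -> 'M[K]_(p, q)) :
  bm F -> bm G -> bm (fun r => F r + G r).
Proof.
move=> [mF [C FC]] [mG [D GD]]; split => [i j|].
  have -> : (fun r => (F r + G r) i j) = (fun r => F r i j + G r i j).
    by apply/funext => r; rewrite mxE.
  exact: measurable_funD.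
by exists (C + D) => r rab; rewrite (le_trans (ler_normD _ _))// lerD ?FC ?GD.
Qed.

Lemma bmeas_mul p q r (F : K -> 'M[K]_(p, q)) (G : K -> 'M[K]_(q, r)) :
  bm F -> bm G -> bm (fun s => F s *m G s).
Proof.
move=> [mF [C FC]] [mG [D GD]]; split => [i j|].
  have -> : (fun s => (F s *m G s) i j) = (fun s => \sum_k F s i k * G s k j).
    by apply/funext => s; rewrite mxE.
  by apply: measurable_sum => k; exact: measurable_funM.
exists (q%:R * (C * D)) => s sab; rewrite (le_trans (mx_norm_mul _ _))//.
by rewrite ler_wpM2l// ler_pM ?FC ?GD.
Qed.

Lemma bmeas_tr p q (F : K -> 'M[K]_(p, q)) : bm F -> bm (fun r => (F r)^T).
Proof.
move=> [mF [C FC]]; split => [i j|]; last by exists C => r /FC; rewrite mx_norm_tr.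
have -> : (fun r => (F r)^T i j) = (fun r => F r j i).
  by apply/funext => r; rewrite mxE.
exact: mF.
Qed.

Lemma bmeas_col p1 p2 q (F : K -> 'M[K]_(p1, q)) (G : K -> 'M[K]_(p2, q)) :
  bm F -> bm G -> bm (fun r => col_mx (F r) (G r)).
Proof.
move=> [mF [C FC]] [mG [D GD]]; split => [i j|].
  case E : (fintype.split i) => [k|k].
    have -> : (fun r => col_mx (F r) (G r) i j) = (fun r => F r k j).
      by apply/funext => r; rewrite mxE E.
    exact: mF.
  have -> : (fun r => col_mx (F r) (G r) i j) = (fun r => G r k j).
    by apply/funext => r; rewrite mxE E.
  exact: mG.
exists (Num.max C D) => r rab.
by apply: mx_norm_col; rewrite le_max ?FC ?GD ?orbT.
Qed.

Lemma bmeas_usub p1 p2 q (F : K -> 'M[K]_(p1 + p2, q)) :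
  bm F -> bm (fun r => usubmx (F r)).
Proof.
move=> [mF [C FC]]; split => [i j|].
  have -> : (fun r => usubmx (F r) i j) = (fun r => F r (lshift p2 i) j).
    by apply/funext => r; rewrite mxE.
  exact: mF.
by exists C => r /FC; apply: le_trans; exact: mx_norm_usub.
Qed.

Lemma bmeas_dsub p1 p2 q (F : K -> 'M[K]_(p1 + p2, q)) :
  bm F -> bm (fun r => dsubmx (F r)).
Proof.
move=> [mF [C FC]]; split => [i j|].
  have -> : (fun r => dsubmx (F r) i j) = (fun r => F r (rshift p1 i) j).
    by apply/funext => r; rewrite mxE.
  exact: mF.
by exists C => r /FC; apply: le_trans; exact: mx_norm_dsub.
Qed.

Lemma within_bmeas p q (F : K -> 'M[K]_(p, q)) :
  {within `[a, b], continuous F} -> bm F.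
Proof.
move=> cF; split => [i j|].
  apply: subspace_continuous_measurable_fun => // x.
  by have /mx_cvgP := cF x; exact.
have /compact_bounded[M [Mr FM]] := continuous_compact cF (@segment_compact _ a b).
by exists (M + 1) => r rab; apply: FM; [rewrite ltrDl|exists r].
Qed.

(** Closure under uniform limits, needed for the limit of the iterates: measurability passes to
    pointwise limits, and an approximant within distance 1 provides the bound. *)
Lemma bmeas_approx p q (F : K -> 'M[K]_(p, q)) :
  (forall d, 0 < d -> exists2 G : K -> 'M[K]_(p, q), bm G &
     forall r, r \in `[a, b] -> `|F r - G r| <= d) -> bm F.
Proof.
move=> FG.
have h k : exists G : K -> 'M[K]_(p, q), bm G /\
    forall r, r \in `[a, b] -> `|F r - G r| <= k.+1%:R^-1.
  have k0 : 0 < k.+1%:R^-1 :> K by rewrite invr_gt0.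
  by have [G bG hG] := FG _ k0; exists G.
have [G hG] := choice h; split => [i j|].
  apply: (@measurable_fun_cvg _ _ _ _ (fun k r => G k r i j)) => [k|r rab].
    by have [[]] := hG k.
  apply/cvgrPdist_le => e e0; near=> k.
  have := (hG k).2 _ rab => /(le_trans (mx_entry_le _ i j)); rewrite !mxE => /le_trans.
  apply; rewrite invf_ple ?posrE//.
  apply: (@le_trans _ _ k%:R); last by rewrite ler_nat.
  by near: k; exact: nbhs_infty_ger.
have [[_ [C GC]] G0] := hG 0%N; exists (C + 1%:R^-1) => r rab.
by rewrite -[F r](addrNK (G 0%N r)) addrC (le_trans (ler_normD _ _))// lerD ?GC// G0.
Unshelve. all: by end_near. Qed.

Lemma bmeas_integrable p q (F : K -> 'M[K]_(p, q)) i j : bm F ->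
  (@lebesgue_measure K).-integrable `[a, b] (EFin \o (fun r => F r i j)).
Proof.
move=> [mF [C FC]]; apply: measurable_bounded_integrable => //.
  by rewrite /= lebesgue_measure_itv/=; case: ifP => // _; rewrite -EFinB ltry.
  exact: mF.
apply: filterS (nbhs_pinfty_ge (num_real C)) => M CM r /= rab.
exact: le_trans (le_trans (mx_entry_le _ i j) (FC _ rab)) CM.
Qed.

End BoundedMeasurable.

Section MatrixIntegral.
Context {K : realType}.
Implicit Types a b c : K.

Lemma mxint_ext p q a b (F G : K -> 'M[K]_(p, q)) :
  (forall r, r \in `[a, b] -> F r = G r) -> mxint a b F = mxint a b G.
Proof.
move=> FG; apply/matrixP => i j; rewrite !mxE; apply: eq_Rintegral => r.
by rewrite inE/= => rab; rewrite FG.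
Qed.

Lemma mxint_point p q a (F : K -> 'M[K]_(p, q)) : mxint a a F = 0.
Proof. by apply/matrixP => i j; rewrite !mxE set_itv1 Rintegral_set1. Qed.

Lemma mxintD p q a b (F G : K -> 'M[K]_(p, q)) : bmeas a b F -> bmeas a b G ->
  mxint a b (fun r => F r + G r) = mxint a b F + mxint a b G.
Proof.
move=> bF bG; apply/matrixP => i j; rewrite !mxE.
under eq_Rintegral do rewrite mxE.
by rewrite RintegralD//; exact: bmeas_integrable.
Qed.

Lemma mxintN p q a b (F : K -> 'M[K]_(p, q)) : bmeas a b F ->
  mxint a b (fun r => - F r) = - mxint a b F.
Proof.
move=> bF; apply/matrixP => i j; rewrite !mxE.
under eq_Rintegral do rewrite mxE -mulN1r.
by rewrite RintegralZl ?mulN1r//; exact: bmeas_integrable.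
Qed.

Lemma mxintB p q a b (F G : K -> 'M[K]_(p, q)) : bmeas a b F -> bmeas a b G ->
  mxint a b (fun r => F r - G r) = mxint a b F - mxint a b G.
Proof.
by move=> bF bG; rewrite mxintD ?mxintN//; exact: bmeas_opp.
Qed.

Lemma Rintegral_sum_ord q a b (f : 'I_q -> K -> K) :
  (forall k, (@lebesgue_measure K).-integrable `[a, b] (EFin \o f k)) ->
  \int[@lebesgue_measure K]_(r in `[a, b]) (\sum_(k < q) f k r)
  = \sum_(k < q) \int[@lebesgue_measure K]_(r in `[a, b]) f k r.
Proof.
move=> fi; elim: q f fi => [|q IH] f fi.
  under eq_Rintegral do rewrite big_ord0.
  by rewrite big_ord0 Rintegral_cst//= mul0r.
under eq_Rintegral do rewrite big_ord_recl.
rewrite big_ord_recl RintegralD ?IH//.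
rewrite (_ : _ \o _ = fun r => (\sum_(k < q) (f (lift ord0 k) r)%:E)%E).
  by apply: integrable_sum => //= k _; exact: fi.
by apply/funext => r; rewrite /= sumEFin.
Qed.

Lemma mxintMl p q r a b (M : 'M[K]_(p, q)) (F : K -> 'M[K]_(q, r)) :
  bmeas a b F -> mxint a b (fun s => M *m F s) = M *m mxint a b F.
Proof.
move=> bF; apply/matrixP => i j; rewrite !mxE.
under eq_Rintegral do rewrite mxE.
rewrite Rintegral_sum_ord => [|k].
  apply: eq_bigr => k _; rewrite mxE RintegralZl//.
  exact: bmeas_integrable.
(* The summand M i k * F s k j is an entry of [M *m delta_mx k k *m F s], which is bounded and
   measurable, hence integrable. *)
rewrite (_ : _ \o _ = EFin \o (fun s => ((fun s => M *m delta_mx k k *m F s) s) i j)).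
  apply: bmeas_integrable; apply: bmeas_mul => //; exact: bmeas_cst.
apply/funext => s /=; rewrite -mulmxA mxE (bigD1 k)//= big1 ?addr0; last first.
  move=> l lk; rewrite mxE big1 ?mulr0// => o _.
  by rewrite mxE (negbTE lk) mul0r.
by rewrite mxE (bigD1 k)//= big1 ?addr0 ?mxE ?eqxx ?mul1r// => o ok;
  rewrite mxE (negbTE ok) andbF mul0r.
Qed.

Lemma mxint_tr p q a b (F : K -> 'M[K]_(p, q)) :
  mxint a b (fun r => (F r)^T) = (mxint a b F)^T.
Proof.
apply/matrixP => i j; rewrite !mxE; apply: eq_Rintegral => r _.
by rewrite mxE.
Qed.

Lemma mxintMr p q r a b (M : 'M[K]_(q, r)) (F : K -> 'M[K]_(p, q)) :
  bmeas a b F -> mxint a b (fun s => F s *m M) = mxint a b F *m M.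
Proof.
move=> bF; apply: trmx_inj; rewrite trmx_mul -!mxint_tr -mxintMl.
  by apply: mxint_ext => s _; rewrite trmx_mul.
exact: bmeas_tr.
Qed.

Lemma mxint_cat p q a b c (F : K -> 'M[K]_(p, q)) : a <= b -> b <= c ->
  bmeas a c F -> mxint a c F = mxint a b F + mxint b c F.
Proof.
move=> ab bc bF; apply/matrixP => i j; rewrite !mxE.
rewrite [RHS]addrC; apply/eqP; rewrite -subr_eq; apply/eqP.
have Fi := bmeas_integrable i j bF.
rewrite Rintegral_itvB// Rintegral_itv_obnd_cbnd//.
by apply: integrableS Fi => // r /=; rewrite !in_itv/= => /andP[br ->];
  rewrite andbT ltW// (le_lt_trans ab).
Qed.

Lemma mxint_norm_le p q a b (F : K -> 'M[K]_(p, q)) (g : K -> K) :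
  bmeas a b F -> {within `[a, b], continuous g} ->
  (forall r, r \in `[a, b] -> `|F r| <= g r) ->
  `|mxint a b F| <= \int[@lebesgue_measure K]_(r in `[a, b]) g r.
Proof.
move=> bF cg Fg.
have gi : (@lebesgue_measure K).-integrable `[a, b] (EFin \o g).
  by apply: continuous_compact_integrable => //; exact: segment_compact.
apply: mx_norm_le => [|i j].
  by apply: Rintegral_ge0 => r /Fg; exact: le_trans.
rewrite mxE; have Fi := bmeas_integrable i j bF.
apply: le_trans (le_normr_Rintegral _ Fi) _ => //.
apply: le_Rintegral => // [|r rab]; first exact: (@integrable_norm _ _ _ _ _ _ Fi).
exact: le_trans (mx_entry_le _ _ _) (Fg _ rab).
Qed.

Lemma mxint_norm_cst p q a b (F : K -> 'M[K]_(p, q)) C : a <= b ->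
  bmeas a b F -> (forall r, r \in `[a, b] -> `|F r| <= C) ->
  `|mxint a b F| <= C * (b - a).
Proof.
move=> ab bF FC; apply: le_trans (mxint_norm_le bF _ FC) _.
  by move=> x; exact: cst_continuous.
rewrite Rintegral_cst//= lebesgue_measure_itv/= lte_fin.
by move: ab; rewrite le_eqVlt => /predU1P[->|->//]; rewrite ltxx subrr mulr0.
Qed.

(** A bound on [F] is a Lipschitz constant of the tail integral, so integrals of discontinuous
    frozen rates are still continuous in [t]. *)
Lemma mxint_tail_cvg p q a b (F : K -> 'M[K]_(p, q)) : bmeas a b F ->
  {within `[a, b], continuous (fun t => mxint t b F)}.
Proof.
move=> bF; have [mF [C FC]] := bF.
apply: (@lip_within_continuous _ _ _ _ _ C) => s t as_ st tb.
rewrite (@mxint_cat _ _ s t b) ?addrK//; last exact: bmeas_sub bF.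
apply: mxint_norm_cst => //; first exact: bmeas_sub bF.
by move=> r; rewrite in_itv/= => /andP[sr rt]; apply: FC;
  rewrite in_itv/= (le_trans as_)// (le_trans rt).
Qed.

Lemma is_derive_mxint p q a b (F : K -> 'M[K]_(p, q)) t : bmeas a b F ->
  t \in `]a, b[ -> {for t, continuous F} ->
  is_derive t 1 (fun t => mxint a t F) (F t).
Proof.
move=> bF tab cF; apply/is_derive_mxP => i j.
have [at_ tb] : a < t /\ t < b by move: tab; rewrite in_itv/= => /andP[].
have Fi := bmeas_integrable i j bF.
have cF' : {for t, continuous (fun r => F r i j)}.
  by move/mx_cvgP : cF; exact.
have [h1 h2] := continuous_FTC1_closed tb Fi at_ cF'.
under eq_fun do rewrite mxE.
by apply: DeriveDef => //; rewrite -derive1E.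
Qed.

Lemma is_derive_mxint_tail p q a b (F : K -> 'M[K]_(p, q)) t : bmeas a b F ->
  t \in `]a, b[ -> {for t, continuous F} ->
  is_derive t 1 (fun t => mxint t b F) (- F t).
Proof.
move=> bF tab cF.
have := is_derive_mxint bF tab cF => h.
have {}h := is_deriveB (is_derive_cst (mxint a b F) t 1) h.
rewrite sub0r in h; apply: near_eq_is_derive h.
move: (tab); rewrite in_itv/= => /andP[at_ tb].
near=> s; rewrite (_ : (_ - _) s = mxint a b F - mxint a s F)//.
rewrite (@mxint_cat _ _ a s b)//; first by rewrite addrC addKr.
- by near: s; exact: lt_le_nbhsr.
- by near: s; exact: lt_le_nbhsl.
Unshelve. all: by end_near. Qed.

End MatrixIntegral.

(** * Fixed points in weighted norms *)

Section WeightedFixpoint.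
Context {K : realType}.

Lemma half_pow_small (c d : K) : 0 < d -> exists n, c * 2 ^- n <= d.
Proof.
move=> d0; have [n cn] : exists n, c / d < n%:R.
  by exists (Num.bound `|c / d|); rewrite (le_lt_trans (ler_norm _))// archi_boundP.
exists n; rewrite ler_pdivrMr ?exprn_gt0//.
rewrite -ler_pdivrMl// mulrC (le_trans (ltW cn))//.
by rewrite -natrX ler_nat ltnW// ltn_expl.
Qed.

Lemma half_pow_le0 (c y : K) : (forall n, y <= c * 2 ^- n) -> y <= 0.
Proof.
move=> h; rewrite leNgt; apply/negP => y0.
have [n hn] := half_pow_small c (divr_gt0 y0 (ltr0n K 2)).
have := le_trans (h n) hn; rewrite leNgt => /negP; apply.
by rewrite ltr_pdivrMr// mulr_natr mulr2n ltrDl.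
Qed.

(** The limit is the supremum of the lower ends [u n - c * 2 ^- n], all of which lie below every
    upper end [u n + c * 2 ^- n]; so the error at stage [n] keeps the constant [c]. *)
Lemma geometric_cauchy_lim (c : K) (u : nat -> K) :
  (forall n m, (n <= m)%N -> `|u m - u n| <= c * 2 ^- n) ->
  exists l, forall n, `|l - u n| <= c * 2 ^- n.
Proof.
move=> uc; pose S := [set u n - c * 2 ^- n | n in [set: nat]].
have ubS n : ubound S (u n + c * 2 ^- n).
  move=> _ [m _ <-].
  have c0 k : 0 <= c * 2 ^- k by have := uc k k (leqnn k); rewrite subrr normr0.
  have [nm|/ltnW mn] := leqP n m.
    have := uc _ _ nm; rewrite ler_norml => /andP[_].
    by have := c0 m; have := c0 n; lra.
  have := uc _ _ mn; rewrite ler_norml => /andP[+ _].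
  by have := c0 m; have := c0 n; lra.
have S0 : S !=set0 by exists (u 0%N - c * 2 ^- 0); exists 0%N.
exists (sup S) => n; rewrite ler_norml; apply/andP; split.
  have : u n - c * 2 ^- n <= sup S.
    by apply: ub_le_sup; [exists (u n + c * 2 ^- n)|exists n].
  lra.
have : sup S <= u n + c * 2 ^- n by apply: ge_sup.
lra.
Qed.

Lemma mx_geometric_cauchy_lim p q (c : K) (u : nat -> 'M[K]_(p, q)) :
  (forall n m, (n <= m)%N -> `|u m - u n| <= c * 2 ^- n) ->
  exists l, forall n, `|l - u n| <= c * 2 ^- n.
Proof.
move=> uc.
have h (ij : 'I_p * 'I_q) : exists l, forall n,
    `|l - u n ij.1 ij.2| <= c * 2 ^- n.
  apply: (@geometric_cauchy_lim c (fun n => u n ij.1 ij.2)) => n m nm.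
  by have := le_trans (mx_entry_le _ ij.1 ij.2) (uc n m nm); rewrite !mxE.
have [l hl] := choice h; exists (\matrix_(i, j) l (i, j)) => n.
apply: mx_norm_le => [|i j]; first exact: le_trans (uc n n (leqnn n)).
by rewrite !mxE; exact: (hl (i, j)).
Qed.

(** Banach iteration from [W0] in the supremum norm weighted by 1/[w], with contraction factor 1/2
    on the ball of radius [rho]. A first step of size [e] leads to a total displacement of at most
    2[e], so [2 * e <= rho] keeps all iterates in the ball. The bound [wmax] turns weighted
    convergence into uniform convergence, which is what measurability of the limit requires. *)
Lemma weighted_fixpoint p q (a b : K) (w : K -> K) (wmax rho e : K)
    (F : (K -> 'M[K]_(p, q)) -> K -> 'M[K]_(p, q)) (W0 : K -> 'M[K]_(p, q)) :
  (forall r, r \in `[a, b] -> 0 <= w r <= wmax) ->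
  0 <= e -> 2 * e <= rho -> bmeas a b W0 ->
  (forall W, bmeas a b W ->
     (forall r, r \in `[a, b] -> `|W r - W0 r| <= rho * w r) ->
     bmeas a b (F W)) ->
  (forall W1 W2 c, bmeas a b W1 -> bmeas a b W2 ->
     (forall r, r \in `[a, b] -> `|W1 r - W0 r| <= rho * w r) ->
     (forall r, r \in `[a, b] -> `|W2 r - W0 r| <= rho * w r) -> 0 <= c ->
     (forall r, r \in `[a, b] -> `|W1 r - W2 r| <= c * w r) ->
     forall r, r \in `[a, b] -> `|F W1 r - F W2 r| <= c / 2 * w r) ->
  (forall r, r \in `[a, b] -> `|F W0 r - W0 r| <= e * w r) ->
  exists W, [/\ bmeas a b W,
    forall r, r \in `[a, b] -> `|W r - W0 r| <= 2 * e * w r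
    & forall r, r \in `[a, b] -> W r = F W r].
Proof.
move=> w0 e0 erho bW0 Fb FL FW0.
pose W n := iter n F W0.
have e2 n : 0 <= e * 2 ^- n by rewrite mulr_ge0// invr_ge0 exprn_ge0.
have half n : (2 : K) ^- n.+1 = 2 ^- n / 2 by rewrite exprSr invfM.
(* The factor 2e(1 - 2^-n) is the partial sum of the steps e 2^-k for k < n. *)
have hW n : [/\ bmeas a b (W n),
    forall r, r \in `[a, b] -> `|W n r - W0 r| <= 2 * e * (1 - 2 ^- n) * w r
    & forall r, r \in `[a, b] -> `|W n.+1 r - W n r| <= e * 2 ^- n * w r].
  elim: n => [|n [bn nW0 nS]].
    split => // r rab; last by rewrite expr0 invr1 mulr1 FW0.
    by rewrite subrr normr0 expr0 invr1 subrr mulr0 mul0r.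
  have ball (c : K) m : c <= 2 * e ->
      (forall r, r \in `[a, b] -> `|W m r - W0 r| <= c * w r) ->
      forall r, r \in `[a, b] -> `|W m r - W0 r| <= rho * w r.
    move=> ce h r rab; apply: le_trans (h _ rab) _.
    by have /andP[wr _] := w0 r rab; rewrite ler_wpM2r// (le_trans ce).
  have le1 m : 2 * e * (1 - 2 ^- m) <= 2 * e.
    by have := e2 m; lra.
  have bnS : bmeas a b (W n.+1) by apply: Fb => //; exact: ball (le1 n) nW0.
  have SW0 r : r \in `[a, b] -> `|W n.+1 r - W0 r| <= 2 * e * (1 - 2 ^- n.+1) * w r.
    move=> rab; rewrite -[_ - _](subrKA (W n r)).
    rewrite (le_trans (ler_normD _ _))// (le_trans (lerD (nS _ rab) (nW0 _ rab)))//.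
    by rewrite half le_eqVlt; apply/orP; left; apply/eqP; move: (2 ^- n) => y; field.
  split => // r rab; rewrite half mulrA.
  exact: (FL _ _ _ bnS bn (ball _ n.+1 (le1 n.+1) SW0) (ball _ n (le1 n) nW0)
    (e2 n) nS _ rab).
have Wcauchy r : r \in `[a, b] -> forall n m, (n <= m)%N ->
    `|W m r - W n r| <= 2 * e * w r * (2 ^- n - 2 ^- m).
  move=> rab n m /subnK <-; elim: (m - n)%N => [|k IH].
    by rewrite add0n !subrr normr0 mulr0.
  rewrite addSn -[_ - _](subrKA (W (k + n)%N r)).
  rewrite (le_trans (ler_normD _ _))//.
  have [_ _ /(_ _ rab) h] := hW (k + n)%N.
  rewrite (le_trans (lerD h IH))//.
  rewrite half le_eqVlt; apply/orP; left; apply/eqP.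
  by move: (2 ^- (k + n)) (2 ^- n) => y z; field.
(* The limit is chosen pointwise, with the value 0 outside the interval. *)
have /choice[Wl hl] : forall r, exists l, r \in `[a, b] -> forall n,
    `|l - W n r| <= 2 * e * w r * 2 ^- n.
  move=> r; have [rab|rab] := boolP (r \in `[a, b]); last by exists 0.
  have [l hl] : exists l, forall n, `|l - W n r| <= 2 * e * w r * 2 ^- n.
    apply: mx_geometric_cauchy_lim => n m nm.
    apply: le_trans (Wcauchy _ rab _ _ nm) _; have /andP[wr _] := w0 r rab.
    by rewrite ler_wpM2l ?mulr_ge0// gerBl invr_ge0 exprn_ge0.
  by exists l.
have bWl : bmeas a b Wl.
  apply: bmeas_approx => d d0; have [n nd] := half_pow_small (2 * e * wmax) d0.
  exists (W n); first by have [] := hW n.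
  move=> r rab; apply: le_trans (hl r rab n) (le_trans _ nd).
  have /andP[wr wm] := w0 r rab.
  by rewrite ler_wpM2r ?invr_ge0 ?exprn_ge0// ler_wpM2l// mulr_ge0.
have WlW0 r : r \in `[a, b] -> `|Wl r - W0 r| <= 2 * e * w r.
  by move=> rab; have := hl r rab 0%N; rewrite expr0 invr1 mulr1.
have ballW n r : r \in `[a, b] -> `|W n r - W0 r| <= rho * w r.
  move=> rab; have [_ /(_ _ rab) h _] := hW n; apply: le_trans h _.
  have /andP[wr _] := w0 r rab; rewrite ler_wpM2r// (le_trans _ erho)//.
  by have := e2 n; lra.
exists Wl; split => // r rab.
apply/esym/eqP; rewrite -subr_eq0 -normr_le0.
apply: (@half_pow_le0 (2 * e * w r)) => n.
(* Both differences contribute e 2^-n [w r]: the first by contraction from the error at stage [n],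
   the second as the error at stage [n.+1]. The residual lies below a null sequence. *)
have -> : F Wl r - Wl r = (F Wl r - F (W n) r) - (Wl r - W n.+1 r).
  by rewrite opprB addrA subrK.
have h : `|F Wl r - F (W n) r| <= (2 * e * 2 ^- n) / 2 * w r.
  have [bn _ _] := hW n.
  apply: (FL _ _ _ bWl bn _ (ballW n) _ _ _ rab); last 2 first.
  - by have := e2 n; lra.
  - by move=> s sab; rewrite mulrAC hl.
  by move=> s sab; rewrite (le_trans (WlW0 _ sab))// ler_wpM2r//;
     have /andP[] := w0 s sab.
rewrite (le_trans (ler_normB _ _))// (le_trans (lerD h (hl _ rab n.+1)))//.
by rewrite half le_eqVlt; apply/orP; left; apply/eqP; move: (2 ^- n) => y; field.
Qed.

(** Since [w] is at least 1, the bound [C] is also a weighted bound, and it can be halved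
    indefinitely. *)
Lemma weighted_unique p q (a b : K) (w : K -> K) C (X : K -> 'M[K]_(p, q)) :
  (forall r, r \in `[a, b] -> 1 <= w r) ->
  (forall r, r \in `[a, b] -> `|X r| <= C) ->
  (forall c, 0 <= c -> (forall r, r \in `[a, b] -> `|X r| <= c * w r) ->
     forall r, r \in `[a, b] -> `|X r| <= c / 2 * w r) ->
  forall r, r \in `[a, b] -> X r = 0.
Proof.
move=> w1 XC half r rab.
have C0 : 0 <= C by exact: le_trans (XC r rab).
have h n : forall r, r \in `[a, b] -> `|X r| <= C * 2 ^- n * w r.
  elim: n => [|n IH] s sab.
    by rewrite expr0 invr1 mulr1 (le_trans (XC _ sab))// ler_peMr// w1.
  rewrite exprSr invfM mulrA; apply: half => //.
  by rewrite mulr_ge0// invr_ge0 exprn_ge0.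
apply/eqP; rewrite -normr_le0; apply: (@half_pow_le0 (C * w r)) => n.
by rewrite mulrAC h.
Qed.

Lemma Rintegral_expR_affine (al be s t : K) : al != 0 -> s <= t ->
  \int[@lebesgue_measure K]_(r in `[s, t]) expR (al * r + be)
  = (expR (al * t + be) - expR (al * s + be)) / al.
Proof.
move=> al0; rewrite le_eqVlt => /predU1P[->|st].
  by rewrite set_itv1 Rintegral_set1 subrr mul0r.
have dF (x : K) : is_derive x 1 (fun r => expR (al * r + be) / al) (expR (al * x + be)).
  have h : is_derive x 1 (fun r : K => al * r + be) al.
    have h1 := is_deriveD (is_deriveZ al (is_derive_id x (1:K))) (is_derive_cst be x (1:K)).
    by apply: is_derive_eq h1 _; rewrite addr0 [LHS]mulr1.
  have h2 := @is_derive1_comp _ expR (fun r => al * r + be) _ _ _ (is_derive_expR _) h.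
  have h3 := is_deriveM h2 (is_derive_cst al^-1 x (1:K)).
  apply: is_derive_eq h3 _; rewrite scaler0 add0r.
  by rewrite [LHS]mulrA mulrAC mulVf ?mul1r.
have cF : continuous (fun r : K => expR (al * r + be) / al).
  move=> x; apply: differentiable_continuous; apply/derivable1_diffP.
  by have [] := dF x.
rewrite /Rintegral (@continuous_FTC2 _ _ (fun r => expR (al * r + be) / al))//.
- by rewrite /= mulrBl.
- apply: continuous_subspaceT => x.
  apply: continuous_comp; last exact: continuous_expR.
  by apply: cvgD; [apply: cvgM; [exact: cvg_cst|exact: cvg_id]|exact: cvg_cst].
- split.
  + by move=> x _; have [] := dF x.
  + exact/cvg_at_right_filter/cF.
  + exact/cvg_at_left_filter/cF.
- by move=> x _; rewrite derive1E; have h := dF x; exact: derive_val.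
Qed.

(** The source of contraction: integrating the weight over a tail gives back the weight at the left
    endpoint with a factor 1/[lam], so a large [lam] absorbs any Lipschitz constant. *)
Lemma Rintegral_exp_tail (lam c s t : K) : 0 < lam -> 0 <= c -> s <= t ->
  \int[@lebesgue_measure K]_(r in `[s, t]) (c * expR (lam * (t - r)))
  <= c / lam * expR (lam * (t - s)).
Proof.
move=> lam0 c0 st.
have E r : lam * (t - r) = (- lam) * r + lam * t by ring.
under eq_Rintegral do rewrite E.
rewrite RintegralZl//; last first.
  apply: continuous_compact_integrable; first exact: segment_compact.
  apply: continuous_subspaceT => x.
  apply: continuous_comp; last exact: continuous_expR.
  by apply: cvgD; [apply: cvgM; [exact: cvg_cst|exact: cvg_id]|exact: cvg_cst].
rewrite Rintegral_expR_affine ?oppr_eq0 ?gt_eqF// -E -E subrr mulr0 expR0.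
have li : 0 <= lam^-1 by rewrite invr_ge0 ltW.
by rewrite -mulrA ler_wpM2l// invrN mulrN -mulNr opprB mulrC ler_wpM2l// gerBl.
Qed.

(** Mirror image for equations that run forward in time, namely the state equation. *)
Lemma Rintegral_exp_head (lam c s t : K) : 0 < lam -> 0 <= c -> s <= t ->
  \int[@lebesgue_measure K]_(r in `[s, t]) (c * expR (lam * (r - s)))
  <= c / lam * expR (lam * (t - s)).
Proof.
move=> lam0 c0 st.
have E r : lam * (r - s) = lam * r + - (lam * s) by ring.
under eq_Rintegral do rewrite E.
rewrite RintegralZl//; last first.
  apply: continuous_compact_integrable; first exact: segment_compact.
  apply: continuous_subspaceT => x.
  apply: continuous_comp; last exact: continuous_expR.
  by apply: cvgD; [apply: cvgM; [exact: cvg_cst|exact: cvg_id]|exact: cvg_cst].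
rewrite Rintegral_expR_affine ?gt_eqF// -E -E subrr mulr0 expR0.
have li : 0 <= lam^-1 by rewrite invr_ge0 ltW.
by rewrite -mulrA ler_wpM2l// mulrC ler_wpM2l// gerBl.
Qed.

End WeightedFixpoint.

(** * Linear flows *)

Section Flows.
Context {K : realType} (a b : K).
Hypothesis ab : a < b.

Lemma in_itv_sub (c d r : K) : a <= c -> d <= b -> r \in `[c, d] -> r \in `[a, b].
Proof.
by rewrite !in_itv/= => ac db /andP[cr rd]; rewrite (le_trans ac)// (le_trans rd).
Qed.

Lemma within_itv_continuous_at (V : normedModType K) (f : K -> V) t :
  {within `[a, b], continuous f} -> t \in `]a, b[ -> {for t, continuous f}.
Proof. by move=> /(continuous_within_itvP _ ab)[+ _ _]; exact. Qed.

Lemma within_itv_sub (V : normedModType K) (f : K -> V) c d :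
  a <= c -> d <= b -> {within `[a, b], continuous f} ->
  {within `[c, d], continuous f}.
Proof. by move=> ac db; apply: continuous_subspaceW => r; exact: in_itv_sub. Qed.

(** Induction on the list of exceptional points: the mean value theorem when none is left, and
    otherwise a point inside the interval splits it into two halves that share the value at that
    point. *)
Lemma cst_off_finite (Z : seq K) (f : K -> K) (c d : K) : c <= d ->
  {within `[c, d], continuous f} ->
  (forall s, s \in `]c, d[ -> s \notin Z -> is_derive s 1 f 0) -> f c = f d.
Proof.
elim: Z c d => [|z Z IH] c d cd cf df.
  have [x _] := MVT_segment cd (fun x xcd => df x xcd isT) cf.
  by rewrite mul0r => /eqP; rewrite subr_eq0 => /eqP.
have [zcd|zcd] := boolP (z \in `]c, d[); last first.
  apply: IH => // s scd sZ; apply: df => //; rewrite inE negb_or sZ andbT.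
  by apply: contraNneq zcd => <-.
move: (zcd); rewrite in_itv/= => /andP[/ltW cz /ltW zd].
have h (u v : K) : c <= u -> u <= v -> v <= d -> (v <= z) || (z <= u) -> f u = f v.
  move=> cu uv vd uvz; apply (IH u v uv).
    apply: continuous_subspaceW cf => r /=; rewrite !in_itv/= => /andP[ur rv].
    by rewrite (le_trans cu)// (le_trans rv).
  move=> s; rewrite in_itv/= => /andP[us sv] sZ; apply: df.
    by rewrite in_itv/= (le_lt_trans cu)// (lt_le_trans sv).
  rewrite inE negb_or sZ andbT; apply/eqP => sz.
  by move: uvz; rewrite -sz !leNgt us sv.
by rewrite (h c z) ?lexx// (h z d) ?lexx ?orbT.
Qed.

Lemma mx_cst_off_finite (Z : seq K) p q (f : K -> 'M[K]_(p, q)) (c d : K) : c <= d ->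
  {within `[c, d], continuous f} ->
  (forall s, s \in `]c, d[ -> s \notin Z -> is_derive s 1 f 0) -> f c = f d.
Proof.
move=> cd cf df; apply/matrixP => i j.
apply: (@cst_off_finite Z (fun s => f s i j)) => // [x|s scd sZ].
  by have /mx_cvgP := cf x; exact.
by have /is_derive_mxP/(_ i j) := df s scd sZ; rewrite mxE.
Qed.

(** Fixed point iteration started at the identity. By linearity the contraction holds without a
    ball, so the radius is simply taken to be 2[e]. *)
Lemma linear_volterra n (c : K -> 'M[K]_n) : bmeas a b c ->
  exists2 U, bmeas a b U & forall t, t \in `[a, b] ->
    U t = 1%:M + mxint t b (fun r => c r *m U r).
Proof.
move=> bc; have [_ [C0 cC0]] := bc; pose C : K := `|C0|; have Cge0 : 0 <= C by rewrite /C.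
have cC r : r \in `[a, b] -> `|c r| <= C.
  by move=> /cC0/le_trans; apply; exact: ler_norm.
(* Makes the contraction factor n C / [lam] at most 1/2. *)
pose lam : K := 2 * (n%:R * C) + 1.
have nC0 : 0 <= n%:R * C by rewrite mulr_ge0.
have lam0 : 0 < lam by rewrite /lam; lra.
pose w t := expR (lam * (b - t)).
pose F (U : K -> 'M[K]_n) t := 1%:M + mxint t b (fun r => c r *m U r).
(* A bound on the first step, the integral of [c] times the identity. *)
pose e : K := n%:R * (C * `|(1%:M : 'M[K]_n)|) * (b - a).
have ba0 : 0 <= b - a by rewrite subr_ge0 ltW.
have e0 : 0 <= e by rewrite /e !mulr_ge0.
have bcU U t : bmeas a b U -> t \in `[a, b] -> bmeas t b (fun r => c r *m U r).
  move=> bU; rewrite in_itv/= => /andP[at_ tb].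
  by apply: (@bmeas_sub _ a b) => //; exact: bmeas_mul.
have wge1 r : r \in `[a, b] -> 1 <= w r.
  rewrite in_itv/= => /andP[_ rb]; rewrite /w -expR0 ler_expR mulr_ge0 ?subr_ge0//.
  exact: ltW.
have [] := @weighted_fixpoint K n n a b w (expR (lam * (b - a))) (2 * e) e F (fun=> 1%:M).
- move=> r; rewrite in_itv/= => /andP[ar _]; rewrite expR_ge0 ler_expR.
  by rewrite ler_wpM2l ?(ltW lam0)// lerD2l lerN2.
- exact: e0.
- by [].
- exact: bmeas_cst.
- move=> W bW _; apply: bmeas_add; first exact: bmeas_cst.
  by apply: within_bmeas; apply: mxint_tail_cvg; exact: bmeas_mul.
- move=> W1 W2 d b1 b2 _ _ d0 W12 t tab.
  rewrite /F opprD addrACA subrr add0r -mxintB; [|exact: bcU|exact: bcU].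
  move: (tab); rewrite in_itv/= => /andP[at_ tb].
  have g r : r \in `[t, b] -> `|c r *m W1 r - c r *m W2 r|
      <= n%:R * (C * d) * expR (lam * (b - r)).
    move=> /(in_itv_sub at_ (lexx b)) rab; rewrite -mulmxBr.
    rewrite (le_trans (mx_norm_mul _ _))// -!mulrA ler_wpM2l//.
    by rewrite ler_pM ?cC// W12.
  apply: le_trans (mxint_norm_le _ _ g) _.
  + apply: bmeas_add; first exact: bcU.
    by apply: bmeas_opp; exact: bcU.
  + apply: continuous_subspaceT => x; apply: cvgM; first exact: cvg_cst.
    apply: continuous_comp; last exact: continuous_expR.
    apply: cvgM; first exact: cvg_cst.
    by apply: cvgB; [exact: cvg_cst|exact: cvg_id].
  apply: le_trans (Rintegral_exp_tail lam0 _ tb) _; first by rewrite !mulr_ge0.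
  rewrite ler_wpM2r ?expR_ge0// ler_pdivrMr// mulrA [leRHS]mulrAC.
  by rewrite [leLHS]mulrC -mulrA ler_wpM2l// /lam; lra.
- move=> t tab; rewrite /F addrC addKr.
  move: (tab); rewrite in_itv/= => /andP[at_ tb].
  apply: (@le_trans _ _ e); last first.
    by rewrite ler_peMr ?wge1.
  have h r : r \in `[t, b] ->
      `|c r *m (1%:M : 'M[K]_n)| <= n%:R * (C * `|(1%:M : 'M[K]_n)|).
    move=> /(in_itv_sub at_ (lexx b)) rab.
    by rewrite (le_trans (mx_norm_mul _ _))// ler_wpM2l// ler_wpM2r// cC.
  apply: le_trans (mxint_norm_cst tb (bcU _ _ _ (bmeas_cst _ _ _) tab) h) _.
  by rewrite /e ler_wpM2l ?mulr_ge0// lerD2l lerN2.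
by move=> U [bU _ FU]; exists U.
Qed.

(* U(b) = V(b) = I, U' = c U and V' = - V c, so that U s *m V t is the
   state transition map from t to s. *)
Definition flow n (c U V : K -> 'M[K]_n) : Prop :=
  [/\ bmeas a b U, bmeas a b V,
      forall t, t \in `[a, b] -> U t = 1%:M - mxint t b (fun r => c r *m U r)
    & forall t, t \in `[a, b] -> V t = 1%:M + mxint t b (fun r => V r *m c r)].

(** [U] comes from the coefficient [- c]; [V] is the transpose of the solution for [c^T], since
    transposing moves the coefficient to the other side. *)
Lemma flow_exists n (c : K -> 'M[K]_n) : bmeas a b c ->
  exists U V, flow c U V.
Proof.
move=> bc.
have [U bU hU] := linear_volterra (bmeas_opp bc).
have [V bV hV] := linear_volterra (bmeas_tr bc).
exists U, (fun t => (V t)^T); split => //; first exact: bmeas_tr.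
  move=> t tab; rewrite hU//; congr (_ + _); rewrite -mxintN.
    by apply: mxint_ext => r _; rewrite mulNmx.
  apply: (@bmeas_sub _ a b) => //; last exact: bmeas_mul.
  by move: tab; rewrite in_itv/= => /andP[].
move=> t tab; rewrite hV// linearD/= trmx1 -mxint_tr; congr (_ + _).
by apply: mxint_ext => r _; rewrite trmx_mul trmxK.
Qed.

Section FlowTheory.
Context n (c U V : K -> 'M[K]_n).
Hypotheses (bc : bmeas a b c) (UV : flow c U V).

Lemma flow_end : U b = 1%:M /\ V b = 1%:M.
Proof.
have [_ _ hU hV] := UV; have bab : b \in `[a, b] by rewrite in_itv/= lexx ltW.
by rewrite hU// hV// !mxint_point subr0 addr0.
Qed.

Lemma flow_continuousU : {within `[a, b], continuous U}.
Proof.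
have [bU bV hU hV] := UV => x.
apply: (@subspace_eq_continuous _ _ _ (fun t => 1%:M - mxint t b (fun r => c r *m U r))).
  by move=> r; rewrite inE/= => rab; rewrite /from_subspace/= hU.
move=> y; apply: cvgB; first exact: cvg_cst.
by apply: mxint_tail_cvg; exact: bmeas_mul.
Qed.

Lemma flow_continuousV : {within `[a, b], continuous V}.
Proof.
have [bU bV hU hV] := UV => x.
apply: (@subspace_eq_continuous _ _ _ (fun t => 1%:M + mxint t b (fun r => V r *m c r))).
  by move=> r; rewrite inE/= => rab; rewrite /from_subspace/= hV.
move=> y; apply: cvgD; first exact: cvg_cst.
by apply: mxint_tail_cvg; exact: bmeas_mul.
Qed.

Lemma flow_deriveU t : t \in `]a, b[ -> {for t, continuous c} ->
  is_derive t 1 U (c t *m U t).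
Proof.
move=> tab ct; have [bU bV hU hV] := UV.
have Ut := within_itv_continuous_at flow_continuousU tab.
have h := is_derive_mxint_tail (bmeas_mul bc bU) tab (mulmx_continuous_at ct Ut).
have {}h := is_deriveB (is_derive_cst (1%:M : 'M[K]_n) t 1) h.
rewrite sub0r opprK in h; apply: near_eq_is_derive h.
near=> s; rewrite hU//; near: s; move: tab; rewrite in_itv/= => /andP[at_ tb].
near=> s; rewrite in_itv/=; apply/andP; split; near: s;
  [exact: lt_le_nbhsr|exact: lt_le_nbhsl].
Unshelve. all: by end_near. Qed.

Lemma flow_deriveV t : t \in `]a, b[ -> {for t, continuous c} ->
  is_derive t 1 V (- (V t *m c t)).
Proof.
move=> tab ct; have [bU bV hU hV] := UV.
have Vt := within_itv_continuous_at flow_continuousV tab.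
have h := is_derive_mxint_tail (bmeas_mul bV bc) tab (mulmx_continuous_at Vt ct).
have {}h := is_deriveD (is_derive_cst (1%:M : 'M[K]_n) t 1) h.
rewrite add0r in h; apply: near_eq_is_derive h.
near=> s; rewrite hV//; near: s; move: tab; rewrite in_itv/= => /andP[at_ tb].
near=> s; rewrite in_itv/=; apply/andP; split; near: s;
  [exact: lt_le_nbhsr|exact: lt_le_nbhsl].
Unshelve. all: by end_near. Qed.

(** The jumps of the coefficient: the nodes of the partition for the game, and the empty list for
    the given system. *)
Variable Z : seq K.
Hypothesis cZ : forall t, t \in `]a, b[ -> t \notin Z -> {for t, continuous c}.

(** [V] is an integrating factor: off [Z] the derivative of V X is - V c X + V c X = 0, and
    continuity bridges the points of [Z]. *)
Lemma flow_transport q (X : K -> 'M[K]_(n, q)) t s :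
  a <= t -> t <= s -> s <= b -> {within `[t, b], continuous X} ->
  (forall r, r \in `]t, b[ -> r \notin Z -> is_derive r 1 X (c r *m X r)) ->
  V s *m X s = V t *m X t.
Proof.
move=> at_ ts sb cX dX; apply/esym.
apply: (@mx_cst_off_finite Z _ _ (fun r => V r *m X r)) => //.
  move=> x; apply: mulmx_cvg.
    by apply: (within_itv_sub at_ sb flow_continuousV).
  by move: x; apply: continuous_subspaceW cX => r /=;
    rewrite !in_itv/= => /andP[-> /le_trans]; exact.
move=> r; rewrite in_itv/= => /andP[tr rs] rZ.
have rab : r \in `]a, b[ by rewrite in_itv/= (le_lt_trans at_)// (lt_le_trans rs).
have dV := flow_deriveV rab (cZ rab rZ).
have rtb : r \in `]t, b[ by rewrite in_itv/= tr (lt_le_trans rs).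
have h := is_derive_mulmx dV (dX _ rtb rZ).
by apply: is_derive_eq h _; rewrite mulNmx mulmxA addrC subrr.
Qed.

(** Transport of X = [U] up to [b], where both factors are the identity. *)
Lemma flow_VU t : t \in `[a, b] -> V t *m U t = 1%:M.
Proof.
rewrite in_itv/= => /andP[at_ tb]; have [Ub Vb] := flow_end.
have cU : {within `[t, b], continuous U}.
  exact: within_itv_sub at_ (lexx b) flow_continuousU.
have dU r : r \in `]t, b[ -> r \notin Z -> is_derive r 1 U (c r *m U r).
  rewrite in_itv/= => /andP[tr rb] rZ.
  have rab : r \in `]a, b[ by rewrite in_itv/= (le_lt_trans at_).
  exact: flow_deriveU (cZ rab rZ).
by rewrite -(flow_transport at_ tb (lexx b) cU dU) Ub Vb mulmx1.
Qed.

Lemma flow_UV t : t \in `[a, b] -> U t *m V t = 1%:M.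
Proof. by move=> tab; rewrite mulmx1C// flow_VU. Qed.

Lemma flow_unique q (X : K -> 'M[K]_(n, q)) t s :
  a <= t -> t <= s -> s <= b -> {within `[t, b], continuous X} ->
  (forall r, r \in `]t, b[ -> r \notin Z -> is_derive r 1 X (c r *m X r)) ->
  X s = U s *m V t *m X t.
Proof.
move=> at_ ts sb cX dX; rewrite -mulmxA -(flow_transport at_ ts sb cX dX).
by rewrite mulmxA flow_UV ?mul1mx// in_itv/= sb (le_trans at_).
Qed.

Lemma flow_forward t s : a <= t -> t <= s -> s <= b ->
  U s = U t + mxint t s (fun r => c r *m U r).
Proof.
move=> at_ ts sb; have [bU _ hU _] := UV.
rewrite [U s]hU ?in_itv/= ?(le_trans at_)// [U t]hU ?in_itv/= ?at_ ?(le_trans ts)//.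
rewrite (@mxint_cat _ _ _ t s b)//; first by rewrite opprD addrA addrAC subrK.
by apply: (@bmeas_sub _ a b) => //; exact: bmeas_mul.
Qed.

End FlowTheory.

End Flows.

(** * The Volterra operator with frozen coefficients *)

Section ContinuityOnSets.
Context {K : realType}.

Lemma within_comp (S1 S2 V : topologicalType) (D1 : set S1) (D2 : set S2)
    (g : S1 -> S2) (f : S2 -> V) :
  {within D1, continuous g} -> (forall x, D1 x -> D2 (g x)) ->
  {within D2, continuous f} -> {within D1, continuous (f \o g)}.
Proof.
move=> cg gD cf; apply/subspace_continuousP => x D1x.
have /subspace_continuousP/(_ _ (gD _ D1x)) fx := cf.
have /subspace_continuousP/(_ _ D1x) gx := cg.
apply: (@cvg_comp _ _ _ g f _ (within D2 (nbhs (g x)))) fx => U hU.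
have {}gx : nbhs x [set y | D1 y -> D2 (g y) -> U (g y)] by exact: (gx _ hU).
suff : nbhs x [set y | D1 y -> U (g y)] by [].
by apply: filterS gx => y /= h D1y; apply: h => //; exact: gD.
Qed.

Section Square.
Variables (T : K) (p q : nat) (F : K -> K -> 'M[K]_(p, q)).
Hypothesis cF : {within square T, continuous (fun x : K * K => F x.1 x.2)}.

Lemma square_bounded :
  exists C, forall t s : K, t \in `[0, T] -> s \in `[0, T] -> `|F t s| <= C.
Proof.
have cS : compact (square T).
  by apply: compact_setX; exact: segment_compact.
have /compact_bounded[M [Mr FM]] := continuous_compact cF cS.
by exists (M + 1) => t s tT sT; apply: FM; [rewrite ltrDl|exists (t, s)].
Qed.

Lemma square_slice (t : K) : t \in `[0, T] -> {within `[0, T], continuous (F t)}.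
Proof.
move=> tT; apply: (@within_comp _ _ _ _ (square T) (fun s => (t, s))) cF => //.
apply: continuous_subspaceT => s.
exact: (@cvg_pair _ _ _ _ _ _ _ _ _ (cst t) id (cvg_cst t) cvg_id).
Qed.

Lemma square_diag : {within `[0, T], continuous (fun r => F r r)}.
Proof.
apply: (@within_comp _ _ _ _ (square T) (fun s => (s, s))) cF => //.
apply: continuous_subspaceT => s.
exact: (@cvg_pair _ _ _ _ _ _ _ _ _ id id cvg_id cvg_id).
Qed.

End Square.

Lemma within_mulmx (S : topologicalType) (D : set S) p q r
    (f : S -> 'M[K]_(p, q)) (g : S -> 'M[K]_(q, r)) :
  {within D, continuous f} -> {within D, continuous g} ->
  {within D, continuous (fun s => f s *m g s)}.
Proof. by move=> cf cg x; apply: mulmx_cvg; [exact: cf|exact: cg]. Qed.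

Lemma within_trmx (S : topologicalType) (D : set S) p q (f : S -> 'M[K]_(p, q)) :
  {within D, continuous f} -> {within D, continuous (fun s => (f s)^T)}.
Proof. by move=> cf x; apply: trmx_cvg; exact: cf. Qed.

Lemma within_add (S : topologicalType) (D : set S) p q (f g : S -> 'M[K]_(p, q)) :
  {within D, continuous f} -> {within D, continuous g} ->
  {within D, continuous (fun s => f s + g s)}.
Proof. by move=> cf cg x; apply: cvgD; [exact: cf|exact: cg]. Qed.

Lemma within_invmx (S : topologicalType) (D : set S) m (f : S -> 'M[K]_m) delta :
  0 < delta -> (forall s, D s -> psd_le delta%:M (f s)) ->
  {within D, continuous f} -> {within D, continuous (fun s => invmx (f s))}.
Proof.
move=> d0 fd cf; apply/subspace_continuousP => x Dx.
apply: (@invmx_cvg _ _ _ _ _ _ _ delta) => //; first exact: fd.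
  by rewrite near_withinE; apply: nearW => y; exact: fd.
by move/subspace_continuousP : cf; exact.
Qed.

End ContinuityOnSets.

(* Index types for [ubnd] and [uclose]: the constants are uniform over them. *)
Record rate_index (K : Type) (p q : nat) := RateIndex {
  ri_th : K; ri_th' : K; ri_tau : K; ri_tau' : K; ri_r : K;
  ri_W : 'M[K]_(p, q); ri_W' : 'M[K]_(p, q) }.

Record read_index (K : Type) (p : nat) := ReadIndex {
  di_th : K; di_th' : K;
  di_V : 'M[K]_p; di_V' : 'M[K]_p; di_J : 'M[K]_p; di_J' : 'M[K]_p }.

(* Syntactic matching: unification up to conversion would unfold the matrix
   operations. *)
Ltac ubnd_step := match goal with
  | H : ?P |- ?P => exact H
  | |- ubnd _ (fun i => @?f i + @?g i) => apply: ubnd_add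
  | |- ubnd _ (fun i => - @?f i) => apply: ubnd_opp
  | |- ubnd _ (fun i => @?f i *m @?g i) => apply: ubnd_mul
  | |- ubnd _ (fun i => (@?f i)^T) => apply: ubnd_tr
  end.
Ltac uclose_step := match goal with
  | H : ?P |- ?P => exact H
  | |- uclose _ _ (fun i => @?f i + @?g i) _ => apply: uclose_add
  | |- uclose _ _ (fun i => - @?f i) _ => apply: uclose_opp
  | |- uclose _ _ (fun i => @?f i *m @?g i) _ => apply: uclose_mul
  | |- uclose _ _ (fun i => (@?f i)^T) _ => apply: uclose_tr
  end.

Record lq_hyps {K : realType} {n m : nat} (T : K)
    (A : K -> K -> 'M[K]_n) (B : K -> K -> 'M[K]_(n, m))
    (Q : K -> K -> 'M[K]_n) (R : K -> K -> 'M[K]_m) (G : K -> 'M[K]_n)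
    (L delta : K) : Prop := LqHyps {
  lq_T_gt0 : 0 < T;
  lq_A_cont : {within square T, continuous (fun p : K * K => A p.1 p.2)};
  lq_B_cont : {within square T, continuous (fun p : K * K => B p.1 p.2)};
  lq_Q_cont : {within square T, continuous (fun p : K * K => Q p.1 p.2)};
  lq_R_cont : {within square T, continuous (fun p : K * K => R p.1 p.2)};
  lq_G_cont : {within `[0, T], continuous G};
  lq_L_gt0 : 0 < L;
  lq_delta_gt0 : 0 < delta;
  lq_lip : forall s t r : K,
    s \in `[0, T] -> t \in `[0, T] -> r \in `[0, T] ->
    `|A t s - A r s| + `|B t s - B r s| + `|Q t s - Q r s|
      + `|R t s - R r s| + `|G t - G r| <= L * `|t - r|;
  lq_R_pd : forall t s : K, t \in `[0, T] -> s \in `[0, T] ->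
    psd_le delta%:M (R t s);
  lq_Q_sym : forall t s : K, t \in `[0, T] -> s \in `[0, T] -> symm (Q t s);
  lq_R_sym : forall t s : K, t \in `[0, T] -> s \in `[0, T] -> symm (R t s);
  lq_G_sym : forall t : K, t \in `[0, T] -> symm (G t) }.

Section System.
Context {K : realType} {n m : nat} (T : K).
Variables (A : K -> K -> 'M[K]_n) (B : K -> K -> 'M[K]_(n, m)).
Variables (Q : K -> K -> 'M[K]_n) (R : K -> K -> 'M[K]_m) (G : K -> 'M[K]_n).
Variables (L delta : K).

Definition gainK (t r : K) : 'M[K]_(m, n) := invmx (R t r) *m (B t r)^T.

Definition closed_loop (P : K -> 'M[K]_n) (sigma : K -> K) (r : K) : 'M[K]_n :=
  A (sigma r) r - B (sigma r) r *m (gainK (sigma r) r *m P r).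

(** The weights are those of the player who pays, frozen at [th], while the feedback is that of the
    player who acts at time [r], frozen at [tau]. The two differ beyond the current interval, and
    this is the time inconsistency of the problem. *)
Definition running (th tau r : K) (P : 'M[K]_n) : 'M[K]_n :=
  Q th r + (gainK tau r *m P)^T *m R th r *m (gainK tau r *m P).

(* A candidate (U, V, P) is stacked into one matrix. *)
Local Notation stack := 'M[K]_(n + (n + n), n).
Definition stU (W : stack) : 'M[K]_n := usubmx W.
Definition stV (W : stack) : 'M[K]_n := usubmx (dsubmx W).
Definition stP (W : stack) : 'M[K]_n := dsubmx (dsubmx W).

Definition drift (tau r : K) (W : stack) : 'M[K]_n :=
  A tau r - B tau r *m (gainK tau r *m stP W).
Definition rateU (tau r : K) (W : stack) := drift tau r W *m stU W.
Definition rateV (tau r : K) (W : stack) := stV W *m drift tau r W.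
Definition rateP (th tau r : K) (W : stack) :=
  (stU W)^T *m running th tau r (stP W) *m stU W.
(** Since U(T) = I, Phi(T; t) is V(t); this factor also leaves the integral, whose remaining part is
    [J]. *)
Definition readP (th : K) (V J : 'M[K]_n) := V^T *m (G th + J) *m V.

(* The fixed points of [volterra_op sigma] are the triples (U, V, P) such that
   Phi(s; t) = U(s) V(t) and P solve the system whose coefficients are frozen
   at sigma: sigma = id gives the equilibrium Volterra system, and
   sigma = left_node D the Riccati equations of the game. *)
Definition volterra_op (sigma : K -> K) (W : K -> stack) (t : K) : stack :=
  let V := 1%:M + mxint t T (fun r => rateV (sigma r) r (W r)) in
  col_mx (1%:M - mxint t T (fun r => rateU (sigma r) r (W r)))
    (col_mx V (readP (sigma t) V
      (mxint t T (fun r => rateP (sigma t) (sigma r) r (W r))))).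

Hypothesis H : lq_hyps T A B Q R G L delta.
Let T_gt0 := lq_T_gt0 H.
Let B_cont := lq_B_cont H.
Let G_cont := lq_G_cont H.
Let delta_gt0 := lq_delta_gt0 H.
Let L_gt0 := lq_L_gt0 H.
Let R_pd := lq_R_pd H.
Let lip := lq_lip H.

Section Estimates.
Context {I : Type} (Om : set I) (e : I -> K) (t t' r : I -> K).
Hypothesis tT : forall i, Om i -> t i \in `[0, T].
Hypothesis t'T : forall i, Om i -> t' i \in `[0, T].
Hypothesis rT : forall i, Om i -> r i \in `[0, T].
Hypothesis tt' : forall i, Om i -> `|t i - t' i| <= e i.

Lemma ubnd_coeffs : [/\ ubnd Om (fun i => A (t i) (r i)),
  ubnd Om (fun i => B (t i) (r i)), ubnd Om (fun i => Q (t i) (r i)),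
  ubnd Om (fun i => R (t i) (r i)) & ubnd Om (fun i => G (t i))].
Proof.
have h p q (F : K -> K -> 'M[K]_(p, q)) :
    {within square T, continuous (fun x : K * K => F x.1 x.2)} ->
    ubnd Om (fun i => F (t i) (r i)).
  move=> /square_bounded[C FC]; apply: (@ubnd_le _ _ _ _ _ _ C) => i Oi.
  by apply: FC; [exact: tT|exact: rT].
split; [exact: h (lq_A_cont H)|exact: h B_cont|exact: h (lq_Q_cont H)|
  exact: h (lq_R_cont H)|].
have [_ [C GC]] := within_bmeas G_cont.
by apply: (@ubnd_le _ _ _ _ _ _ C) => i Oi; apply: GC; exact: tT.
Qed.

Lemma uclose_coeffs : [/\
  uclose Om e (fun i => A (t i) (r i)) (fun i => A (t' i) (r i)),
  uclose Om e (fun i => B (t i) (r i)) (fun i => B (t' i) (r i)),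
  uclose Om e (fun i => Q (t i) (r i)) (fun i => Q (t' i) (r i)),
  uclose Om e (fun i => R (t i) (r i)) (fun i => R (t' i) (r i))
  & uclose Om e (fun i => G (t i)) (fun i => G (t' i))].
Proof.
have h i : Om i -> L * `|t i - t' i| <= L * e i.
  by move=> Oi; rewrite ler_wpM2l ?(ltW L_gt0)// tt'.
have L0 := ltW L_gt0.
have key i : Om i -> `|A (t i) (r i) - A (t' i) (r i)|
    + `|B (t i) (r i) - B (t' i) (r i)| + `|Q (t i) (r i) - Q (t' i) (r i)|
    + `|R (t i) (r i) - R (t' i) (r i)| + `|G (t i) - G (t' i)| <= L * e i.
  by move=> Oi; apply: le_trans (lip (rT Oi) (tT Oi) (t'T Oi)) (h i Oi).
have s5 (u v x y z : K) : 0 <= u -> 0 <= v -> 0 <= x -> 0 <= y -> 0 <= z ->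
    [/\ u <= u + v + x + y + z, v <= u + v + x + y + z, x <= u + v + x + y + z,
      y <= u + v + x + y + z & z <= u + v + x + y + z].
  by move=> *; split; lra.
by split; exists L => // i /key; apply: le_trans;
  have [] := s5 `|A (t i) (r i) - A (t' i) (r i)| `|B (t i) (r i) - B (t' i) (r i)|
    `|Q (t i) (r i) - Q (t' i) (r i)| `|R (t i) (r i) - R (t' i) (r i)|
    `|G (t i) - G (t' i)| (normr_ge0 _) (normr_ge0 _) (normr_ge0 _) (normr_ge0 _)
    (normr_ge0 _).
Qed.

Lemma uclose_gainK : uclose Om e (fun i => gainK (t i) (r i))
  (fun i => gainK (t' i) (r i)).
Proof.
have [_ ucB _ ucR _] := uclose_coeffs; have [_ uB _ _ _] := ubnd_coeffs.
have uB' : ubnd Om (fun i => B (t' i) (r i)).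
  have [C BC] := square_bounded B_cont.
  by apply: (@ubnd_le _ _ _ _ _ _ C) => i Oi; apply: BC; [exact: t'T|exact: rT].
apply: uclose_mul => //.
- by apply: (@ubnd_inv _ _ _ _ _ delta) => // i Oi; apply: R_pd; [exact: tT|exact: rT].
- exact: ubnd_tr.
- apply: (@uclose_inv _ _ _ _ _ _ _ delta) => // i Oi; apply: R_pd;
    by [exact: tT|exact: rT|exact: t'T].
- exact: uclose_tr.
Qed.

Lemma ubnd_gainK : ubnd Om (fun i => gainK (t i) (r i)).
Proof.
have [_ uB _ _ _] := ubnd_coeffs; apply: ubnd_mul; last exact: ubnd_tr.
by apply: (@ubnd_inv _ _ _ _ _ delta) => // i Oi; apply: R_pd; [exact: tT|exact: rT].
Qed.

End Estimates.

Definition rate_dom M : set (rate_index K (n + (n + n)) n) := [set i |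
  [/\ ri_th i \in `[0, T], ri_th' i \in `[0, T], ri_tau i \in `[0, T],
      ri_tau' i \in `[0, T] & ri_r i \in `[0, T]]
  /\ `|ri_W i| <= M /\ `|ri_W' i| <= M].

Definition rate_err (i : rate_index K (n + (n + n)) n) : K :=
  `|ri_th i - ri_th' i| + `|ri_tau i - ri_tau' i| + `|ri_W i - ri_W' i|.

(** The rates are polynomial in the coefficients, the gains and the blocks of [W], hence Lipschitz
    on bounded sets; [M] is the size of such a set. The two frozen times vary separately because one
    follows the outer variable and the other the integration variable. *)
Lemma rate_estimates M : exists2 C, 0 <= C &
  forall (th th' tau tau' r : K) (W W' : stack),
  th \in `[0, T] -> th' \in `[0, T] -> tau \in `[0, T] -> tau' \in `[0, T] ->
  r \in `[0, T] -> `|W| <= M -> `|W'| <= M ->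
  let e := `|th - th'| + `|tau - tau'| + `|W - W'| in
  [/\ `|rateU tau r W - rateU tau' r W'| <= C * e,
      `|rateV tau r W - rateV tau' r W'| <= C * e,
      `|rateP th tau r W - rateP th' tau' r W'| <= C * e,
      `|rateU tau r W| <= C & `|rateV tau r W| <= C /\ `|rateP th tau r W| <= C].
Proof.
pose Om := rate_dom M; pose e := rate_err.
have e0 i : Om i -> 0 <= e i by move=> _; rewrite !addr_ge0.
have thT i : Om i -> ri_th i \in `[0, T] by move=> [[]].
have th'T i : Om i -> ri_th' i \in `[0, T] by move=> [[]].
have tauT i : Om i -> ri_tau i \in `[0, T] by move=> [[]].
have tau'T i : Om i -> ri_tau' i \in `[0, T] by move=> [[]].
have rT i : Om i -> ri_r i \in `[0, T] by move=> [[]].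
have the i : Om i -> `|ri_th i - ri_th' i| <= e i.
  by move=> _; rewrite /e /rate_err -addrA lerDl addr_ge0.
have taue i : Om i -> `|ri_tau i - ri_tau' i| <= e i.
  by move=> _; rewrite /e /rate_err addrAC lerDr addr_ge0.
have We i : Om i -> `|ri_W i - ri_W' i| <= e i.
  by move=> _; rewrite /e /rate_err lerDr addr_ge0.
have [_ _ ubQ ubR _] := ubnd_coeffs thT rT.
have [_ _ ubQ' ubR' _] := ubnd_coeffs th'T rT.
have [ubA ubB _ _ _] := ubnd_coeffs tauT rT.
have [ubA' ubB' _ _ _] := ubnd_coeffs tau'T rT.
have ubK := ubnd_gainK tauT rT; have ubK' := ubnd_gainK tau'T rT.
have [_ _ ucQ ucR _] := uclose_coeffs thT th'T rT the.
have [ucA ucB _ _ _] := uclose_coeffs tauT tau'T rT taue.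
have ucK := uclose_gainK tauT tau'T rT taue.
have ub (g : stack -> 'M[K]_n) (w : rate_index K (n + (n + n)) n -> stack) :
    (forall W, `|g W| <= `|W|) -> (forall i, Om i -> `|w i| <= M) ->
    ubnd Om (fun i => g (w i)).
  move=> gW wM; apply: (@ubnd_le _ _ _ _ _ _ M) => i Oi.
  exact: le_trans (gW _) (wM _ Oi).
have uc (g : stack -> 'M[K]_n) : {morph g : x y / x - y} ->
    (forall W, `|g W| <= `|W|) ->
    uclose Om e (fun i => g (ri_W i)) (fun i => g (ri_W' i)).
  move=> gB gW; exists 1 => // i Oi; rewrite mul1r -gB.
  exact: le_trans (gW _) (We _ Oi).
have WM i : Om i -> `|ri_W i| <= M by move=> [_ []].
have W'M i : Om i -> `|ri_W' i| <= M by move=> [_ []].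
have nU W : `|stU W| <= `|W| by exact: mx_norm_usub.
have nV W : `|stV W| <= `|W|.
  exact: le_trans (mx_norm_usub _) (mx_norm_dsub _).
have nP W : `|stP W| <= `|W|.
  exact: le_trans (mx_norm_dsub _) (mx_norm_dsub _).
have ubU := ub _ _ nU WM; have ubU' := ub _ _ nU W'M.
have ubV := ub _ _ nV WM; have ubV' := ub _ _ nV W'M.
have ubP := ub _ _ nP WM; have ubP' := ub _ _ nP W'M.
have ucU : uclose Om e (fun i => stU (ri_W i)) (fun i => stU (ri_W' i)).
  apply: uc nU => x y; exact: linearB.
have ucV : uclose Om e (fun i => stV (ri_W i)) (fun i => stV (ri_W' i)).
  apply: uc nV => x y; by rewrite /stV linearB linearB.
have ucP : uclose Om e (fun i => stP (ri_W i)) (fun i => stP (ri_W' i)).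
  apply: uc nP => x y; by rewrite /stP linearB linearB.
have [C1 C10 h1] : uclose Om e (fun i => rateU (ri_tau i) (ri_r i) (ri_W i))
    (fun i => rateU (ri_tau' i) (ri_r i) (ri_W' i)).
  by rewrite /rateU /drift; repeat first [uclose_step|ubnd_step].
have [C2 C20 h2] : uclose Om e (fun i => rateV (ri_tau i) (ri_r i) (ri_W i))
    (fun i => rateV (ri_tau' i) (ri_r i) (ri_W' i)).
  by rewrite /rateV /drift; repeat first [uclose_step|ubnd_step].
have [C3 C30 h3] : uclose Om e
    (fun i => rateP (ri_th i) (ri_tau i) (ri_r i) (ri_W i))
    (fun i => rateP (ri_th' i) (ri_tau' i) (ri_r i) (ri_W' i)).
  by rewrite /rateP /running; repeat first [uclose_step|ubnd_step].
have [C4 C40 h4] : ubnd Om (fun i => rateU (ri_tau i) (ri_r i) (ri_W i)).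
  by rewrite /rateU /drift; repeat ubnd_step.
have [C5 C50 h5] : ubnd Om (fun i => rateV (ri_tau i) (ri_r i) (ri_W i)).
  by rewrite /rateV /drift; repeat ubnd_step.
have [C6 C60 h6] : ubnd Om
    (fun i => rateP (ri_th i) (ri_tau i) (ri_r i) (ri_W i)).
  by rewrite /rateP /running; repeat ubnd_step.
exists (C1 + C2 + C3 + C4 + C5 + C6) => [|th th' tau tau' r W W' hth hth' htau
  htau' hr hW hW' d]; first by rewrite !addr_ge0.
pose i := RateIndex th th' tau tau' r W W'.
have Oi : Om i by split.
have d0 : 0 <= d by exact: (e0 i Oi).
have := h1 i Oi; have := h2 i Oi; have := h3 i Oi.
have := h4 i Oi; have := h5 i Oi; have := h6 i Oi => /= k6 k5 k4 k3 k2 k1.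
have le (c x : K) : x <= c * d -> c <= C1 + C2 + C3 + C4 + C5 + C6 ->
    x <= (C1 + C2 + C3 + C4 + C5 + C6) * d.
  by move=> xc cC; apply: le_trans xc _; rewrite ler_wpM2r.
split; [apply: le k1 _|apply: le k2 _|apply: le k3 _|apply: le_trans k4 _|
  split; [apply: le_trans k5 _|apply: le_trans k6 _]]; lra.
Qed.

Lemma readP_estimates N : exists2 C, 0 <= C &
  forall (th th' : K) (V V' J J' : 'M[K]_n),
  th \in `[0, T] -> th' \in `[0, T] ->
  `|V| <= N -> `|V'| <= N -> `|J| <= N -> `|J'| <= N ->
  `|readP th V J - readP th' V' J'|
    <= C * (`|th - th'| + `|V - V'| + `|J - J'|) /\ `|readP th V J| <= C.
Proof.
pose Om : set (read_index K n) := [set i |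
  [/\ di_th i \in `[0, T], di_th' i \in `[0, T] & [/\ `|di_V i| <= N,
      `|di_V' i| <= N, `|di_J i| <= N & `|di_J' i| <= N]]].
pose e (i : read_index K n) :=
  `|di_th i - di_th' i| + `|di_V i - di_V' i| + `|di_J i - di_J' i|.
have thT i : Om i -> di_th i \in `[0, T] by move=> [].
have th'T i : Om i -> di_th' i \in `[0, T] by move=> [].
have the i : Om i -> `|di_th i - di_th' i| <= e i.
  by move=> _; rewrite /e -addrA lerDl addr_ge0.
have [_ _ _ _ ubG] := ubnd_coeffs thT thT.
have [_ _ _ _ ubG'] := ubnd_coeffs th'T thT.
have [_ _ _ _ ucG] := uclose_coeffs thT th'T thT the.
have ubV : ubnd Om (@di_V K n).
  by apply: (@ubnd_le _ _ _ _ _ _ N) => i [_ _ []].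
have ubV' : ubnd Om (@di_V' K n).
  by apply: (@ubnd_le _ _ _ _ _ _ N) => i [_ _ []].
have ubJ : ubnd Om (@di_J K n).
  by apply: (@ubnd_le _ _ _ _ _ _ N) => i [_ _ []].
have ubJ' : ubnd Om (@di_J' K n).
  by apply: (@ubnd_le _ _ _ _ _ _ N) => i [_ _ []].
have ucV : uclose Om e (@di_V K n) (@di_V' K n).
  by exists 1 => // i _; rewrite mul1r /e addrAC lerDr addr_ge0.
have ucJ : uclose Om e (@di_J K n) (@di_J' K n).
  by exists 1 => // i _; rewrite mul1r /e lerDr addr_ge0.
have [C C0 hC] : uclose Om e (fun i => readP (di_th i) (di_V i) (di_J i))
    (fun i => readP (di_th' i) (di_V' i) (di_J' i)).
  by rewrite /readP; repeat first [uclose_step|ubnd_step].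
have [C' C'0 hC'] : ubnd Om (fun i => readP (di_th i) (di_V i) (di_J i)).
  by rewrite /readP; repeat ubnd_step.
exists (C + C') => [|th th' V V' J J' hth hth' hV hV' hJ hJ']; first exact: addr_ge0.
pose i := ReadIndex th th' V V' J J'.
have Oi : Om i by split.
have := hC i Oi; have := hC' i Oi => /= k' k.
split; last by apply: le_trans k' _; rewrite lerDr.
by apply: le_trans k _; rewrite ler_wpM2r ?lerDl// !addr_ge0.
Qed.

End System.

(** * Lipschitz dependence on the freezing and perturbation of the given solution *)

Section Perturbation.
Context {K : realType} {n m : nat} (T : K).
Variables (A : K -> K -> 'M[K]_n) (B : K -> K -> 'M[K]_(n, m)).
Variables (Q : K -> K -> 'M[K]_n) (R : K -> K -> 'M[K]_m) (G : K -> 'M[K]_n).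
Variables (L delta : K).
Hypothesis H : lq_hyps T A B Q R G L delta.
Let T_gt0 := lq_T_gt0 H.
Local Notation stack := 'M[K]_(n + (n + n), n).
Local Notation gainK := (gainK B R).
Local Notation rateU := (rateU A B R).
Local Notation rateV := (rateV A B R).
Local Notation rateP := (rateP B Q R).
Local Notation readP := (readP G).
Local Notation vop := (volterra_op T A B Q R G).

(** The second clause yields measurability along [sigma] from that of the slices at fixed first
    argument, with no joint measurability of [h]. This suits a [sigma] that takes finitely many
    values on intervals. *)
Definition tame (sigma : K -> K) : Prop :=
  (forall r : K, r \in `[0, T] -> sigma r \in `[0, T]) /\
  forall h : K -> K -> K,
    (forall th : K, th \in `[0, T] -> measurable_fun (`[0, T] : set K) (h th)) ->
    measurable_fun (`[0, T] : set K) (fun s => h (sigma s) s).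

Lemma tame_bmeas sigma p q (h : K -> K -> 'M[K]_(p, q)) C : tame sigma ->
  (forall th : K, th \in `[0, T] -> bmeas 0 T (h th)) ->
  (forall th s : K, th \in `[0, T] -> s \in `[0, T] -> `|h th s| <= C) ->
  bmeas 0 T (fun s => h (sigma s) s).
Proof.
move=> [sT ms] bh hC; split => [i j|]; last first.
  by exists C => r rT; apply: hC => //; exact: sT.
apply: (ms (fun th s => h th s i j)) => th thT.
by have [/(_ i j)] := bh th thT.
Qed.

Lemma slice_bmeas p q (F : K -> K -> 'M[K]_(p, q)) (th : K) :
  {within square T, continuous (fun x : K * K => F x.1 x.2)} ->
  th \in `[0, T] -> bmeas 0 T (F th).
Proof. by move=> cF thT; apply: within_bmeas; exact: square_slice cF _ thT. Qed.

(** The common ground of the two cases: the identity satisfies it by continuity on the diagonal,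
    [left_node D] by tameness. *)
Definition coef_bmeas (sigma : K -> K) : Prop :=
  [/\ forall r : K, r \in `[0, T] -> sigma r \in `[0, T],
      bmeas 0 T (fun r => A (sigma r) r), bmeas 0 T (fun r => B (sigma r) r)
    & bmeas 0 T (fun r => gainK (sigma r) r)].

Lemma gainK_continuous (f : K -> K) :
  (forall r : K, r \in `[0, T] -> f r \in `[0, T]) ->
  {within `[0, T], continuous (fun r => R (f r) r)} ->
  {within `[0, T], continuous (fun r => B (f r) r)} ->
  {within `[0, T], continuous (fun r => gainK (f r) r)}.
Proof.
move=> fT cR cB; apply: within_mulmx; last exact: within_trmx.
apply: (@within_invmx _ _ _ _ _ delta) => //; first exact: lq_delta_gt0 H.
by move=> s sT; apply: (lq_R_pd H) => //; exact: fT.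
Qed.

Lemma coef_bmeas_id : coef_bmeas id.
Proof.
split => //.
- by apply: within_bmeas; apply: square_diag; exact: lq_A_cont H.
- by apply: within_bmeas; apply: square_diag; exact: lq_B_cont H.
- apply: within_bmeas; apply: gainK_continuous => //; apply: square_diag.
    exact: lq_R_cont H.
  exact: lq_B_cont H.
Qed.

Lemma coef_bmeas_tame sigma : tame sigma -> coef_bmeas sigma.
Proof.
move=> ts; split; first by have [] := ts.
- have [C AC] := square_bounded (lq_A_cont H).
  by apply: (tame_bmeas ts _ AC) => th; exact: slice_bmeas (lq_A_cont H).
- have [C BC] := square_bounded (lq_B_cont H).
  by apply: (tame_bmeas ts _ BC) => th; exact: slice_bmeas (lq_B_cont H).
- have [C C0 KC] : ubnd [set x : K * K | x.1 \in `[0, T] /\ x.2 \in `[0, T]]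
      (fun x => gainK x.1 x.2).
    by apply: (ubnd_gainK H) => x [].
  apply: (tame_bmeas (h := gainK) (C := C) ts) => [th thT|th s thT sT].
    apply: within_bmeas; apply: (@gainK_continuous (cst th)) => //.
      exact: square_slice (lq_R_cont H) _ thT.
    exact: square_slice (lq_B_cont H) _ thT.
  exact: (KC (th, s)).
Qed.

Lemma bmeas_rates sigma W (th : K) : coef_bmeas sigma -> bmeas 0 T W ->
  th \in `[0, T] ->
  [/\ bmeas 0 T (fun r => rateU (sigma r) r (W r)),
      bmeas 0 T (fun r => rateV (sigma r) r (W r))
    & bmeas 0 T (fun r => rateP th (sigma r) r (W r))].
Proof.
move=> [sT bA bB bK] bW thT.
have bU : bmeas 0 T (fun r => stU (W r)) by exact: bmeas_usub.
have bV : bmeas 0 T (fun r => stV (W r)).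
  by apply: bmeas_usub; exact: bmeas_dsub.
have bP : bmeas 0 T (fun r => stP (W r)).
  by apply: bmeas_dsub; exact: bmeas_dsub.
have bKP : bmeas 0 T (fun r => gainK (sigma r) r *m stP (W r)).
  exact: bmeas_mul bK bP.
have bD : bmeas 0 T (fun r => drift A B R (sigma r) r (W r)).
  exact: bmeas_add bA (bmeas_opp (bmeas_mul bB bKP)).
split; [exact: bmeas_mul bD bU|exact: bmeas_mul bV bD|].
have bQ := slice_bmeas (lq_Q_cont H) thT.
have bR := slice_bmeas (lq_R_cont H) thT.
have bK2 := bmeas_mul (bmeas_mul (bmeas_tr bKP) bR) bKP.
exact: bmeas_mul (bmeas_mul (bmeas_tr bU) (bmeas_add bQ bK2)) bU.
Qed.

(** The term 2[eta] stems from the two frozen times, each displaced by at most [eta]; its integral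
    is at most 2T[eta]. The weighted term gains 1/[lam], and 2T + 1 dominates both coefficients. *)
Lemma mxint_tail_le p q (f f' : K -> 'M[K]_(p, q)) C (eta c lam t : K) :
  0 <= C -> 0 <= eta -> 0 <= c -> 0 < lam ->
  bmeas 0 T f -> bmeas 0 T f' -> t \in `[0, T] ->
  (forall r : K, r \in `[0, T] ->
     `|f r - f' r| <= C * (2 * eta + c * expR (lam * (T - r)))) ->
  `|mxint t T f - mxint t T f'|
    <= C * (2 * T + 1) * (eta + c / lam * expR (lam * (T - t))).
Proof.
move=> C0 eta0 c0 lam0 bf bf' + ff'; rewrite in_itv/= => /andP[t0 tT].
have sub p' q' (g : K -> 'M[K]_(p', q')) : bmeas 0 T g -> bmeas t T g.
  exact: bmeas_sub.
rewrite -mxintB; [|exact: sub|exact: sub].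
have cst1 : {within `[t, T], continuous (fun r => C * (2 * eta + c * expR (lam * (T - r))))}.
  apply: continuous_subspaceT => x; apply: cvgM; first exact: cvg_cst.
  apply: cvgD; first exact: cvg_cst.
  apply: cvgM; first exact: cvg_cst.
  apply: continuous_comp; last exact: continuous_expR.
  apply: cvgM; first exact: cvg_cst.
  by apply: cvgB; [exact: cvg_cst|exact: cvg_id].
have cexp : {within `[t, T], continuous (fun r => c * expR (lam * (T - r)))}.
  apply: continuous_subspaceT => x; apply: cvgM; first exact: cvg_cst.
  apply: continuous_comp; last exact: continuous_expR.
  apply: cvgM; first exact: cvg_cst.
  by apply: cvgB; [exact: cvg_cst|exact: cvg_id].
have int (g : K -> K) : {within `[t, T], continuous g} ->
    (@lebesgue_measure K).-integrable `[t, T] (EFin \o g).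
  by move=> cg; apply: continuous_compact_integrable => //; exact: segment_compact.
have ccst (z : K) : {within `[t, T], continuous (fun=> z)}.
  by apply: continuous_subspaceT => x; exact: cvg_cst.
apply: le_trans (mxint_norm_le _ cst1 _) _.
- by apply: bmeas_add; [exact: sub|apply: bmeas_opp; exact: sub].
- by move=> r rtT; apply: ff'; exact: in_itv_sub rtT.
rewrite RintegralZl//; last first.
  apply: int => x; apply: cvgD; [exact: ccst|exact: cexp].
rewrite -mulrA ler_wpM2l// RintegralD//; [|exact: int|exact: int].
have h := Rintegral_exp_tail lam0 c0 tT.
apply: le_trans (lerD (lexx _) h) _.
rewrite Rintegral_cst//= lebesgue_measure_itv/=.
have -> : fine (if (t%:E < T%:E)%E then (T%:E - t%:E)%E else 0%E) = T - t.
  rewrite lte_fin; move: tT; rewrite le_eqVlt => /predU1P[->|->//].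
  by rewrite ltxx subrr.
set y := c / lam * _.
have y0 : 0 <= y by rewrite /y !mulr_ge0 ?expR_ge0// invr_ge0 ltW.
have : 0 <= T * y by rewrite mulr_ge0// ltW.
have : 0 <= t * eta by rewrite mulr_ge0.
by nra.
Qed.

(** One estimate for two purposes: equal freezings with [eta] = 0 give the contraction, and equal
    arguments with [c] = 0 give the O([eta]) defect of the given solution under freezing. *)
Lemma volterra_lip M : exists2 C, 0 <= C &
  forall (sigma sigma' : K -> K) (W W' : K -> stack) (eta c lam : K),
  coef_bmeas sigma -> coef_bmeas sigma' -> bmeas 0 T W -> bmeas 0 T W' ->
  (forall r : K, r \in `[0, T] -> `|W r| <= M) ->
  (forall r : K, r \in `[0, T] -> `|W' r| <= M) ->
  0 <= eta -> 0 <= c -> 0 < lam ->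
  (forall r : K, r \in `[0, T] -> `|sigma r - sigma' r| <= eta) ->
  (forall r : K, r \in `[0, T] -> `|W r - W' r| <= c * expR (lam * (T - r))) ->
  forall t : K, t \in `[0, T] -> `|vop sigma W t - vop sigma' W' t|
    <= C * (eta + c / lam * expR (lam * (T - t))).
Proof.
have [C1 C10 hr] := rate_estimates H M.
(* An a priori bound on the new [V] block and on the integral read by [readP]. *)
pose N := `|(1%:M : 'M[K]_n)| + C1 * T.
have T0 : 0 <= T by exact: ltW.
have [C2 C20 hp] := readP_estimates H N.
pose E1 := C1 * (2 * T + 1).
have E10 : 0 <= E1 by rewrite mulr_ge0// addr_ge0// mulr_ge0.
exists (E1 + C2 * (1 + 2 * E1)) => [|s s' W W' eta c lam cs cs' bW bW' WM W'M
    eta0 c0 lam0 ss' WW' t tT].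
  by rewrite addr_ge0// mulr_ge0// addr_ge0// mulr_ge0.
have sT : forall r : K, r \in `[0, T] -> s r \in `[0, T] by have [] := cs.
have s'T : forall r : K, r \in `[0, T] -> s' r \in `[0, T] by have [] := cs'.
set eps := eta + _.
have eps0 : 0 <= c / lam * expR (lam * (T - t)).
  by rewrite !mulr_ge0 ?expR_ge0// invr_ge0 ltW.
have hr' r rT := hr _ _ _ _ r (W r) (W' r) (sT _ tT) (s'T _ tT) (sT r rT)
  (s'T r rT) rT (WM r rT) (W'M r rT).
have hr2 r rT := hr _ _ _ _ r (W' r) (W' r) (s'T _ tT) (s'T _ tT) (s'T r rT)
  (s'T r rT) rT (W'M r rT) (W'M r rT).
have le (r : K) : r \in `[0, T] ->
    C1 * (`|s t - s' t| + `|s r - s' r| + `|W r - W' r|)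
    <= C1 * (2 * eta + c * expR (lam * (T - r))).
  move=> rT; rewrite ler_wpM2l// lerD ?WW'//.
  by rewrite mulrDl mul1r lerD ?ss'.
have [bU bV bP] := bmeas_rates cs bW (sT _ tT).
have [bU' bV' bP'] := bmeas_rates cs' bW' (s'T _ tT).
have dU : `|mxint t T (fun r => rateU (s r) r (W r))
    - mxint t T (fun r => rateU (s' r) r (W' r))| <= E1 * eps.
  apply: mxint_tail_le => // r rT.
  by have [h _ _ _ _] := hr' r rT; exact: le_trans h (le r rT).
have dV : `|mxint t T (fun r => rateV (s r) r (W r))
    - mxint t T (fun r => rateV (s' r) r (W' r))| <= E1 * eps.
  apply: mxint_tail_le => // r rT.
  by have [_ h _ _ _] := hr' r rT; exact: le_trans h (le r rT).
have dP : `|mxint t T (fun r => rateP (s t) (s r) r (W r))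
    - mxint t T (fun r => rateP (s' t) (s' r) r (W' r))| <= E1 * eps.
  apply: mxint_tail_le => // r rT.
  by have [_ _ h _ _] := hr' r rT; exact: le_trans h (le r rT).
move: (tT); rewrite in_itv/= => /andP[t0 tT'].
have bnd (f : K -> 'M[K]_n) : bmeas 0 T f ->
    (forall r : K, r \in `[0, T] -> `|f r| <= C1) -> `|mxint t T f| <= C1 * T.
  move=> bf fC; have bf' : bmeas t T f by exact: bmeas_sub bf.
  apply: le_trans (mxint_norm_cst tT' bf' (C := C1) _) _.
    by move=> r rtT; apply: fC; exact: in_itv_sub rtT.
  by rewrite ler_wpM2l// gerBl.
have nV : `|1%:M + mxint t T (fun r => rateV (s r) r (W r))| <= N.
  rewrite (le_trans (ler_normD _ _))// lerD2l; apply: bnd bV _ => r rT.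
  by have [_ _ _ _ []] := hr' r rT.
have nV' : `|1%:M + mxint t T (fun r => rateV (s' r) r (W' r))| <= N.
  rewrite (le_trans (ler_normD _ _))// lerD2l; apply: bnd bV' _ => r rT.
  by have [_ _ _ _ []] := hr2 r rT.
have nJ : `|mxint t T (fun r => rateP (s t) (s r) r (W r))| <= N.
  apply: (@le_trans _ _ (C1 * T)); last by rewrite lerDr.
  by apply: bnd bP _ => r rT; have [_ _ _ _ []] := hr' r rT.
have nJ' : `|mxint t T (fun r => rateP (s' t) (s' r) r (W' r))| <= N.
  apply: (@le_trans _ _ (C1 * T)); last by rewrite lerDr.
  by apply: bnd bP' _ => r rT; have [_ _ _ _ []] := hr2 r rT.
have [dR _] := hp _ _ _ _ _ _ (sT _ tT) (s'T _ tT) nV nV' nJ nJ'.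
rewrite /volterra_op opp_col_mx add_col_mx opp_col_mx add_col_mx.
have ee : 0 <= eps by exact: addr_ge0.
have C2e : 0 <= C2 * (1 + 2 * E1) * eps.
  by rewrite mulr_ge0// mulr_ge0// addr_ge0// mulr_ge0.
have E1e : 0 <= E1 * eps by rewrite mulr_ge0.
rewrite mulrDl; apply: mx_norm_col; last apply: mx_norm_col.
- rewrite opprD addrACA subrr add0r -opprD normrN.
  by apply: le_trans dU _; rewrite lerDl.
- by rewrite opprD addrACA subrr add0r; apply: le_trans dV _; rewrite lerDl.
- apply: le_trans dR _; apply: (@le_trans _ _ (C2 * (1 + 2 * E1) * eps)); last first.
    by rewrite lerDr.
  rewrite -mulrA ler_wpM2l// opprD addrACA subrr add0r.
  apply: le_trans (lerD (lerD (ss' _ tT) dV) dP) _.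
  have : eta <= eps by rewrite lerDl.
  move=> he; have -> : eta + E1 * eps + E1 * eps = eta + 2 * E1 * eps by ring.
  by rewrite [leRHS]mulrDl mul1r; apply: lerD.
Qed.

(** The [U] and [V] blocks are continuous as tail integrals. The [P] block jumps with [sigma t], so
    it is written as a family indexed by a fixed [th] and evaluated along [sigma]. *)
Lemma volterra_bmeas sigma W : tame sigma -> bmeas 0 T W ->
  bmeas 0 T (vop sigma W).
Proof.
move=> ts bW; have [sT _] := ts; have cs := coef_bmeas_tame ts.
have T0 : (0 : K) \in `[0, T] by rewrite in_itv/= lexx ltW.
have [bU bV _] := bmeas_rates cs bW T0.
have tail (f : K -> 'M[K]_n) : bmeas 0 T f -> bmeas 0 T (fun t => mxint t T f).
  by move=> bf; apply: within_bmeas; exact: mxint_tail_cvg.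
have bV1 := bmeas_add (bmeas_cst 0 T 1%:M) (tail _ bV).
apply: bmeas_col; first exact: bmeas_add (bmeas_cst _ _ _) (bmeas_opp (tail _ bU)).
apply: bmeas_col; first exact: bV1.
have [_ [M WM]] := bW.
have [C1 C10 hr] := rate_estimates H M.
have [_ [N0 N0V]] := bV1; pose N := Num.max N0 (C1 * T).
have [C2 C20 hp] := readP_estimates H N.
apply: (tame_bmeas (h := fun th t => readP th
    (1%:M + mxint t T (fun r => rateV (sigma r) r (W r)))
    (mxint t T (fun r => rateP th (sigma r) r (W r)))) (C := C2) ts).
  move=> th thT; have [_ _ bP] := bmeas_rates cs bW thT.
  exact: bmeas_mul (bmeas_mul (bmeas_tr bV1)
    (bmeas_add (bmeas_cst 0 T (G th)) (tail _ bP))) bV1.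
move=> th t thT tT; have [_ _ bP] := bmeas_rates cs bW thT.
have nV : `|1%:M + mxint t T (fun r => rateV (sigma r) r (W r))| <= N.
  by rewrite le_max N0V.
have nJ : `|mxint t T (fun r => rateP th (sigma r) r (W r))| <= N.
  move: tT; rewrite in_itv/= => /andP[t0 tT].
  have bP' := bmeas_sub t0 (lexx T) bP.
  rewrite le_max; apply/orP; right.
  apply: le_trans (mxint_norm_cst tT bP' (C := C1) _) _ => [r rtT|].
    have rT : r \in `[0, T] by exact: in_itv_sub rtT.
    by have [_ _ _ _ []] := hr _ _ _ _ _ _ _ thT thT (sT r rT) (sT r rT) rT
      (WM r rT) (WM r rT).
  by rewrite ler_wpM2l// gerBl.
by have [] := hp _ _ _ _ _ _ thT thT nV nV nJ nJ.
Qed.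

(* Contraction in the norm weighted by exp(lam (T - t)), on a ball around W0. *)
Lemma volterra_perturbation W0 : bmeas 0 T W0 ->
  (forall t : K, t \in `[0, T] -> W0 t = vop id W0 t) ->
  exists C eta0, [/\ 0 <= C, 0 < eta0 & forall sigma eta, tame sigma ->
    0 <= eta -> eta <= eta0 ->
    (forall r : K, r \in `[0, T] -> `|sigma r - r| <= eta) ->
    exists W, [/\ bmeas 0 T W,
      forall t : K, t \in `[0, T] -> `|W t - W0 t| <= C * eta
      & forall t : K, t \in `[0, T] -> W t = vop sigma W t]].
Proof.
move=> bW0 fW0; have [_ [M0 W0M]] := bW0.
(* [M0 + 1] bounds the ball: the weighted radius 1/[wmax] allows a deviation of at most 1 from
   [W0]. *)
have [C C0 hC] := volterra_lip (M0 + 1).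
pose lam := 2 * C + 1; have lam0 : 0 < lam by rewrite /lam; lra.
pose w t := expR (lam * (T - t)); pose wmax := expR (lam * T).
have wmax0 : 0 < wmax by exact: expR_gt0.
have w1 r : r \in `[0, T] -> 1 <= w r.
  rewrite in_itv/= => /andP[_ rT]; rewrite /w -expR0 ler_expR mulr_ge0 ?subr_ge0//.
  exact: ltW.
have ww r : r \in `[0, T] -> w r <= wmax.
  rewrite in_itv/= => /andP[r0 _]; rewrite ler_expR ler_wpM2l ?(ltW lam0)//.
  by rewrite gerBl.
have C1 : 0 < 2 * (C + 1) * wmax by rewrite !mulr_gt0// ltr_wpDl.
(* The defect of [W0] is C[eta], so the fixed point lies within 2C[eta] in weighted norm, hence
   within 2C[wmax] [eta]. The threshold on [eta] makes 2C[eta] at most the radius 1/[wmax]. *)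
exists (2 * C * wmax), (2 * (C + 1) * wmax)^-1; split.
- by rewrite !mulr_ge0// ltW.
- by rewrite invr_gt0.
move=> s eta ts eta0 etale seta.
have cs := coef_bmeas_tame ts.
have ball (W : K -> stack) : (forall r : K, r \in `[0, T] ->
    `|W r - W0 r| <= wmax^-1 * w r) ->
    forall r : K, r \in `[0, T] -> `|W r| <= M0 + 1.
  move=> WW0 r rT; rewrite -[W r](subrK (W0 r)) addrC.
  rewrite (le_trans (ler_normD _ _))// lerD ?W0M// (le_trans (WW0 _ rT))//.
  by rewrite mulrC ler_pdivrMr// mul1r ww.
have W0M1 : forall r : K, r \in `[0, T] -> `|W0 r| <= M0 + 1.
  by move=> r /W0M h; rewrite (le_trans h)// lerDl.
have [] := @weighted_fixpoint K _ _ 0 T w wmax wmax^-1 (C * eta) (vop s) W0.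
- by move=> r rT; rewrite expR_ge0 ww.
- by rewrite mulr_ge0.
- have h : eta * (2 * (C + 1) * wmax) <= 1 by rewrite -ler_pdivlMr// mul1r.
  rewrite -[leRHS]mul1r ler_pdivlMr//; apply: le_trans h.
  rewrite (_ : 2 * (C * eta) * wmax = eta * (2 * C * wmax)); last by ring.
  by rewrite ler_wpM2l// ler_wpM2r ?(ltW wmax0)// ler_wpM2l// lerDl.
- exact: bW0.
- by move=> W bW _; exact: volterra_bmeas.
- move=> W1 W2 c b1 b2 ball1 ball2 c0 W12 t tT.
  have ss r : r \in `[0, T] -> `|s r - s r| <= 0 by rewrite subrr normr0.
  have h := hC _ _ _ _ 0 c lam cs cs b1 b2 (ball _ ball1) (ball _ ball2)
    (lexx 0) c0 lam0 ss W12 t tT.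
  apply: le_trans h _; rewrite add0r mulrA ler_wpM2r ?expR_ge0//.
  have h2 : C <= 2^-1 * lam by rewrite /lam; lra.
  rewrite (_ : C * (c / lam) = c * (C / lam)); last by ring.
  by rewrite ler_wpM2l// ler_pdivrMr.
- move=> t tT; rewrite [X in _ - X]fW0//.
  have WW r : r \in `[0, T] -> `|W0 r - W0 r| <= 0 * expR (lam * (T - r)).
    by rewrite subrr normr0 mul0r.
  have h := hC _ _ _ _ eta 0 lam cs coef_bmeas_id bW0 bW0 W0M1 W0M1
    eta0 (lexx 0) lam0 seta WW t tT.
  apply: le_trans h _; rewrite !mul0r addr0 ler_peMr ?w1//.
  by rewrite mulr_ge0.
move=> W [bW WW0 fW]; exists W; split => // t tT.
apply: le_trans (WW0 t tT) _; rewrite (_ : 2 * C * wmax * eta = 2 * (C * eta) * wmax).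
  by rewrite ler_wpM2l ?ww// !mulr_ge0.
by ring.
Qed.

End Perturbation.

(** * Partitions *)

Section Partition.
Context {K : realType} (T : K) (D : seq K).
Hypothesis T_gt0 : 0 < T.
Hypothesis Dpart : itv_partition 0 T D.

Lemma node0 : node D 0 = 0. Proof. by []. Qed.

Lemma node_last : node D (size D) = T.
Proof.
have [_ /eqP DT] := Dpart.
by rewrite /node -[size D]/(size (0 :: D)).-1 nth_last.
Qed.

Lemma partition_size_gt0 : (0 < size D)%N.
Proof.
rewrite lt0n; apply/eqP => D0; have := node_last; rewrite D0 node0 => T0.
by move: T_gt0; rewrite -T0 ltxx.
Qed.

Lemma node_lt i j : (i < j)%N -> (j <= size D)%N -> node D i < node D j.
Proof.
move=> ij jD; have [Dp _] := Dpart.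
have Ds : sorted <%O (0 :: D) by exact: Dp.
by apply: (sorted_ltn_nth lt_trans 0 Ds) => //; rewrite inE/= ltnS// (ltnW (leq_trans ij jD)).
Qed.

Lemma node_le i j : (i <= j)%N -> (j <= size D)%N -> node D i <= node D j.
Proof.
by rewrite leq_eqVlt => /predU1P[->//|ij] jD; apply/ltW; exact: node_lt.
Qed.

Lemma node_in k : (k <= size D)%N -> node D k \in `[0, T].
Proof.
by move=> kD; rewrite in_itv/= -[X in X <= _]node0 -node_last !node_le.
Qed.

Lemma node_mem k : (0 < k)%N -> (k <= size D)%N -> node D k \in D.
Proof. by case: k => // k _ kD; rewrite /node/= mem_nth. Qed.

(** The second disjunct covers the closed last interval: T is not among the nodes over which
    [left_node] maximizes. *)
Lemma left_nodeE k (s : K) : (k < size D)%N -> node D k <= s ->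
  (s < node D k.+1) || (k.+1 == size D) -> left_node D s = node D k.
Proof.
move=> kD ks sk; apply/eqP; rewrite eq_le; apply/andP; split.
  apply: bigmax_le => [|j js].
    by have := node_in (ltnW kD); rewrite in_itv/= => /andP[].
  apply: node_le (ltnW kD); rewrite leqNgt; apply/negP => kj.
  case/orP: sk => [sk|/eqP kE].
    by have := le_lt_trans (node_le kj (ltnW (ltn_ord j))) (le_lt_trans js sk); rewrite ltxx.
  by have := leq_trans (ltn_ord j) (eq_leq (esym kE)); rewrite ltnS leqNgt kj.
rewrite /left_node (bigmaxD1 (Ordinal kD))//= le_max lexx.
done.
Qed.

Lemma left_node_ex (s : K) : s \in `[0, T] -> exists k, [/\ (k < size D)%N,
  node D k <= s, (s < node D k.+1) || (k.+1 == size D) & s <= node D k.+1].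
Proof.
rewrite in_itv/= => /andP[s0 sT].
pose P k := (k < size D)%N && (node D k <= s).
have P0 : exists k, P k by exists 0%N; rewrite /P partition_size_gt0 node0.
have Pub k : P k -> (k <= size D)%N by move=> /andP[/ltnW].
have [k /andP[kD ks] kmax] := ex_maxnP P0 Pub; exists k.
have h : (s < node D k.+1) || (k.+1 == size D).
  have [->|kN] := eqVneq k.+1 (size D); first by rewrite orbT.
  rewrite orbF ltNge; apply/negP => ks'.
  have /kmax : P k.+1 by rewrite /P ks' andbT ltn_neqAle kN.
  by rewrite ltnn.
split => //; case/orP: h => [/ltW//|/eqP ->]; by rewrite node_last.
Qed.

Lemma left_node_in (s : K) : s \in `[0, T] -> left_node D s \in `[0, T].
Proof.
by move=> /left_node_ex[k [kD ks sk _]]; rewrite (left_nodeE kD ks sk) node_in// ltnW.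
Qed.

Lemma mesh_ge0 : 0 <= mesh D.
Proof. exact: bigmax_ge_id. Qed.

Lemma left_node_mesh (s : K) : s \in `[0, T] -> `|left_node D s - s| <= mesh D.
Proof.
move=> /left_node_ex[k [kD ks sk sk1]]; rewrite (left_nodeE kD ks sk).
rewrite distrC ger0_norm ?subr_ge0//.
apply: (@le_trans _ _ (node D k.+1 - node D k)); first by rewrite lerD2r.
by rewrite /mesh (bigmaxD1 (Ordinal kD))//= le_max lexx.
Qed.

Lemma left_node_tame : tame T (left_node D).
Proof.
split => [|h mh]; first exact: left_node_in.
(* The pieces on which [left_node D] is constant, half-open except the last. They are empty from
   [size D] on, so that a countable union covers [[0, T]]. *)
pose E (k : nat) : set K := if (k < size D)%N then
  (if k.+1 == size D then [set` `[node D k, T]] else [set` `[node D k, node D k.+1[])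
  else set0.
have Enode k s : E k s -> [/\ (k < size D)%N, s \in `[0, T] & left_node D s = node D k].
  rewrite /E; case: ifP => // kD.
  have := node_in (ltnW kD); rewrite in_itv/= => /andP[k0 _].
  case: ifP => [/eqP kE|_] /=; rewrite !in_itv/= => /andP[ks sk].
    by split; rewrite ?(le_trans k0) ?sk//; apply: left_nodeE => //; rewrite kE eqxx orbT.
  split => //; last by apply: left_nodeE => //; rewrite sk.
  have := node_in kD; rewrite in_itv/= => /andP[_ kT].
  by rewrite (le_trans k0)//= ltW// (lt_le_trans sk).
have EU : [set` `[0, T]] = \bigcup_k E k.
  apply/seteqP; split => [s sT|s [k _ /Enode[]]//].
  have [k [kD ks sk sk1]] := left_node_ex sT; exists k => //; rewrite /E kD.
  move: sT; rewrite /= in_itv/= => /andP[_ sT].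
  by case: ifP sk => [_ _|_] /=; rewrite in_itv/= ks ?orbF.
rewrite EU; apply/measurable_fun_bigcup => [k|k].
  by rewrite /E; case: ifP => // _; case: ifP.
have mE : measurable_fun (E k) (h (node D k)).
  have [kD|kD] := boolP (k < size D)%N; last first.
    by rewrite /E (negbTE kD); exact: measurable_fun_set0.
  apply: measurable_funS (mh _ (node_in (ltnW kD))) => // s.
  by move=> /Enode[].
by apply: eq_measurable_fun mE => s; rewrite inE => /Enode[_ _ ->].
Qed.

Lemma left_node_itv k (s : K) : (0 < k <= size D)%N -> node D k.-1 <= s < node D k ->
  left_node D s = node D k.-1.
Proof.
case: k => // k /= kD /andP[ks sk]; apply: left_nodeE => //.
by rewrite sk.
Qed.

Lemma left_node_near (s : K) : s \in `]0, T[ -> s \notin D ->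
  exists2 th, th \in `[0, T] & \forall r \near s, left_node D r = th.
Proof.
rewrite in_itv/= => /andP[s0 sT] sD.
have sT' : s \in `[0, T] by rewrite in_itv/= !ltW.
have [k [kD ks sk sk1]] := left_node_ex sT'; exists (node D k).
  by rewrite node_in// ltnW.
have ks' : node D k < s.
  rewrite lt_neqAle ks andbT; case: k kD {ks sk sk1} => [|k] kD.
    by rewrite node0 lt_eqF.
  by apply: contraNneq sD => <-; rewrite node_mem// ltnW.
have sk' : s < node D k.+1.
  rewrite lt_neqAle sk1 andbT; apply: contraNneq sD => ->; exact: node_mem.
near=> r; apply: left_nodeE => //; first by near: r; exact: lt_le_nbhsr.
by apply/orP; left; near: r; exact: lt_nbhsl.
Unshelve. all: by end_near. Qed.

End Partition.

Lemma near_eq_continuous_at {S V : topologicalType} (f g : S -> V) (s : S) :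
  (\forall r \near s, f r = g r) -> {for s, continuous g} -> {for s, continuous f}.
Proof.
move=> fg cg; have h : f r @[r --> s] --> g s.
  apply: cvg_trans cg; apply: near_eq_cvg.
  by apply: filterS fg => r ->.
by move: h; rewrite -(nbhs_singleton fg).
Qed.

(** * Fixed points as flows, and the given solution as a fixed point *)

Section FixedPoint.
Context {K : realType} {n m : nat} (T : K).
Variables (A : K -> K -> 'M[K]_n) (B : K -> K -> 'M[K]_(n, m)).
Variables (Q : K -> K -> 'M[K]_n) (R : K -> K -> 'M[K]_m) (G : K -> 'M[K]_n).
Variables (L delta : K).
Hypothesis H : lq_hyps T A B Q R G L delta.
Let T_gt0 := lq_T_gt0 H.
Local Notation stack := 'M[K]_(n + (n + n), n).
Local Notation gainK := (gainK B R).
Local Notation rateP := (rateP B Q R).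
Local Notation readP := (readP G).
Local Notation vop := (volterra_op T A B Q R G).
Local Notation cloop := (closed_loop A B R).

Lemma symmD p (M N : 'M[K]_p) : symm M -> symm N -> symm (M + N).
Proof. by rewrite /symm linearD => /= -> ->. Qed.

Lemma symm_congr p q (M : 'M[K]_p) (N : 'M[K]_(p, q)) :
  symm M -> symm (N^T *m M *m N).
Proof. by rewrite /symm => sM; rewrite !trmx_mul trmxK sM mulmxA. Qed.

Lemma symm_inv p (M : 'M[K]_p) : symm M -> symm (invmx M).
Proof. by rewrite /symm => sM; rewrite trmx_inv sM. Qed.

Lemma symm_mxint p (a b : K) (F : K -> 'M[K]_p) :
  (forall r, r \in `[a, b] -> symm (F r)) -> symm (mxint a b F).
Proof.
by move=> sF; rewrite /symm -mxint_tr; apply: mxint_ext => r /sF.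
Qed.

Lemma gainK_tr (t r : K) : t \in `[0, T] -> r \in `[0, T] ->
  (gainK t r)^T = B t r *m invmx (R t r).
Proof.
move=> tT rT; rewrite /gainK trmx_mul trmxK.
by rewrite (symm_inv (lq_R_sym H tT rT)).
Qed.

Lemma running_symm (th tau r : K) P : th \in `[0, T] -> r \in `[0, T] ->
  symm (running B Q R th tau r P).
Proof.
move=> thT rT; apply: symmD; first exact: lq_Q_sym H _ _ thT rT.
by apply: symm_congr; exact: lq_R_sym H _ _ thT rT.
Qed.

Section Sigma.
Variables (sigma : K -> K) (W : K -> stack).
Hypothesis cs : coef_bmeas T A B R sigma.
Hypothesis bW : bmeas 0 T W.
Hypothesis fW : forall t : K, t \in `[0, T] -> W t = vop sigma W t.

Let U t := stU (W t).
Let V t := stV (W t).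
Let P t := stP (W t).

Lemma fixpoint_flow : flow 0 T (cloop P sigma) U V.
Proof.
split; first exact: bmeas_usub.
- by apply: bmeas_usub; exact: bmeas_dsub.
- by move=> t tT; rewrite /U fW// /stU /volterra_op col_mxKu.
- by move=> t tT; rewrite /V fW// /stV /volterra_op col_mxKd col_mxKu.
Qed.

Lemma fixpoint_P t : t \in `[0, T] ->
  P t = readP (sigma t) (V t) (mxint t T (fun r => rateP (sigma t) (sigma r) r (W r))).
Proof.
move=> tT; rewrite {1}/P fW// /stP /volterra_op !col_mxKd; congr (readP _ _ _).
by rewrite /V [in RHS]fW// /stV /volterra_op col_mxKd col_mxKu.
Qed.

Lemma fixpoint_closed_loop_bmeas : bmeas 0 T (cloop P sigma).
Proof.
have [_ bA bB bK] := cs.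
have bP : bmeas 0 T P by apply: bmeas_dsub; exact: bmeas_dsub.
exact: bmeas_add bA (bmeas_opp (bmeas_mul bB (bmeas_mul bK bP))).
Qed.

(** P with its outer frozen time detached from [t]. For fixed [th] this is continuous on all of
    [[0, T]] although P jumps; on the k-th interval P is its instance at t_(k-1), so the left limit
    of P at t_k is the value of that instance at t_k. *)
Definition readP_at (th t : K) : 'M[K]_n :=
  readP th (V t) (mxint t T (fun r => rateP th (sigma r) r (W r))).

Lemma readP_at_symm (th t : K) : th \in `[0, T] -> t \in `[0, T] ->
  symm (readP_at th t).
Proof.
move=> thT tT; apply: symm_congr; apply: symmD; first exact: lq_G_sym H _ thT.
apply: symm_mxint => r rtT; apply: symm_congr; apply: running_symm => //.
by apply: in_itv_sub rtT; move: tT; rewrite ?in_itv/= => /andP[].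
Qed.

Lemma fixpoint_P_symm (t : K) : t \in `[0, T] -> symm (P t).
Proof.
move=> tT; rewrite fixpoint_P//; apply: readP_at_symm => //.
by have [sT _ _ _] := cs; exact: sT.
Qed.

Lemma readP_at_continuous (th : K) : th \in `[0, T] ->
  {within `[0, T], continuous (readP_at th)}.
Proof.
move=> thT; have [_ _ bP] := bmeas_rates H cs bW thT.
have cV := flow_continuousV fixpoint_closed_loop_bmeas fixpoint_flow.
have cG : {within `[0, T], continuous (fun=> G th)}.
  by apply: continuous_subspaceT => x; exact: cvg_cst.
exact: within_mulmx (within_mulmx (within_trmx cV)
  (within_add cG (mxint_tail_cvg bP))) cV.
Qed.

Section Piece.
Variables (s th : K).
Hypothesis s0T : s \in `]0, T[.
Hypothesis thT : th \in `[0, T].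
Hypothesis sth : \forall r \near s, sigma r = th.

Lemma piece_continuous p q (F : K -> K -> 'M[K]_(p, q)) :
  {within `[0, T], continuous (F th)} ->
  {for s, continuous (fun r => F (sigma r) r)}.
Proof.
move=> cF; have Fs := within_itv_continuous_at T_gt0 cF s0T.
by apply: near_eq_continuous_at Fs; apply: filterS sth => r ->.
Qed.

Lemma fixpoint_P_near : \forall r \near s, P r = readP_at th r.
Proof.
move: (s0T); rewrite in_itv/= => /andP[s0 sT].
near=> r; rewrite fixpoint_P; last first.
  rewrite in_itv/=; apply/andP; split; near: r;
    [exact: lt_le_nbhsr|exact: lt_le_nbhsl].
by rewrite /readP_at (_ : sigma r = th)//; near: r.
Unshelve. all: by end_near. Qed.

Lemma fixpoint_P_continuous_at : {for s, continuous P}.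
Proof.
have cR := within_itv_continuous_at T_gt0 (readP_at_continuous thT) s0T.
exact: near_eq_continuous_at fixpoint_P_near cR.
Qed.

Lemma gainK_continuous_at : {for s, continuous (fun r => gainK (sigma r) r)}.
Proof.
apply: piece_continuous; apply: (gainK_continuous H (f := cst th)) => //.
  exact: square_slice (lq_R_cont H) _ thT.
exact: square_slice (lq_B_cont H) _ thT.
Qed.

Lemma closed_loop_continuous_at : {for s, continuous (cloop P sigma)}.
Proof.
have cA := piece_continuous (square_slice (lq_A_cont H) thT).
have cB := piece_continuous (square_slice (lq_B_cont H) thT).
apply: cvgB; first exact: cA.
exact: mulmx_continuous_at cB
  (mulmx_continuous_at gainK_continuous_at fixpoint_P_continuous_at).
Qed.

End Piece.
End Sigma.

Section Limit.
Variables (Phi : K -> K -> 'M[K]_n) (P : K -> 'M[K]_n).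
Hypothesis sol : volterra_sol T A B Q R G Phi P.

Let cP : {within `[0, T], continuous P}. Proof. by have [] := sol. Qed.

Lemma limit_gain_bmeas : bmeas 0 T (cloop P id).
Proof.
have [_ bA bB bK] := coef_bmeas_id H.
exact: bmeas_add bA (bmeas_opp (bmeas_mul bB (bmeas_mul bK (within_bmeas cP)))).
Qed.

Lemma limit_gain_continuous : {within `[0, T], continuous (cloop P id)}.
Proof.
have cA := square_diag (lq_A_cont H); have cB := square_diag (lq_B_cont H).
have cK := gainK_continuous H (f := id) (fun r rT => rT)
  (square_diag (lq_R_cont H)) cB.
move=> x; apply: cvgB; first exact: cA.
exact: within_mulmx cB (within_mulmx cK cP) x.
Qed.

(** [U] and [V] are the flow of the closed loop of the given P. Uniqueness for the linear equation
    yields Phi(s; t) = U(s) V(t), after which the equation for P becomes the third block. *)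
Lemma limit_fixpoint : exists2 W : K -> stack, bmeas 0 T W &
  [/\ forall t : K, t \in `[0, T] -> W t = vop id W t,
      forall t : K, t \in `[0, T] -> stP (W t) = P t
    & forall s t : K, 0 <= t -> t <= s -> s <= T ->
        Phi s t = stU (W s) *m stV (W t)].
Proof.
have [symP _ cPhi hPhi hP] := sol.
have bc := limit_gain_bmeas; have cc := limit_gain_continuous.
have [U [V UV]] := flow_exists T_gt0 bc; have [bU bV hU hV] := UV.
have cZ (t : K) : t \in `]0, T[ -> t \notin [::] -> {for t, continuous (cloop P id)}.
  by move=> tT _; exact: within_itv_continuous_at cc tT.
have PhiUV (s t : K) : 0 <= t -> t <= s -> s <= T -> Phi s t = U s *m V t.
  move=> t0 ts sT; have tT := le_trans ts sT.
  have cX : {within `[t, T], continuous (Phi ^~ t)}.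
    apply: (@within_comp _ _ _ _ (triangle T) (fun r => (r, t))) cPhi.
      apply: continuous_subspaceT => r.
      exact: (@cvg_pair _ _ _ _ _ _ _ _ _ id (cst t) cvg_id (cvg_cst t)).
    by move=> r /=; rewrite in_itv/= => /andP[].
  have bX := within_bmeas cX; have bcT := bmeas_sub t0 (lexx T) bc.
  have dX r : r \in `]t, T[ -> r \notin [::] ->
      is_derive r 1 (Phi ^~ t) (cloop P id r *m Phi r t).
    move=> rtT _.
    have rT : r \in `]0, T[.
      by move: rtT; rewrite !in_itv/= => /andP[tr ->]; rewrite (le_lt_trans t0).
    have tT' : t < T by move: rtT; rewrite in_itv/= => /andP[]; exact: lt_trans.
    have cr := mulmx_continuous_at (cZ r rT isT) (within_itv_continuous_at tT' cX rtT).
    have h := is_derive_mxint (bmeas_mul bcT bX) rtT cr.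
    have {}h := is_deriveD (is_derive_cst (1%:M : 'M[K]_n) r 1) h.
    rewrite add0r in h; apply: near_eq_is_derive h.
    move: rtT; rewrite in_itv/= => /andP[tr rT'].
    near=> y; rewrite /= hPhi//.
      by near: y; exact: lt_le_nbhsr.
    by near: y; exact: lt_le_nbhsl.
  rewrite (flow_unique T_gt0 bc UV cZ t0 ts sT cX dX).
  by rewrite hPhi// mxint_point addr0 mulmx1.
have [UT VT] := flow_end T_gt0 UV.
have [W [bW eW eU eV eP]] : exists W : K -> stack, [/\ bmeas 0 T W,
    forall t, W t = col_mx (U t) (col_mx (V t) (P t)),
    forall t, stU (W t) = U t, forall t, stV (W t) = V t
    & forall t, stP (W t) = P t].
  exists (fun t => col_mx (U t) (col_mx (V t) (P t))); split => [|//|t|t|t].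
  - exact: bmeas_col bU (bmeas_col bV (within_bmeas cP)).
  - by rewrite /stU col_mxKu.
  - by rewrite /stV col_mxKd col_mxKu.
  - by rewrite /stP !col_mxKd.
exists W; first exact: bW.
split; [|by move=> t _; rewrite eP|by move=> s t *; rewrite eU eV; exact: PhiUV].
move=> t tT; rewrite /volterra_op.
have -> : 1%:M + mxint t T (fun r => rateV A B R r r (W r)) = V t.
  rewrite (hV _ tT); congr (_ + _); apply: mxint_ext => r _.
  by rewrite /rateV /drift (eV r) (eP r).
have -> : 1%:M - mxint t T (fun r => rateU A B R r r (W r)) = U t.
  rewrite (hU _ tT); congr (_ - _); apply: mxint_ext => r _.
  by rewrite /rateU /drift (eU r) (eP r).
rewrite (eW t); congr (col_mx _ (col_mx _ _)); rewrite (hP _ tT).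
move: (tT); rewrite in_itv/= => /andP[t0 tT'].
rewrite (PhiUV _ _ t0 tT' (lexx T)) UT mul1mx /readP mulmxDr mulmxDl.
congr (_ + _).
have [_ _ bP] := bmeas_rates H (coef_bmeas_id H) bW tT.
have bP' := bmeas_sub t0 (lexx T) bP.
(* V(t)^T and V(t) are moved back under the integral, where the integrands can be compared. *)
rewrite -(mxintMl _ bP') -(mxintMr _ (bmeas_mul (bmeas_cst _ _ _) bP')).
apply: mxint_ext => r rtT.
have rT : r \in `[0, T] by exact: in_itv_sub rtT.
move: (rtT); rewrite in_itv/= => /andP[tr rT'].
rewrite (PhiUV _ _ t0 tr rT') /rateP /running (eU r) (eP r) trmx_mul.
have -> : (gainK r r *m P r)^T = P r *m B r r *m invmx (R r r).
  by rewrite trmx_mul (gainK_tr rT rT) (symP _ rT) mulmxA.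
have -> : gainK r r = invmx (R r r) *m (B r r)^T by [].
by rewrite !mulmxA mulmxDr !mulmxDl !mulmxA.
Unshelve. all: by end_near. Qed.

End Limit.

End FixedPoint.

(** * The solution of the game *)

Section OneSided.
Context {K : realType} (V : normedModType K) (a b : K) (f : K -> V).
Hypothesis ab : a < b.
Hypothesis cf : {within `[a, b], continuous f}.

Lemma within_cvg_at_left c : a < c -> c <= b -> f r @[r --> c^'-] --> f c.
Proof.
have [ci ca cb] := (continuous_within_itvP _ ab).1 cf.
move=> ac; rewrite le_eqVlt => /predU1P[->//|cb'].
by apply: cvg_at_left_filter; apply: ci; rewrite in_itv/= ac.
Qed.

Lemma within_cvg_at_right c : a <= c -> c < b -> f r @[r --> c^'+] --> f c.
Proof.
have [ci ca cb] := (continuous_within_itvP _ ab).1 cf.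
rewrite le_eqVlt => /predU1P[<-//|ac cb'].
by apply: cvg_at_right_filter; apply: ci; rewrite in_itv/= ac.
Qed.

End OneSided.

(** The product rule for v^T X v with v' = - v a and X' = - u^T r u gives a Lyapunov equation: u v =
    I cancels the flow around the source [r]. *)
Lemma readP_derivative_algebra {S : comPzRingType} {n : nat}
    (a u v X r : 'M[S]_n) : u *m v = 1%:M ->
  ((- (v *m a))^T *m X + v^T *m (0 - u^T *m r *m u)) *m v
    + v^T *m X *m (- (v *m a))
  = - (a^T *m (v^T *m X *m v) + v^T *m X *m v *m a + r).
Proof.
move=> uv; have vu : v^T *m u^T = 1%:M by rewrite -trmx_mul uv trmx1.
rewrite add0r linearN/= trmx_mul mulNmx mulmxDl !mulNmx !mulmxN !mulNmx.
rewrite (_ : v^T *m (u^T *m r *m u) *m v = r); last first.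
  by rewrite !mulmxA vu mul1mx -mulmxA uv mulmx1.
by rewrite !mulmxA !opprD addrAC.
Qed.

(** With Phi = u v and Psi = - k u v, the integrand of the prescribed end value is the integrand of
    [rateP] conjugated by [v]. *)
Lemma end_value_algebra {S : comPzRingType} {n m : nat} (u v q : 'M[S]_n)
    (k : 'M[S]_(m, n)) (r : 'M[S]_m) :
  (u *m v)^T *m q *m (u *m v) + (- (k *m (u *m v)))^T *m r *m - (k *m (u *m v))
  = v^T *m (u^T *m (q + k^T *m r *m k) *m u) *m v.
Proof.
rewrite [(- _)^T]linearN/= mulmxN !mulNmx opprK !trmx_mul.
by rewrite ?mulmxDr ?mulmxDl ?mulmxA ?mulmxDr ?mulmxDl ?mulmxA.
Qed.

Section GameSolution.
Context {K : realType} {n m : nat} (T : K).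
Variables (A : K -> K -> 'M[K]_n) (B : K -> K -> 'M[K]_(n, m)).
Variables (Q : K -> K -> 'M[K]_n) (R : K -> K -> 'M[K]_m) (G : K -> 'M[K]_n).
Variables (L delta : K).
Hypothesis H : lq_hyps T A B Q R G L delta.
Let T_gt0 := lq_T_gt0 H.
Local Notation stack := 'M[K]_(n + (n + n), n).
Local Notation gK := (gainK B R).
Local Notation vop := (volterra_op T A B Q R G).
Local Notation cloop := (closed_loop A B R).
Variables (D : seq K) (W : K -> stack).
Hypothesis Dpart : itv_partition 0 T D.
Hypothesis bW : bmeas 0 T W.
Hypothesis fW : forall t : K, t \in `[0, T] -> W t = vop (left_node D) W t.

Let sg := left_node D.
Let cs : coef_bmeas T A B R sg := coef_bmeas_tame H (left_node_tame T_gt0 Dpart).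
Let U t := stU (W t).
Let V t := stV (W t).
Let P t := stP (W t).
Local Notation Pat := (readP_at T B Q R G sg W).
Let bc := fixpoint_closed_loop_bmeas cs bW.
Let UV := fixpoint_flow bW fW.

Lemma game_closed_loop_continuous s : s \in `]0, T[ -> s \notin D ->
  {for s, continuous (cloop P sg)}.
Proof.
move=> sT sD; have [th thT sth] := left_node_near T_gt0 Dpart sT sD.
exact: (closed_loop_continuous_at H cs bW fW sT thT sth).
Qed.

Lemma game_UV t : t \in `[0, T] -> U t *m V t = 1%:M.
Proof. exact: (flow_UV T_gt0 bc UV game_closed_loop_continuous). Qed.

Lemma readP_at_derive (s th : K) : s \in `]0, T[ -> s \notin D -> th \in `[0, T] ->
  is_derive s 1 (Pat th)
    (- ((cloop P sg s)^T *m Pat th s + Pat th s *m cloop P sg s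
        + running B Q R th (sg s) s (P s))).
Proof.
move=> sT sD thT; have cc := game_closed_loop_continuous sT sD.
have [th' th'T sth] := left_node_near T_gt0 Dpart sT sD.
have dV := flow_deriveV T_gt0 bc UV sT cc.
have [_ _ bP] := bmeas_rates H cs bW thT.
have cK := gainK_continuous_at H sT th'T sth.
have cPs := fixpoint_P_continuous_at H cs bW fW sT th'T sth.
have cU := within_itv_continuous_at T_gt0 (flow_continuousU bc UV) sT.
have cQ := within_itv_continuous_at T_gt0 (square_slice (lq_Q_cont H) thT) sT.
have cR := within_itv_continuous_at T_gt0 (square_slice (lq_R_cont H) thT) sT.
have cKP := mulmx_continuous_at cK cPs.
have crun : {for s, continuous (fun r => running B Q R th (sg r) r (P r))}.
  apply: cvgD; first exact: cQ.
  exact: mulmx_continuous_at (mulmx_continuous_at (trmx_continuous_at cKP) cR) cKP.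
have cr := mulmx_continuous_at (mulmx_continuous_at (trmx_continuous_at cU) crun) cU.
have dJ := is_derive_mxint_tail bP sT cr.
have dGJ := is_deriveD (is_derive_cst (G th) s (1 : K)) dJ.
have d := is_derive_mulmx (is_derive_mulmx (is_derive_trmx dV) dGJ) dV.
apply: is_derive_eq d _.
have UVs : U s *m V s = 1%:M.
  by apply: game_UV; move: sT; rewrite !in_itv/= => /andP[/ltW-> /ltW->].
exact: readP_derivative_algebra UVs.
Qed.

Lemma between_nodes_notin k s : (0 < k <= size D)%N ->
  node D k.-1 < s < node D k -> s \notin D.
Proof.
move=> /andP[k0 kD] /andP[ks sk]; apply/negP => sD.
have jD : ((index s D).+1 <= size D)%N by rewrite index_mem.
have sE : node D (index s D).+1 = s by rewrite /node/= nth_index.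
have [jk|kj] := leqP k (index s D).+1.
  by have := node_le Dpart jk jD; rewrite sE leNgt sk.
have jk : ((index s D).+1 <= k.-1)%N by rewrite -ltnS prednK.
have := node_le Dpart jk (leq_trans (leq_pred k) kD).
by rewrite sE leNgt ks.
Qed.

Lemma game_P_itv k s : (0 < k <= size D)%N -> node D k.-1 <= s < node D k ->
  P s = Pat (node D k.-1) s.
Proof.
move=> kD ks; rewrite /P (fixpoint_P fW).
  by rewrite /readP_at /sg (left_node_itv Dpart kD ks).
move: kD ks => /andP[k0 kD] /andP[ks sk].
have kD' := leq_trans (leq_pred k) kD.
have := node_in Dpart kD'; have := node_in Dpart kD.
rewrite !in_itv/= => /andP[_ kT] /andP[k0' _].
by rewrite (le_trans k0')//= (le_trans (ltW sk)).
Qed.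

(** Inside the k-th interval the player who pays also acts, so both frozen times coincide and K^T R
    K, with K the feedback, equals Y = P B R^-1 B^T P. The Lyapunov equation contains - Y twice from
    the closed loop and + Y from the running cost; the sum - Y is the Riccati term. *)
Lemma game_riccati k s : (0 < k <= size D)%N -> node D k.-1 < s < node D k ->
  is_derive s 1 P (- (P s *m frozen D A s + (frozen D A s)^T *m P s
    + frozen D Q s
    - P s *m frozen D B s *m invmx (frozen D R s) *m (frozen D B s)^T *m P s)).
Proof.
move=> kD ks; have sD := between_nodes_notin kD ks.
move: (kD) => /andP[k0 kD1]; have kD' := leq_trans (leq_pred k) kD1.
have thT := node_in Dpart kD'.
have sT : s \in `]0, T[.
  move: (node_in Dpart kD1) thT ks; rewrite !in_itv/=.
  move=> /andP[_ kT] /andP[k0' _] /andP[k1 k2].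
  by rewrite (le_lt_trans k0')//= (lt_le_trans k2).
have sT' : s \in `[0, T] by apply: subset_itv_oo_cc sT.
have ks' : node D k.-1 <= s < node D k by move: ks => /andP[/ltW-> ->].
have sgs : sg s = node D k.-1 by rewrite /sg (left_node_itv Dpart kD ks').
have d := readP_at_derive sT sD thT.
have Pn : \forall r \near s, Pat (node D k.-1) r = P r.
  move: ks => /andP[k1 k2]; near=> r; rewrite (game_P_itv kD)//.
  apply/andP; split; near: r; [exact: lt_le_nbhsr|exact: lt_nbhsl].
have {}d := near_eq_is_derive Pn d; apply: is_derive_eq d _.
rewrite -(game_P_itv kD ks') /frozen -/sg.
have symP : (P s)^T = P s.
  exact (fixpoint_P_symm H cs fW sT').
have sgT : sg s \in `[0, T] by rewrite sgs.
rewrite /running /closed_loop -sgs.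
have Ru : R (sg s) s \in unitmx.
  exact: coercive_unit (lq_delta_gt0 H) (lq_R_pd H sgT sT').
set Y := P s *m B (sg s) s *m invmx (R (sg s) s) *m (B (sg s) s)^T *m P s.
have KP : (gK (sg s) s *m P s)^T = P s *m B (sg s) s *m invmx (R (sg s) s).
  by rewrite trmx_mul (gainK_tr H sgT sT') symP mulmxA.
have Y1 : (gK (sg s) s *m P s)^T *m R (sg s) s *m (gK (sg s) s *m P s) = Y.
  by rewrite KP mulmxKV// /gainK !mulmxA.
have Y2 : P s *m (B (sg s) s *m (gK (sg s) s *m P s)) = Y.
  by rewrite /gainK !mulmxA.
have Y3 : (B (sg s) s *m (gK (sg s) s *m P s))^T *m P s = Y.
  by rewrite trmx_mul KP.
rewrite Y1 linearB/= mulmxBl mulmxBr Y2 Y3.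
have alg (x y z q : 'M[K]_n) :
    - (y - z + (x - z) + (q + z)) = - (x + y + q - z).
  by apply/matrixP => i j; rewrite !mxE; ring.
exact: alg.
Unshelve. all: by end_near. Qed.

(** The end value prescribed at t_k carries the weights of t_(k-1) along the flow that starts at
    t_k, which is what the detached frozen time describes. *)
Lemma game_end_value k : (0 < k <= size D)%N ->
  end_value T B Q R G D P (fun s t => U s *m V t) k = Pat (node D k.-1) (node D k).
Proof.
move=> kD; move: (kD) => /andP[k0 kD1]; have kD' := leq_trans (leq_pred k) kD1.
have thT := node_in Dpart kD'; have tkT := node_in Dpart kD1.
have [UT VT] : U T = 1%:M /\ V T = 1%:M.
  exact (flow_end T_gt0 UV).
have [_ _ bP] := bmeas_rates H cs bW thT.
move: (tkT); rewrite in_itv/= => /andP[tk0 tkT'].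
have bP' := bmeas_sub tk0 (lexx T) bP.
rewrite /end_value; cbv zeta beta; rewrite UT mul1mx /readP_at /readP mulmxDr mulmxDl.
congr (_ + _).
rewrite -(mxintMl _ bP') -(mxintMr _ (bmeas_mul (bmeas_cst _ _ _) bP')).
apply: mxint_ext => r rtT.
have -> : psi_of B R D P (fun s t => U s *m V t) r (node D k)
    = - (gK (sg r) r *m P r *m (U r *m V (node D k))).
  by rewrite /psi_of /gainK.
exact: end_value_algebra.
Qed.

Lemma fixpoint_game_sol : game_sol T A B Q R G D (P, fun s t => U s *m V t).
Proof.
split => [k kD||t tT].
- move: (kD) => /andP[k0 kD1]; have kD' := leq_trans (leq_pred k) kD1.
  have thT := node_in Dpart kD'; have tkT := node_in Dpart kD1.
  have kk : node D k.-1 < node D k by apply: (node_lt Dpart _ kD1); rewrite prednK.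
  have cP := readP_at_continuous H cs bW fW thT.
  move: (thT) (tkT); rewrite !in_itv/= => /andP[th0 thT'] /andP[tk0 tkT'].
  split.
  + move=> s ks; have d := game_riccati kD ks; split; first by case: d.
    rewrite derive1E derive_val.
    by rewrite -!addrA addNr.
  + have cr := within_cvg_at_right T_gt0 cP th0 (lt_le_trans kk tkT').
    rewrite (game_P_itv kD); last by rewrite lexx kk.
    apply: cvg_trans cr; apply: near_eq_cvg.
    near=> r; rewrite (game_P_itv kD)//; apply/andP; split; last first.
      by near: r; exact: nbhs_right_lt.
    by apply/ltW; near: r; exact: nbhs_right_gt.
  + rewrite game_end_value//.
    have cl := within_cvg_at_left T_gt0 cP (le_lt_trans th0 kk) tkT'.
    apply: cvg_trans cl; apply: near_eq_cvg.
    near=> r; rewrite (game_P_itv kD)//; apply/andP; split.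
      by near: r; exact: nbhs_left_ge.
    by near: r; exact: nbhs_left_lt.
- have kD : (0 < size D <= size D)%N by rewrite (partition_size_gt0 T_gt0 Dpart) leqnn.
  have [k0 _] := andP kD.
  have thT := node_in Dpart (leq_pred (size D)).
  have cP := readP_at_continuous H cs bW fW thT.
  have kk : node D (size D).-1 < T.
    by rewrite -[X in _ < X](node_last Dpart); apply: (node_lt Dpart) => //; rewrite prednK.
  (* [left_node D T] is the last node before T, so the value at T continues the last interval and is
     the left limit. *)
  have PT : P T = Pat (node D (size D).-1) T.
    have TT : T \in `[0, T] by rewrite in_itv/= lexx andbT ltW.
    have sgT : left_node D T = node D (size D).-1.
      by apply: (left_nodeE Dpart); rewrite ?prednK ?eqxx ?orbT//; exact: ltW.
    by rewrite /P (fixpoint_P fW TT) /readP_at /sg sgT.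
  rewrite PT; have cl := within_cvg_at_left T_gt0 cP T_gt0 (lexx T).
  apply: cvg_trans cl; apply: near_eq_cvg.
  near=> r; rewrite (game_P_itv kD)// (node_last Dpart); apply/andP; split.
    by near: r; exact: nbhs_left_ge.
  by near: r; exact: nbhs_left_lt.
- move: (tT); rewrite in_itv/= => /andP[t0 tT'].
  split; first exact: game_UV.
    have cU := within_itv_sub t0 (lexx T) (flow_continuousU bc UV).
    apply: within_mulmx cU _.
    by apply: continuous_subspaceT => x; exact: cvg_cst.
  move=> s /andP[ts sT] sD.
  have sT' : s \in `]0, T[ by rewrite in_itv/= (le_lt_trans t0).
  have dU := flow_deriveU T_gt0 bc UV sT' (game_closed_loop_continuous sT' sD).
  have d := is_derive_mulmx dU (is_derive_cst (V t) s (1 : K)).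
  split; first by case: d.
  rewrite derive1E derive_val mulmx0 addr0 mulmxA; congr (_ *m _ *m _).
  by rewrite /closed_loop /frozen /gainK !mulmxA.
Unshelve. all: by end_near. Qed.

End GameSolution.

(** * Uniqueness of the solution of the game *)

Section BackwardUniqueness.
Context {K : realType}.

(** z(r) = y(r) exp(C r) has derivative exp(C r) (C y + y') >= 0 and tends to 0 at [b]; a
    nondecreasing nonnegative function with this limit vanishes. *)
Lemma backward_gronwall_zero (y dy : K -> K) (a b C : K) :
  (forall s, s \in `]a, b[ -> is_derive s 1 y (dy s)) ->
  (forall s, s \in `]a, b[ -> 0 <= y s) ->
  (forall s, s \in `]a, b[ -> `|dy s| <= C * y s) ->
  y r @[r --> b^'-] --> 0 ->
  forall s, s \in `]a, b[ -> y s = 0.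
Proof.
move=> hy y0 hdy ylim s sab.
pose z r := y r * expR (C * r).
have dexp (r : K) : is_derive r 1 (fun x => expR (C * x)) (expR (C * r) * C).
  have h := is_deriveZ C (is_derive_id r (1 : K)).
  have h2 := @is_derive1_comp _ expR (fun x => C * x) _ _ _ (is_derive_expR _) h.
  by apply: is_derive_eq h2 _; rewrite /= [C *: _]mulr1.
have dz r : r \in `]a, b[ ->
    is_derive r 1 z (y r *: (expR (C * r) * C) + expR (C * r) *: dy r).
  by move=> /hy h; exact: is_deriveM h (dexp r).
have zmono : {in `]a, b[ &, {homo z : u v / u <= v}}.
  apply: ger0_derive1_le_oo => [r /dz[]//|r rab|r rab].
    have h := dz r rab; rewrite derive1E derive_val.
    rewrite (_ : _ + _ = expR (C * r) * (C * y r + dy r)); last first.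
      by rewrite /GRing.scale/=; ring.
    rewrite mulr_ge0 ?expR_ge0//.
    by have := hdy r rab; rewrite ler_norml => /andP[+ _]; lra.
  have rab' : r \in `]a, b[ by move: rab; rewrite inE.
  by apply: differentiable_continuous; apply/derivable1_diffP; have [] := dz r rab'.
apply/eqP; rewrite eq_le y0// andbT leNgt; apply/negP => ys.
have zs : 0 < z s by rewrite mulr_gt0// expR_gt0.
have zlim : z r @[r --> b^'-] --> 0.
  rewrite -[X in _ --> X](mul0r (expR (C * b))); apply: cvgM => //.
  apply: cvg_at_left_filter; apply: continuous_comp; last exact: continuous_expR.
  by apply: cvgM; [exact: cvg_cst|exact: cvg_id].
have zlt : \forall r \near b^'-, z r < z s.
  by apply: (cvgr_lt _ zlim).
move: (sab); rewrite in_itv/= => /andP[as_ sb].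
have : \forall r \near b^'-, False.
  near=> r.
  have sr : s < r by near: r; exact: nbhs_left_gt.
  have rb : r < b by near: r; exact: nbhs_left_lt.
  have rab : r \in `]a, b[ by rewrite in_itv/= rb (lt_trans as_).
  have zr : z r < z s by near: r.
  by have := le_lt_trans (zmono _ _ sab rab (ltW sr)) zr; rewrite ltxx.
by move=> /filter_ex[].
Unshelve. all: by end_near. Qed.

(** The maximum norm is not differentiable; the trace of E^T E replaces it. It dominates the squared
    norm, and its derivative is at most 2 q p |C| times itself, with [q] diagonal entries and inner
    dimension [p]. *)
Lemma mx_backward_gronwall_zero p q (E dE : K -> 'M[K]_(p, q)) (a b C : K) :
  (forall s, s \in `]a, b[ -> is_derive s 1 E (dE s)) ->
  (forall s, s \in `]a, b[ -> `|dE s| <= C * `|E s|) ->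
  E r @[r --> b^'-] --> (0 : 'M[K]_(p, q)) ->
  forall s, s \in `]a, b[ -> E s = 0.
Proof.
move=> hE hdE Elim.
pose y s := \sum_(i < q) ((E s)^T *m E s) i i.
have yE s : y s = \sum_(i < q) \sum_(k < p) (E s k i) ^+ 2.
  apply: eq_bigr => i _; rewrite mxE; apply: eq_bigr => k _.
  by rewrite mxE expr2.
have Ey s i j : (E s i j) ^+ 2 <= y s.
  rewrite yE (bigD1 j)//= (bigD1 i)//= -addrA lerDl addr_ge0//.
    by apply: sumr_ge0 => k _; exact: sqr_ge0.
  by apply: sumr_ge0 => k _; apply: sumr_ge0 => l _; exact: sqr_ge0.
have y0 s : 0 <= y s.
  by rewrite yE; apply: sumr_ge0 => k _; apply: sumr_ge0 => l _; exact: sqr_ge0.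
have E2 s : `|E s| ^+ 2 <= y s.
  rewrite -(sqr_sqrtr (y0 s)) ler_sqr ?nnegrE ?sqrtr_ge0//.
  apply: mx_norm_le => [|i j]; first exact: sqrtr_ge0.
  by rewrite -ler_sqr ?nnegrE ?sqrtr_ge0// sqr_sqrtr// real_normK ?num_real.
pose dy s := \sum_(i < q) ((dE s)^T *m E s + (E s)^T *m dE s) i i.
have hy s : s \in `]a, b[ -> is_derive s 1 y (dy s).
  move=> sab; have h := hE s sab.
  have /is_derive_mxP h2 := is_derive_mulmx (is_derive_trmx h) h.
  have -> : y = \sum_(i < q) (fun s => ((E s)^T *m E s) i i).
    by apply/funext => r; rewrite fct_sumE.
  by apply: is_derive_sum => i; exact: h2.
have hdy s : s \in `]a, b[ -> `|dy s| <= q%:R * (2 * (p%:R * `|C|)) * y s.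
  move=> sab; rewrite (le_trans (ler_norm_sum _ _ _))//.
  have dEC : `|dE s| <= `|C| * `|E s|.
    by apply: le_trans (hdE s sab) _; rewrite ler_wpM2r// ler_norm.
  have key i : `|((dE s)^T *m E s + (E s)^T *m dE s) i i|
      <= 2 * (p%:R * `|C|) * y s.
    rewrite (le_trans (mx_entry_le _ _ _))// (le_trans (ler_normD _ _))//.
    apply: le_trans (lerD (mx_norm_mul _ _) (mx_norm_mul _ _)) _.
    rewrite !mx_norm_tr [`|E s| * _]mulrC.
    have h : `|dE s| * `|E s| <= `|C| * y s.
      apply: (@le_trans _ _ (`|C| * `|E s| ^+ 2)); last by rewrite ler_wpM2l.
      by rewrite expr2 mulrA ler_wpM2r.
    have := ler_wpM2l (ler0n K p) h; lra.
  apply: (@le_trans _ _ (\sum_(i < q) 2 * (p%:R * `|C|) * y s)).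
    by apply: ler_sum => i _; exact: key.
  by rewrite sumr_const card_ord -[leLHS]mulr_natl !mulrA.
have ylim : y r @[r --> b^'-] --> 0.
  have h i : ((E r)^T *m E r) i i @[r --> b^'-]
      --> ((0 : 'M[K]_(p, q))^T *m (0 : 'M[K]_(p, q))) i i.
    by apply: (mx_cvgP _ _).1; exact: mulmx_cvg (trmx_cvg Elim) Elim.
  have h0 : \sum_(i < q) ((0 : 'M[K]_(p, q))^T *m (0 : 'M[K]_(p, q))) i i = 0.
    by rewrite big1// => i _; rewrite mulmx0 mxE.
  have hs : y r @[r --> b^'-]
      --> \sum_(i < q) ((0 : 'M[K]_(p, q))^T *m (0 : 'M[K]_(p, q))) i i.
    by apply: cvg_big => [|i _]; [exact: add_continuous|exact: h].
  by rewrite h0 in hs.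
move=> s sab; have ys := backward_gronwall_zero hy (fun s _ => y0 s) hdy ylim sab.
apply/eqP; rewrite -normr_eq0 -sqrf_eq0 eq_le sqr_ge0 andbT.
by rewrite -ys E2.
Qed.

(** Extension by the one-sided limits is continuous on the compact interval. This bounds Riccati
    solutions of which only the limits at the nodes are known. *)
Lemma itv_oo_bounded p q (F : K -> 'M[K]_(p, q)) (a b : K)
    (la lb : 'M[K]_(p, q)) : a < b ->
  (forall s, s \in `]a, b[ -> {for s, continuous F}) ->
  F r @[r --> a^'+] --> la -> F r @[r --> b^'-] --> lb ->
  exists C, forall s, s \in `]a, b[ -> `|F s| <= C.
Proof.
move=> ab cF Fa Fb.
pose f r := if r <= a then la else if b <= r then lb else F r.
have fF s : s \in `]a, b[ -> f s = F s.
  by rewrite in_itv/= /f => /andP[as_ sb]; rewrite !leNgt as_ sb.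
have cf : {within `[a, b], continuous f}.
  apply/(continuous_within_itvP _ ab); split => [s sab||].
  - apply: near_eq_continuous_at (cF s sab).
    move: sab; rewrite in_itv/= => /andP[as_ sb].
    near=> r; apply: fF; rewrite in_itv/=; apply/andP.
    by split; near: r; [exact: lt_nbhsr|exact: lt_nbhsl].
  - rewrite {2}/f lexx; apply: cvg_trans Fa; apply: near_eq_cvg.
    near=> r; apply/esym/fF; rewrite in_itv/=; apply/andP.
    by split; near: r; [exact: nbhs_right_gt|exact: nbhs_right_lt].
  - rewrite {2}/f leNgt ab lexx; apply: cvg_trans Fb; apply: near_eq_cvg.
    near=> r; apply/esym/fF; rewrite in_itv/=; apply/andP.
    by split; near: r; [exact: nbhs_left_gt|exact: nbhs_left_lt].
have [_ [C fC]] := within_bmeas cf; exists C => s sab.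
by rewrite -fF// fC//; exact: subset_itv_oo_cc.
Unshelve. all: by end_near. Qed.

End BackwardUniqueness.

Section GameUniqueness.
Context {K : realType} {n m : nat} (T : K).
Variables (A : K -> K -> 'M[K]_n) (B : K -> K -> 'M[K]_(n, m)).
Variables (Q : K -> K -> 'M[K]_n) (R : K -> K -> 'M[K]_m) (G : K -> 'M[K]_n).
Variables (L delta : K).
Hypothesis H : lq_hyps T A B Q R G L delta.
Let T_gt0 := lq_T_gt0 H.
Local Notation stack := 'M[K]_(n + (n + n), n).
Local Notation vop := (volterra_op T A B Q R G).
Local Notation cloop := (closed_loop A B R).
Variables (D : seq K) (W : K -> stack).
Hypothesis Dpart : itv_partition 0 T D.
Hypothesis bW : bmeas 0 T W.
Hypothesis fW : forall t : K, t \in `[0, T] -> W t = vop (left_node D) W t.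
Variables (P1 : K -> 'M[K]_n) (Phi1 : K -> K -> 'M[K]_n).
Hypothesis sol1 : game_sol T A B Q R G D (P1, Phi1).

Let cs : coef_bmeas T A B R (left_node D) :=
  coef_bmeas_tame H (left_node_tame T_gt0 Dpart).
Let P t := stP (W t).
Let PhiW (s t : K) := stU (W s) *m stV (W t).
Let bc := fixpoint_closed_loop_bmeas cs bW.
Let UV := fixpoint_flow bW fW.

(** Once the two P agree on [t0, T], both transition maps solve the same linear equation off the
    nodes. *)
Lemma game_Phi_unique t0 : 0 <= t0 ->
  (forall t, t0 <= t -> t <= T -> P1 t = P t) ->
  forall s t, t0 <= t -> t <= s -> s <= T -> Phi1 s t = PhiW s t.
Proof.
move=> t00 PP s t t0t ts sT; have t0' := le_trans t00 t0t.
have tT := le_trans ts sT.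
have [_ _ hPhi] := sol1.
have [Phitt cPhi dPhi] : [/\ Phi1 t t = 1%:M,
            {within `[t, T], continuous (Phi1 ^~ t)}
          & forall s, t < s < T -> s \notin D ->
              derivable (Phi1 ^~ t) s 1 /\
              derive1 (Phi1 ^~ t) s
                = (frozen D A s - frozen D B s *m invmx (frozen D R s)
                   *m (frozen D B s)^T *m P1 s) *m Phi1 s t].
  by apply: hPhi; rewrite in_itv/= t0'.
have dX r : r \in `]t, T[ -> r \notin D ->
    is_derive r 1 (Phi1 ^~ t) (cloop P (left_node D) r *m Phi1 r t).
  rewrite in_itv/= => rtT rD; have [d1 d2] := dPhi r rtT rD.
  apply: DeriveDef => //; rewrite -derive1E d2; congr (_ *m _).
  move: rtT => /andP[/ltW tr /ltW rT].
  by rewrite PP ?(le_trans t0t)// /frozen /closed_loop /gainK !mulmxA.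
have h := flow_unique T_gt0 bc UV
  (game_closed_loop_continuous H Dpart bW fW) t0' ts sT cPhi dX.
by rewrite h Phitt mulmx1.
Qed.

(** The end value at t_k involves only data on [t_k, T]; this is what lets the backward induction
    pass from one interval to the previous one. *)
Lemma end_value_eq k (P2 : K -> 'M[K]_n) (Phi2 : K -> K -> 'M[K]_n) :
  (0 < k <= size D)%N ->
  (forall t, node D k <= t -> t <= T -> P1 t = P2 t) ->
  (forall s t, node D k <= t -> t <= s -> s <= T -> Phi1 s t = Phi2 s t) ->
  end_value T B Q R G D P1 Phi1 k = end_value T B Q R G D P2 Phi2 k.
Proof.
move=> /andP[_ kD] PP PhiPhi.
have := node_in Dpart kD; rewrite in_itv/= => /andP[k0 kT].
rewrite /end_value; cbv zeta; rewrite (PhiPhi _ _ (lexx _) kT (lexx T)).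
congr (_ + _).
apply: mxint_ext => r; rewrite in_itv/= => /andP[kr rT].
by rewrite /psi_of (PhiPhi _ _ (lexx _) kr rT) (PP _ kr rT).
Qed.

(** Both functions solve the same Riccati equation with the same left limit at t_k. They are bounded
    on the interval, so the quadratic right-hand side is Lipschitz along them and the backward
    Gronwall argument applies; the left endpoint follows from right continuity. *)
Lemma game_P_unique_itv k : (0 < k <= size D)%N ->
  P1 r @[r --> (node D k)^'-] --> end_value T B Q R G D P PhiW k ->
  forall s, node D k.-1 <= s < node D k -> P1 s = P s.
Proof.
move=> kD lim1.
move: (kD) => /andP[k0 kD1]; have kD' := leq_trans (leq_pred k) kD1.
have sol2 := fixpoint_game_sol H Dpart bW fW.
have [hP1 _ _] := sol1; have [hP2 _ _] := sol2.
have [ode1 right1 _] := hP1 k kD; have [ode2 right2 left2] := hP2 k kD.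
set a := node D k.-1 in ode1 right1 ode2 right2 *.
set b := node D k in ode1 ode2 left2 lim1 *.
have ab : a < b by apply: (node_lt Dpart _ kD1); rewrite prednK.
have aT := node_in Dpart kD'; have bT := node_in Dpart kD1.
have abT s : s \in `]a, b[ -> s \in `[0, T].
  move: aT bT; rewrite !in_itv/= => /andP[a0 _] /andP[_ bT'] /andP[as_ sb].
  by rewrite (le_trans a0 (ltW as_)) (le_trans (ltW sb)).
pose f (X : K -> 'M[K]_n) s := - (X s *m frozen D A s + (frozen D A s)^T *m X s
  + frozen D Q s
  - X s *m (frozen D B s *m invmx (frozen D R s) *m (frozen D B s)^T) *m X s).
have ode (X : K -> 'M[K]_n) : (forall s, a < s < b -> derivable X s 1 /\
    derive1 X s + X s *m frozen D A s + (frozen D A s)^T *m X s + frozen D Q s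
      - X s *m frozen D B s *m invmx (frozen D R s) *m (frozen D B s)^T *m X s = 0) ->
    forall s, s \in `]a, b[ -> is_derive s 1 X (f X s).
  move=> h s; rewrite in_itv/= => sab; have [d1 d2] := h s sab.
  apply: DeriveDef => //; rewrite -derive1E /f.
  apply/eqP; rewrite -addr_eq0 -d2 !addrA; apply/eqP.
  by rewrite !mulmxA.
have d1 := ode _ ode1; have d2 := ode _ ode2.
have cont (X : K -> 'M[K]_n) : (forall s, s \in `]a, b[ -> is_derive s 1 X (f X s)) ->
    forall s, s \in `]a, b[ -> {for s, continuous X}.
  move=> h s sab; apply: differentiable_continuous; apply/derivable1_diffP.
  by have [] := h s sab.
have [C1 b1] := itv_oo_bounded ab (cont _ d1) right1 lim1.
have [C2 b2] := itv_oo_bounded ab (cont _ d2) right2 left2.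
pose Om : set K := [set s | s \in `]a, b[].
pose e s := `|P1 s - P s|.
have sT s : Om s -> left_node D s \in `[0, T].
  by move=> /abT; exact: left_node_in.
have rT s : Om s -> s \in `[0, T] by exact: abT.
have [uA uB uQ uR _] := ubnd_coeffs H sT rT.
have uRi : ubnd Om (fun s => invmx (R (left_node D s) s)).
  apply: (@ubnd_inv _ _ _ _ _ delta); first exact: lq_delta_gt0 H.
  by move=> s Os; apply: (lq_R_pd H); [exact: sT|exact: rT].
have u1 : ubnd Om P1 by exact: ubnd_le b1.
have u2 : ubnd Om P by exact: ubnd_le b2.
have c12 : uclose Om e P1 P by exists 1 => // s _; rewrite mul1r.
have [C C0 hC] : uclose Om e (f P1) (f P).
  rewrite /f /frozen.
  have cA := uclose_refl Om e (fun s => A (left_node D s) s).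
  have cB := uclose_refl Om e (fun s => B (left_node D s) s).
  have cQ := uclose_refl Om e (fun s => Q (left_node D s) s).
  have cR := uclose_refl Om e (fun s => invmx (R (left_node D s) s)).
  by repeat first [uclose_step|ubnd_step].
have E0 : forall s, s \in `]a, b[ -> P1 s - P s = 0.
  apply: (@mx_backward_gronwall_zero _ _ _ (fun s => P1 s - P s)
    (fun s => f P1 s - f P s) a b C).
  - by move=> s sab; have h1 := d1 s sab; have h2 := d2 s sab; exact: is_deriveB.
  - by move=> s sab; exact: hC.
  - by rewrite -(subrr (end_value T B Q R G D P PhiW k)); exact: cvgB lim1 left2.
have PPo s : s \in `]a, b[ -> P1 s = P s.
  by move=> /E0/eqP; rewrite subr_eq0 => /eqP.
move=> s /andP[]; rewrite le_eqVlt => /predU1P[<- _|as_ sb]; last first.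
  by apply: PPo; rewrite in_itv/= as_.
have right1' : P1 r @[r --> a^'+] --> P a.
  apply: cvg_trans right2; apply: near_eq_cvg.
  near=> r; rewrite PPo// in_itv/=; apply/andP; split; near: r.
    exact: nbhs_right_gt.
  exact: nbhs_right_lt.
exact: (cvg_unique _ right1 right1').
Unshelve. all: by end_near. Qed.

Lemma game_P_unique t : t \in `[0, T] -> P1 t = P t.
Proof.
have sol2 := fixpoint_game_sol H Dpart bW fW.
have [hP1 endP1 hPhi1] := sol1; have [hP2 endP2 _] := sol2.
have D0 := partition_size_gt0 T_gt0 Dpart.
have TT : T \in `[0, T] by rewrite in_itv/= lexx andbT ltW.
(* At t_N the integral in the end value is empty and Phi(T; T) = I, so both end values are
   G(t_(N-1)). *)
have PT : P1 T = P T.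
  have kD : (0 < size D <= size D)%N by rewrite D0 leqnn.
  have [_ _ left1] := hP1 _ kD; have [_ _ left2] := hP2 _ kD.
  have e12 : end_value T B Q R G D P1 Phi1 (size D)
      = end_value T B Q R G D P PhiW (size D).
    rewrite /end_value; cbv zeta; rewrite (node_last Dpart) !mxint_point.
    have [Phitt _ _] := hPhi1 T TT; rewrite Phitt.
    have -> : PhiW T T = 1%:M by exact (game_UV H Dpart bW fW TT).
    by [].
  rewrite (node_last Dpart) e12 in left1.
  rewrite (node_last Dpart) in left2.
  rewrite (cvg_unique _ endP1 left1) //.
  exact/esym/(cvg_unique _ endP2 left2).
(* [j] counts the intervals from T down. *)
suff main : forall j, (j <= size D)%N ->
    forall t, node D (size D - j) <= t -> t <= T -> P1 t = P t.
  rewrite in_itv/= => /andP[t0 tT]; apply: (main (size D)) => //.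
  by rewrite subnn.
elim=> [_ s|j IH jD s].
  by rewrite subn0 (node_last Dpart) => Ts sT; have -> : s = T by apply/eqP; rewrite eq_le sT.
have {}IH := IH (ltnW jD).
set k := (size D - j)%N in IH.
have kD : (0 < k <= size D)%N by rewrite subn_gt0 jD leq_subr.
have kE : (size D - j.+1)%N = k.-1 by rewrite subnS.
rewrite kE => ks sT; have [sk|ks'] := ltP s (node D k); last exact: IH.
apply: (game_P_unique_itv kD); last by rewrite ks.
have [_ _ left1] := hP1 k kD.
have k0 : 0 <= node D k.
  by have /andP[_ kD1] := kD; have := node_in Dpart kD1; rewrite in_itv/= => /andP[].
by rewrite -(end_value_eq kD IH (game_Phi_unique k0 IH)).
Qed.

Lemma game_sol_unique : (forall t : K, t \in `[0, T] -> P1 t = P t) /\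
  forall s t : K, 0 <= t -> t <= s -> s <= T -> Phi1 s t = PhiW s t.
Proof.
split; first exact: game_P_unique.
apply: game_Phi_unique => // t t0 tT.
by apply: game_P_unique; rewrite in_itv/= t0.
Qed.

End GameUniqueness.

(** * States and costs *)

Section StateAndCost.
Context {K : realType} {n m : nat} (T : K).
Variables (A : K -> K -> 'M[K]_n) (B : K -> K -> 'M[K]_(n, m)).
Variables (Q : K -> K -> 'M[K]_n) (R : K -> K -> 'M[K]_m) (G : K -> 'M[K]_n).
Variables (L delta : K).
Hypothesis H : lq_hyps T A B Q R G L delta.
Let T_gt0 := lq_T_gt0 H.

Definition state_op (D : seq K) (x : 'cV[K]_n) (u : K -> 'cV[K]_m)
    (X : K -> 'cV[K]_n) (s : K) : 'cV[K]_n :=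
  x + mxint 0 s (fun r => frozen D A r *m X r + frozen D B r *m u r).

Lemma mxint_head_continuous p q (F : K -> 'M[K]_(p, q)) : bmeas 0 T F ->
  {within `[0, T], continuous (fun t => mxint 0 t F)}.
Proof.
move=> bF; have [mF [C FC]] := bF.
apply: (@lip_within_continuous _ _ _ _ _ C) => s t s0 st tT.
have bFt := bmeas_sub (lexx 0) tT bF.
rewrite (mxint_cat s0 st bFt) opprD addrA subrr add0r normrN.
apply: mxint_norm_cst => //; first exact: bmeas_sub bF.
by move=> r; rewrite in_itv/= => /andP[sr rt]; apply: FC;
  rewrite in_itv/= (le_trans s0)// (le_trans rt).
Qed.

Section OneControl.
Variables (D : seq K) (x : 'cV[K]_n) (u : K -> 'cV[K]_m).
Hypothesis Dpart : itv_partition 0 T D.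
Hypothesis bu : bmeas 0 T u.
Variable CA : K.
Hypothesis CA0 : 0 <= CA.
Hypothesis ACA : forall t s : K, t \in `[0, T] -> s \in `[0, T] -> `|A t s| <= CA.

Let cs : coef_bmeas T A B R (left_node D) :=
  coef_bmeas_tame H (left_node_tame T_gt0 Dpart).
Let lam := 2 * (n%:R * CA) + 1.
Let w (s : K) := expR (lam * (s - 0)).

Lemma state_rate_bmeas X : bmeas 0 T X ->
  bmeas 0 T (fun r => frozen D A r *m X r + frozen D B r *m u r).
Proof.
move=> bX; have [_ bA bB _] := cs.
exact: bmeas_add (bmeas_mul bA bX) (bmeas_mul bB bu).
Qed.

Lemma state_op_continuous X : bmeas 0 T X ->
  {within `[0, T], continuous (state_op D x u X)}.
Proof.
move=> bX; have cst_x : {within `[0, T], continuous (fun=> x)}.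
  by apply: continuous_subspaceT => y; exact: cvg_cst.
exact: within_add cst_x (mxint_head_continuous (state_rate_bmeas bX)).
Qed.

Lemma state_lam_gt0 : 0 < lam.
Proof. by rewrite /lam ltr_wpDl// !mulr_ge0. Qed.

Lemma state_weight s : s \in `[0, T] -> 1 <= w s <= expR (lam * T).
Proof.
rewrite in_itv/= => /andP[s0 sT]; have l0 := ltW state_lam_gt0.
rewrite /w subr0 -[X in X <= _]expR0 !ler_expR mulr_ge0//=.
by rewrite ler_wpM2l.
Qed.

(** The control term cancels in the difference. The rest has factor n [CA] / [lam], at most 1/2, in
    the norm weighted forward in time. *)
Lemma state_op_contraction X1 X2 c : bmeas 0 T X1 -> bmeas 0 T X2 -> 0 <= c ->
  (forall r : K, r \in `[0, T] -> `|X1 r - X2 r| <= c * w r) ->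
  forall r : K, r \in `[0, T] ->
    `|state_op D x u X1 r - state_op D x u X2 r| <= c / 2 * w r.
Proof.
move=> b1 b2 c0 X12 s sT; have [_ bA bB _] := cs.
move: (sT); rewrite in_itv/= => /andP[s0 sT'].
have bs X : bmeas 0 T X ->
    bmeas 0 s (fun r => frozen D A r *m X r + frozen D B r *m u r).
  by move=> bX; exact: bmeas_sub (lexx 0) sT' (state_rate_bmeas bX).
rewrite /state_op opprD addrACA subrr add0r -mxintB; [|exact: bs|exact: bs].
have g r : r \in `[0, s] ->
    `|frozen D A r *m X1 r + frozen D B r *m u r
      - (frozen D A r *m X2 r + frozen D B r *m u r)|
    <= n%:R * (CA * c) * expR (lam * (r - 0)).
  move=> rs; have rT : r \in `[0, T] by exact: in_itv_sub rs.
  rewrite opprD addrACA subrr addr0 -mulmxBr.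
  rewrite (le_trans (mx_norm_mul _ _))// -!mulrA ler_wpM2l//.
  by rewrite ler_pM ?X12// ACA// left_node_in.
apply: le_trans (mxint_norm_le _ _ g) _.
- by apply: bmeas_add; [exact: bs|apply: bmeas_opp; exact: bs].
- apply: continuous_subspaceT => y; apply: cvgM; first exact: cvg_cst.
  apply: continuous_comp; last exact: continuous_expR.
  apply: cvgM; first exact: cvg_cst.
  by apply: cvgB; [exact: cvg_id|exact: cvg_cst].
apply: le_trans (Rintegral_exp_head state_lam_gt0 _ s0) _.
  by rewrite !mulr_ge0.
rewrite ler_wpM2r ?expR_ge0// ler_pdivrMr ?state_lam_gt0//.
have h : n%:R * CA <= 2^-1 * lam by rewrite /lam; lra.
rewrite (_ : n%:R * (CA * c) = c * (n%:R * CA)); last by ring.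
by rewrite -mulrA ler_wpM2l.
Qed.

Lemma is_state_unique X1 X2 : is_state T A B D x u X1 -> is_state T A B D x u X2 ->
  forall s : K, s \in `[0, T] -> X1 s = X2 s.
Proof.
move=> [c1 h1] [c2 h2].
have b1 := within_bmeas c1; have b2 := within_bmeas c2.
have [_ [C bC]] := bmeas_add b1 (bmeas_opp b2).
move=> s sT; apply/eqP; rewrite -subr_eq0; apply/eqP; move: s sT.
apply: (@weighted_unique _ _ _ 0 T w C) => //.
  by move=> r /state_weight/andP[].
move=> c c0 hc r rT; rewrite (h1 r rT) (h2 r rT).
exact: state_op_contraction b1 b2 c0 hc r rT.
Qed.

(** A posteriori estimate: a candidate with defect [e] is within a multiple of [e] of the true
    state. The fixed point also shows that a state exists, so that [state], which is a choice, is
    one. *)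
Lemma state_close (X0 : K -> 'cV[K]_n) (e : K) : 0 <= e -> bmeas 0 T X0 ->
  (forall s : K, s \in `[0, T] -> `|state_op D x u X0 s - X0 s| <= e) ->
  {within `[0, T], continuous (state T A B D x u)} /\
  forall s : K, s \in `[0, T] ->
    `|state T A B D x u s - X0 s| <= 2 * e * expR (lam * T).
Proof.
move=> e0 bX0 hX0.
have [] := @weighted_fixpoint K _ _ 0 T w (expR (lam * T)) (2 * e) e
  (state_op D x u) X0.
- by move=> r /state_weight/andP[/(le_trans ler01)-> ->].
- exact: e0.
- by [].
- exact: bX0.
- by move=> X bX _; apply: within_bmeas; exact: state_op_continuous.
- by move=> X1 X2 c b1 b2 _ _ c0 h; exact: state_op_contraction b1 b2 c0 h.
- move=> r rT; apply: le_trans (hX0 r rT) _.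
  by rewrite ler_peMr//; have /andP[] := state_weight rT.
move=> X [bX XX0 fX].
have sX : is_state T A B D x u X.
  split => [y|s sT]; last exact: fX.
  apply: (@subspace_eq_continuous _ _ _ (state_op D x u X)).
    by move=> r; rewrite inE/= => rT; rewrite /from_subspace/= -fX.
  exact: state_op_continuous.
have sS : is_state T A B D x u (state T A B D x u).
  by apply: getPex; exists X.
split; first by have [] := sS.
move=> s sT; rewrite (is_state_unique sS sX sT).
apply: le_trans (XX0 s sT) _; rewrite ler_wpM2l ?mulr_ge0//.
by have /andP[] := state_weight sT.
Qed.

End OneControl.

(** The cost as a 1 by 1 matrix, so that the estimates on matrix integrals apply. *)
Definition cost_mx (tau : K) (X : K -> 'cV[K]_n) (u : K -> 'cV[K]_m) : 'M[K]_1 :=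
  (G tau *m X T)^T *m X T
  + mxint tau T (fun s => (Q tau s *m X s)^T *m X s + (R tau s *m u s)^T *m u s).

Lemma costE (D : seq K) x k u :
  cost T A B Q R G D x k u
  = cost_mx (node D k.-1) (state T A B D x u) u 0 0.
Proof.
rewrite /cost /cost_mx /qform [RHS]mxE; congr (_ + _); rewrite [RHS]mxE.
by apply: eq_Rintegral => s _; rewrite [RHS]mxE.
Qed.

Lemma qform_close p N : exists2 C, 0 <= C &
  forall (M : 'M[K]_p) (v v' : 'cV[K]_p), `|M| <= N -> `|v| <= N -> `|v'| <= N ->
    `|(M *m v)^T *m v - (M *m v')^T *m v'| <= C * `|v - v'|.
Proof.
pose I := ('M[K]_p * ('cV[K]_p * 'cV[K]_p))%type.
pose Om : set I := [set i | [/\ `|i.1| <= N, `|i.2.1| <= N & `|i.2.2| <= N]].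
pose e (i : I) := `|i.2.1 - i.2.2|.
have uM : ubnd Om (fun i => i.1) by apply: (@ubnd_le _ _ _ _ _ _ N) => i [].
have uv : ubnd Om (fun i => i.2.1) by apply: (@ubnd_le _ _ _ _ _ _ N) => i [].
have uv' : ubnd Om (fun i => i.2.2) by apply: (@ubnd_le _ _ _ _ _ _ N) => i [].
have cM := uclose_refl Om e (fun i => i.1).
have cv : uclose Om e (fun i => i.2.1) (fun i => i.2.2).
  by exists 1 => // i _; rewrite mul1r.
have [C C0 hC] : uclose Om e (fun i => (i.1 *m i.2.1)^T *m i.2.1)
    (fun i => (i.1 *m i.2.2)^T *m i.2.2).
  by repeat first [uclose_step|ubnd_step].
by exists C => // M v v' hM hv hv'; apply: (hC (M, (v, v'))).
Qed.

Lemma cost_close N : exists2 C, 0 <= C &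
  forall (tau e : K) (X X' : K -> 'cV[K]_n) (u u' : K -> 'cV[K]_m),
  tau \in `[0, T] -> 0 <= e ->
  bmeas 0 T X -> bmeas 0 T X' -> bmeas 0 T u -> bmeas 0 T u' ->
  (forall s : K, s \in `[0, T] ->
    [/\ `|X s| <= N, `|X' s| <= N, `|u s| <= N & `|u' s| <= N]) ->
  (forall s : K, s \in `[0, T] -> `|X s - X' s| <= e /\ `|u s - u' s| <= e) ->
  `|cost_mx tau X u - cost_mx tau X' u'| <= C * e.
Proof.
have [NQ hQ] := square_bounded (lq_Q_cont H).
have [NR hR] := square_bounded (lq_R_cont H).
have [_ [NG hG]] := within_bmeas (lq_G_cont H).
pose M := Num.max N (Num.max NQ (Num.max NR NG)).
have leM (y : K) : (y <= N) || (y <= NQ) || (y <= NR) || (y <= NG) -> y <= M.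
  by rewrite !le_max -!orbA.
have [C1 C10 h1] := qform_close n M; have [C2 C20 h2] := qform_close m M.
have T0 : 0 <= T by exact: ltW.
(* The terminal term, then the two running terms over an interval of length at most T. *)
exists (C1 + (C1 + C2) * T) => [|tau e X X' u u' tauT e0 bX bX' bu bu' hN he].
  by rewrite addr_ge0// mulr_ge0// addr_ge0.
have TT : T \in `[0, T] by rewrite in_itv/= lexx andbT.
move: (tauT); rewrite in_itv/= => /andP[tau0 tauT'].
have bQ := slice_bmeas (lq_Q_cont H) tauT.
have bR := slice_bmeas (lq_R_cont H) tauT.
have bf Y v : bmeas 0 T Y -> bmeas 0 T v ->
    bmeas tau T (fun s => (Q tau s *m Y s)^T *m Y s + (R tau s *m v s)^T *m v s).
  move=> bY bv; apply: bmeas_sub tau0 (lexx T) _.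
  exact: bmeas_add (bmeas_mul (bmeas_tr (bmeas_mul bQ bY)) bY)
    (bmeas_mul (bmeas_tr (bmeas_mul bR bv)) bv).
rewrite /cost_mx opprD addrACA (le_trans (ler_normD _ _))// [leRHS]mulrDl lerD//.
  have [x1 x2 _ _] := hN T TT; have [d _] := he T TT.
  apply: le_trans (h1 _ _ _ _ _ _) (ler_wpM2l C10 d); apply: leM.
  - by rewrite hG// !orbT.
  - by rewrite x1.
  - by rewrite x2.
rewrite -mxintB; [|exact: bf|exact: bf].
have key s : s \in `[tau, T] ->
    `|(Q tau s *m X s)^T *m X s + (R tau s *m u s)^T *m u s
      - ((Q tau s *m X' s)^T *m X' s + (R tau s *m u' s)^T *m u' s)|
    <= (C1 + C2) * e.
  move=> ss; have sT : s \in `[0, T] by exact: in_itv_sub ss.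
  have [x1 x2 u1 u2] := hN s sT; have [d1 d2] := he s sT.
  rewrite opprD addrACA (le_trans (ler_normD _ _))// mulrDl lerD//.
    apply: le_trans (h1 _ _ _ _ _ _) (ler_wpM2l C10 d1); apply: leM.
    - by rewrite hQ// !orbT.
    - by rewrite x1.
    - by rewrite x2.
  apply: le_trans (h2 _ _ _ _ _ _) (ler_wpM2l C20 d2); apply: leM.
  - by rewrite hR// !orbT.
  - by rewrite u1.
  - by rewrite u2.
apply: le_trans (mxint_norm_cst tauT' _ key) _.
  by apply: bmeas_add; [exact: bf|apply: bmeas_opp; exact: bf].
rewrite [leRHS]mulrAC ler_wpM2l//; first by rewrite mulr_ge0// addr_ge0.
by rewrite gerBl.
Qed.

End StateAndCost.

(** * Convergence *)

Section Quantitative.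
Context {K : realType} {n m : nat} (T : K).
Variables (A : K -> K -> 'M[K]_n) (B : K -> K -> 'M[K]_(n, m)).
Variables (Q : K -> K -> 'M[K]_n) (R : K -> K -> 'M[K]_m) (G : K -> 'M[K]_n).
Variables (L delta : K).
Hypothesis H : lq_hyps T A B Q R G L delta.
Let T_gt0 := lq_T_gt0 H.
Local Notation stack := 'M[K]_(n + (n + n), n).
Local Notation vop := (volterra_op T A B Q R G).
Variable x : 'cV[K]_n.

Definition stack_state (W : K -> stack) (s : K) : 'cV[K]_n :=
  stU (W s) *m stV (W 0) *m x.

Definition stack_control (sigma : K -> K) (W : K -> stack) (s : K) : 'cV[K]_m :=
  - (gainK B R (sigma s) s *m stP (W s) *m (stU (W s) *m stV (W 0)) *m x).

Lemma stack_state_bmeas W : bmeas 0 T W -> bmeas 0 T (stack_state W).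
Proof.
move=> bW; exact: bmeas_mul (bmeas_mul (bmeas_usub bW) (bmeas_cst _ _ _))
  (bmeas_cst _ _ _).
Qed.

Lemma stack_control_bmeas sigma W : coef_bmeas T A B R sigma -> bmeas 0 T W ->
  bmeas 0 T (stack_control sigma W).
Proof.
move=> [_ _ _ bK] bW; have bP := bmeas_dsub (bmeas_dsub bW).
exact: bmeas_opp (bmeas_mul (bmeas_mul (bmeas_mul bK bP)
  (bmeas_mul (bmeas_usub bW) (bmeas_cst _ _ _))) (bmeas_cst _ _ _)).
Qed.

(** The forward integral form of [U], multiplied by V(0) x; the hypothesis at time 0 supplies the
    initial value x. *)
Lemma stack_stateE sigma W : coef_bmeas T A B R sigma -> bmeas 0 T W ->
  (forall t : K, t \in `[0, T] -> W t = vop sigma W t) ->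
  stU (W 0) *m stV (W 0) = 1%:M -> forall s : K, s \in `[0, T] ->
  stack_state W s = x + mxint 0 s (fun r =>
    A (sigma r) r *m stack_state W r + B (sigma r) r *m stack_control sigma W r).
Proof.
move=> cs bW fW UV0 s; rewrite in_itv/= => /andP[s0 sT].
have bc := fixpoint_closed_loop_bmeas cs bW; have UV := fixpoint_flow bW fW.
have [bU _ _ _] := UV.
have U0s := flow_forward bc UV (lexx 0) s0 sT.
rewrite /stack_state U0s !mulmxDl UV0 mul1mx; congr (_ + _).
have b := bmeas_sub (lexx 0) sT (bmeas_mul bc bU).
rewrite -mulmxA -(mxintMr _ b).
apply: mxint_ext => r _; rewrite /stack_control /closed_loop.
by rewrite !mulmxBl mulmxN !mulmxA.
Qed.

Variables (Phi : K -> K -> 'M[K]_n) (P : K -> 'M[K]_n).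
Hypothesis sol : volterra_sol T A B Q R G Phi P.

Let Xbar s := Phi s 0 *m x.
Let ubar s := - (invmx (R s s) *m (B s s)^T *m P s *m Phi s 0 *m x).

(** Every quantity is polynomial in the blocks of the fixed point, the coefficients and the gains,
    all of which move by O(mesh). The costs are estimated in absolute value because both controls
    and both states are O(mesh)-close. *)
Theorem quantitative_convergence : exists C h0, [/\ 0 <= C, 0 < h0 &
  forall D, itv_partition 0 T D -> mesh D <= h0 ->
  [/\ forall t : K, t \in `[0, T] -> `|PD T A B Q R G D t - P t| <= C * mesh D,
      forall s t : K, 0 <= t -> t <= s -> s <= T ->
        `|PhiD T A B Q R G D s t - Phi s t| <= C * mesh D,
      forall s : K, s \in `[0, T] ->
        `|XD T A B Q R G D x s - Xbar s| <= C * mesh D,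
      forall s : K, s \in `[0, T] ->
        `|uD T A B Q R G D x s - ubar s| <= C * mesh D
    & forall k, (0 < k <= size D)%N ->
        `|cost T A B Q R G D x k ubar
          - cost T A B Q R G D x k (uD T A B Q R G D x)| <= C * mesh D]].
Proof.
have [W0 bW0 [fW0 W0P W0Phi]] := limit_fixpoint H sol.
have [C1 [h0 [C10 h00 hpert]]] := volterra_perturbation H bW0 fW0.
have T0 : 0 <= T by exact: ltW.
have zT : (0 : K) \in `[0, T] by rewrite in_itv/= lexx.
pose good D := itv_partition 0 T D /\ mesh D <= h0.
(* One fixed point is chosen for every partition in advance, with [W0] as default, so that the
   partition can be part of the index and the constants do not depend on it. *)
have /choice[WD hWD] : forall D, exists W : K -> stack, good D ->
    [/\ bmeas 0 T W,
        forall t : K, t \in `[0, T] -> `|W t - W0 t| <= C1 * mesh D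
      & forall t : K, t \in `[0, T] -> W t = vop (left_node D) W t].
  move=> D; have [[Dp Dm]|ng] := pselect (good D); last first.
    by exists W0 => gD; case: (ng gD).
  have [W hW] := hpert (left_node D) (mesh D) (left_node_tame T_gt0 Dp)
    (mesh_ge0 D) Dm (fun r => left_node_mesh T_gt0 Dp (s := r)).
  by exists W => _.
pose I := (seq K * (K * K))%type.
pose Om : set I := [set i | good i.1 /\ (0 <= i.2.2 /\ i.2.2 <= i.2.1 /\ i.2.1 <= T)].
pose e (i : I) := mesh i.1.
have OmE D s t : good D -> 0 <= t -> t <= s -> s <= T -> Om (D, (s, t)) by [].
have sT i : Om i -> i.2.1 \in `[0, T].
  by move=> [_ [t0 [ts sT]]]; rewrite in_itv/= (le_trans t0 ts).
have tT i : Om i -> i.2.2 \in `[0, T].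
  by move=> [_ [t0 [ts sT']]]; rewrite in_itv/= t0 (le_trans ts sT').
have lT i : Om i -> left_node i.1 i.2.1 \in `[0, T].
  by move=> Oi; have [[Dp _] _] := Oi; exact: left_node_in T_gt0 Dp _ (sT i Oi).
have lm i : Om i -> `|left_node i.1 i.2.1 - i.2.1| <= e i.
  by move=> Oi; have [[Dp _] _] := Oi; exact: left_node_mesh T_gt0 Dp _ (sT i Oi).
have eh i : Om i -> e i <= h0 by move=> [[]].
have [uA uB _ _ _] := ubnd_coeffs H lT sT.
have [uA0 uB0 _ _ _] := ubnd_coeffs H sT sT.
have [cA cB _ _ _] := uclose_coeffs H lT sT sT lm.
have uK := ubnd_gainK H lT sT; have uK0 := ubnd_gainK H sT sT.
have cK := uclose_gainK H lT sT sT lm.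
have [_ [M0 W0M]] := bW0.
have st (g : stack -> 'M[K]_n) (r : I -> K) : {morph g : a b / a - b} ->
    (forall W, `|g W| <= `|W|) -> (forall i, Om i -> r i \in `[0, T]) ->
    [/\ ubnd Om (fun i => g (W0 (r i))), ubnd Om (fun i => g (WD i.1 (r i)))
      & uclose Om e (fun i => g (WD i.1 (r i))) (fun i => g (W0 (r i)))].
  move=> gB gW rT.
  have u0 : ubnd Om (fun i => g (W0 (r i))).
    apply: (@ubnd_le _ _ _ _ _ _ M0) => i Oi.
    exact: le_trans (gW _) (W0M _ (rT i Oi)).
  have c0 : uclose Om e (fun i => g (WD i.1 (r i))) (fun i => g (W0 (r i))).
    exists C1 => // i Oi; rewrite -gB; apply: le_trans (gW _) _.
    have [gi _] := Oi; have [_ h _] := hWD _ gi; exact: h (rT i Oi).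
  split => //; exact: uclose_bnd eh u0 (uclose_sym c0).
have nU (W : stack) : `|stU W| <= `|W| by exact: mx_norm_usub.
have nV (W : stack) : `|stV W| <= `|W|.
  exact: le_trans (mx_norm_usub _) (mx_norm_dsub _).
have nP (W : stack) : `|stP W| <= `|W|.
  exact: le_trans (mx_norm_dsub _) (mx_norm_dsub _).
have mU : {morph @stU K n : a b / a - b} by move=> a b; exact: linearB.
have mV : {morph @stV K n : a b / a - b} by move=> a b; rewrite /stV linearB linearB.
have mP : {morph @stP K n : a b / a - b} by move=> a b; rewrite /stP linearB linearB.
have [uU0 uU cU] := st _ (fun i => i.2.1) mU nU sT.
have [uP0 uP cP] := st _ (fun i => i.2.1) mP nP sT.
have [uV0 uV cV] := st _ (fun i => i.2.2) mV nV tT.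
have ux := ubnd_cst Om x; have cx := uclose_refl Om e (fun=> x).
have [CP CP0 hCP] := cP.
have [CF CF0 hCF] : uclose Om e
    (fun i => stU (WD i.1 i.2.1) *m stV (WD i.1 i.2.2))
    (fun i => stU (W0 i.2.1) *m stV (W0 i.2.2)).
  by repeat first [uclose_step|ubnd_step].
have cX : uclose Om e
    (fun i => stU (WD i.1 i.2.1) *m stV (WD i.1 i.2.2) *m x)
    (fun i => stU (W0 i.2.1) *m stV (W0 i.2.2) *m x).
  by repeat first [uclose_step|ubnd_step].
have uX0 : ubnd Om (fun i => stU (W0 i.2.1) *m stV (W0 i.2.2) *m x).
  by repeat ubnd_step.
have cu : uclose Om e
    (fun i => - (gainK B R (left_node i.1 i.2.1) i.2.1 *m stP (WD i.1 i.2.1)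
      *m (stU (WD i.1 i.2.1) *m stV (WD i.1 i.2.2)) *m x))
    (fun i => - (gainK B R i.2.1 i.2.1 *m stP (W0 i.2.1)
      *m (stU (W0 i.2.1) *m stV (W0 i.2.2)) *m x)).
  by repeat first [uclose_step|ubnd_step].
have uu0 : ubnd Om (fun i => - (gainK B R i.2.1 i.2.1 *m stP (W0 i.2.1)
      *m (stU (W0 i.2.1) *m stV (W0 i.2.2)) *m x)).
  by repeat ubnd_step.
have cX0 := uclose_refl Om e (fun i => stU (W0 i.2.1) *m stV (W0 i.2.2) *m x).
have cu0 := uclose_refl Om e (fun i => - (gainK B R i.2.1 i.2.1 *m stP (W0 i.2.1)
      *m (stU (W0 i.2.1) *m stV (W0 i.2.2)) *m x)).
(* [CS] measures how much the right-hand side of the given state equation changes when [A] and [B]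
   alone are frozen. *)
have [CS CS0 hCS] : uclose Om e
    (fun i => A (left_node i.1 i.2.1) i.2.1
        *m (stU (W0 i.2.1) *m stV (W0 i.2.2) *m x)
      + B (left_node i.1 i.2.1) i.2.1 *m (- (gainK B R i.2.1 i.2.1
        *m stP (W0 i.2.1) *m (stU (W0 i.2.1) *m stV (W0 i.2.2)) *m x)))
    (fun i => A i.2.1 i.2.1 *m (stU (W0 i.2.1) *m stV (W0 i.2.2) *m x)
      + B i.2.1 i.2.1 *m (- (gainK B R i.2.1 i.2.1
        *m stP (W0 i.2.1) *m (stU (W0 i.2.1) *m stV (W0 i.2.2)) *m x))).
  by repeat first [uclose_step|ubnd_step].
have [NX NX0 hNX] := uX0; have [Nu Nu0 hNu] := uu0.
have [CX CX0 hCX] := cX; have [Cu Cu0 hCu] := cu.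
have [CA1 hCA1] := square_bounded (lq_A_cont H); pose CA := `|CA1|.
have CA0 : 0 <= CA by exact: normr_ge0.
have hCA (t s : K) : t \in `[0, T] -> s \in `[0, T] -> `|A t s| <= CA.
  by move=> tT' sT'; apply: le_trans (hCA1 _ _ tT' sT') _; exact: ler_norm.
pose wm := expR ((2 * (n%:R * CA) + 1) * T).
have wm0 : 0 <= wm by exact: expR_ge0.
pose CY := 2 * (CS * T) * wm.
have CY0 : 0 <= CY by rewrite /CY !mulr_ge0.
(* One bound for all states and controls below: the limit objects plus their deviations at the
   largest admissible mesh. *)
pose N := NX + CY * h0 + CX * h0 + Nu + Cu * h0.
have [CC CC0 hCC] := cost_close H N.
have h00' : 0 <= h0 by exact: ltW.
pose Ce := CY + CX + Cu.
exists (CP + CF + CX + Cu + CC * Ce), h0; split => //.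
  by rewrite !addr_ge0// mulr_ge0// !addr_ge0.
move=> D Dp Dm; have gD : good D by [].
have [bW WW0 fW] := hWD D gD.
have m0 := mesh_ge0 D.
(* The existence of a solution makes the pair selected by [get] a solution; uniqueness then equates
   it with the chosen fixed point. *)
have sol1 : game_sol T A B Q R G D (PD T A B Q R G D, PhiD T A B Q R G D).
  have : game_sol T A B Q R G D (game_pair T A B Q R G D).
    by apply: getPex; eexists; exact: (fixpoint_game_sol H Dp bW fW).
  by rewrite /PD /PhiD; case: (game_pair T A B Q R G D).
have [PDE PhiDE] := game_sol_unique H Dp bW fW sol1.
have XDE s : s \in `[0, T] -> XD T A B Q R G D x s = stack_state (WD D) s.
  by rewrite in_itv/= => /andP[s0 sT']; rewrite /XD (PhiDE s 0 (lexx 0) s0 sT').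
have uDE s : s \in `[0, T] ->
    uD T A B Q R G D x s = stack_control (left_node D) (WD D) s.
  move=> sT'; move: (sT'); rewrite in_itv/= => /andP[s0 sT''].
  rewrite /uD /PsiD /psi_of (PhiDE s 0 (lexx 0) s0 sT'') (PDE s sT').
  by rewrite mulNmx.
have XbarE s : s \in `[0, T] -> Xbar s = stack_state W0 s.
  by rewrite in_itv/= => /andP[s0 sT']; rewrite /Xbar (W0Phi s 0 (lexx 0) s0 sT').
have ubarE s : s \in `[0, T] -> ubar s = stack_control id W0 s.
  move=> sT'; move: (sT'); rewrite in_itv/= => /andP[s0 sT''].
  by rewrite /ubar (W0Phi s 0 (lexx 0) s0 sT'') -(W0P s sT').
have Oms s : s \in `[0, T] -> Om (D, (s, 0)).
  by rewrite in_itv/= => /andP[s0 sT']; exact: OmE.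
have weak (c y : K) : c <= CP + CF + CX + Cu + CC * Ce -> y <= c * mesh D ->
    y <= (CP + CF + CX + Cu + CC * Ce) * mesh D.
  by move=> cc yc; apply: le_trans yc _; rewrite ler_wpM2r.
have CCe : 0 <= CC * Ce by rewrite mulr_ge0// !addr_ge0.
have dX s : s \in `[0, T] -> `|stack_state (WD D) s - stack_state W0 s| <= CX * mesh D.
  by move=> sT'; exact: (hCX (D, (s, 0)) (Oms s sT')).
have du s : s \in `[0, T] -> `|stack_control (left_node D) (WD D) s
    - stack_control id W0 s| <= Cu * mesh D.
  by move=> sT'; exact: (hCu (D, (s, 0)) (Oms s sT')).
split.
- move=> t tT'; rewrite (PDE t tT') -(W0P t tT'); apply: (weak CP); first by lra.
  exact: (hCP (D, (t, 0)) (Oms t tT')).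
- move=> s t t0 ts sT'; rewrite (PhiDE s t t0 ts sT') (W0Phi s t t0 ts sT').
  apply: (weak CF); first by lra.
  exact: (hCF (D, (s, t)) (OmE D s t gD t0 ts sT')).
- move=> s sT'; rewrite (XDE s sT') (XbarE s sT'); apply: (weak CX); first by lra.
  exact: dX.
- move=> s sT'; rewrite (uDE s sT') (ubarE s sT'); apply: (weak Cu); first by lra.
  exact: du.
move=> k kD; apply: (weak (CC * Ce)); first by lra.
have cs := coef_bmeas_tame H (left_node_tame T_gt0 Dp).
have bub : bmeas 0 T ubar.
  apply: bmeas_ext (stack_control_bmeas (coef_bmeas_id H) bW0) => r rT.
  exact/esym/ubarE.
have bXb : bmeas 0 T Xbar.
  by apply: bmeas_ext (stack_state_bmeas bW0) => r rT; exact/esym/XbarE.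
have buD : bmeas 0 T (uD T A B Q R G D x).
  apply: bmeas_ext (stack_control_bmeas cs bW) => r rT; exact/esym/uDE.
have bXD : bmeas 0 T (stack_state (WD D)) by exact: stack_state_bmeas.
have UV0 : stU (W0 0) *m stV (W0 0) = 1%:M.
  have [_ _ _ hPhi _] := sol.
  by rewrite -(W0Phi 0 0 (lexx 0) (lexx 0) T0) (hPhi _ _ (lexx 0) (lexx 0) T0)
    mxint_point addr0.
have UVD : stU (WD D 0) *m stV (WD D 0) = 1%:M by exact (game_UV H Dp bW fW zT).
have cost_ub : forall s : K, s \in `[0, T] ->
    `|state_op A B D x ubar Xbar s - Xbar s| <= CS * T * mesh D.
  move=> s sT'; move: (sT'); rewrite in_itv/= => /andP[s0 sT''].
  rewrite [X in _ - X](XbarE s sT').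
  rewrite (stack_stateE (coef_bmeas_id H) bW0 fW0 UV0 sT') /state_op.
  rewrite opprD addrACA subrr add0r.
  have b1 := bmeas_sub (lexx 0) sT'' (state_rate_bmeas H Dp bub bXb).
  have [_ bA0 bB0 _] := coef_bmeas_id H.
  have b2 := bmeas_sub (lexx 0) sT'' (bmeas_add
    (bmeas_mul bA0 (stack_state_bmeas bW0))
    (bmeas_mul bB0 (stack_control_bmeas (coef_bmeas_id H) bW0))).
  rewrite -(mxintB b1 b2).
  have key r : r \in `[0, s] ->
      `|frozen D A r *m Xbar r + frozen D B r *m ubar r
        - (A r r *m stack_state W0 r + B r r *m stack_control id W0 r)|
      <= CS * mesh D.
    move=> rs; have rT : r \in `[0, T] by exact: in_itv_sub rs.
    rewrite (XbarE r rT) (ubarE r rT).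
    exact: (hCS (D, (r, 0)) (Oms r rT)).
  apply: le_trans (mxint_norm_cst s0 (bmeas_add b1 (bmeas_opp b2)) key) _.
  by rewrite subr0 mulrAC ler_wpM2r// ler_wpM2l.
have eub : 0 <= CS * T * mesh D by rewrite !mulr_ge0.
have [cY hY] := state_close H Dp bub CA0 hCA eub bXb cost_ub.
have cost_D : forall s : K, s \in `[0, T] ->
    `|state_op A B D x (uD T A B Q R G D x) (stack_state (WD D)) s
      - stack_state (WD D) s| <= 0.
  move=> s sT'; rewrite [X in _ - X](stack_stateE cs bW fW UVD sT') /state_op.
  rewrite opprD addrACA subrr add0r normr_le0 subr_eq0; apply/eqP.
  apply: mxint_ext => r rs; rewrite uDE//.
  by move: sT'; rewrite in_itv/= => /andP[_ sT'']; exact: in_itv_sub rs.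
have [cZ hZ] := state_close H Dp buD CA0 hCA (lexx 0) bXD cost_D.
have hY' s : s \in `[0, T] -> `|state T A B D x ubar s - Xbar s| <= CY * mesh D.
  move=> sT'; apply: le_trans (hY s sT') _; rewrite /CY /wm.
  by rewrite le_eqVlt; apply/orP; left; apply/eqP; ring.
have hZ' s : s \in `[0, T] ->
    state T A B D x (uD T A B Q R G D x) s = stack_state (WD D) s.
  move=> sT'; apply/eqP; rewrite -subr_eq0 -normr_le0.
  by apply: le_trans (hZ s sT') _; rewrite mulr0 mul0r.
have mh (c : K) : 0 <= c -> c * mesh D <= c * h0 by move=> c0; rewrite ler_wpM2l.
have p1 := mulr_ge0 CY0 h00'; have p2 := mulr_ge0 CX0 h00'.
have p3 := mulr_ge0 Cu0 h00'.
have nX s : s \in `[0, T] -> `|stack_state W0 s| <= NX.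
  by move=> sT'; exact: (hNX (D, (s, 0)) (Oms s sT')).
have nu s : s \in `[0, T] -> `|stack_control id W0 s| <= Nu.
  by move=> sT'; exact: (hNu (D, (s, 0)) (Oms s sT')).
have tri p q (Y Z : 'M[K]_(p, q)) (a b : K) : `|Y - Z| <= a -> `|Z| <= b -> `|Y| <= b + a.
  move=> h1 h2; rewrite -[Y](subrK Z) addrC (le_trans (ler_normD _ _))//.
  exact: lerD.
have em : 0 <= Ce * mesh D by rewrite mulr_ge0// !addr_ge0.
have hN (s : K) : s \in `[0, T] -> [/\ `|state T A B D x ubar s| <= N,
    `|state T A B D x (uD T A B Q R G D x) s| <= N, `|ubar s| <= N
    & `|uD T A B Q R G D x s| <= N].
  move=> sT'; have x0 := nX s sT'; have u0 := nu s sT'.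
  have y1 := hY' s sT'; rewrite (XbarE s sT') in y1.
  have e1 := tri _ _ _ _ _ _ y1 x0.
  have e2 := tri _ _ _ _ _ _ (dX s sT') x0.
  have e3 := tri _ _ _ _ _ _ (du s sT') u0.
  have q1 := mh _ CY0; have q2 := mh _ CX0; have q3 := mh _ Cu0.
  rewrite (hZ' s sT') (ubarE s sT') (uDE s sT') /N.
  split; [apply: le_trans e1 _|apply: le_trans e2 _|apply: le_trans u0 _
    |apply: le_trans e3 _]; lra.
have he (s : K) : s \in `[0, T] ->
    `|state T A B D x ubar s - state T A B D x (uD T A B Q R G D x) s| <= Ce * mesh D
    /\ `|ubar s - uD T A B Q R G D x s| <= Ce * mesh D.
  move=> sT'; have y1 := hY' s sT'; rewrite (XbarE s sT') in y1.
  have r1 := mulr_ge0 CY0 m0; have r2 := mulr_ge0 CX0 m0; have r3 := mulr_ge0 Cu0 m0.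
  have d1 := dX s sT'; have d2 := du s sT'.
  rewrite (hZ' s sT') (ubarE s sT') (uDE s sT') /Ce !mulrDl; split.
    rewrite -[_ - _](subrKA (stack_state W0 s)).
    rewrite (le_trans (ler_normD _ _))// [X in _ + X]distrC.
    by apply: le_trans (lerD y1 d1) _; lra.
  by rewrite distrC; apply: le_trans d2 _; lra.
have tkT : node D k.-1 \in `[0, T].
  by apply: (node_in Dp); case/andP: kD => _; apply: leq_trans; exact: leq_pred.
rewrite !costE -mulrA.
have hc := hCC _ _ _ _ _ _ tkT em (within_bmeas cY) (within_bmeas cZ) bub buD hN he.
apply: le_trans hc.
have entry (M1 M2 : 'M[K]_1) : `|M1 0 0 - M2 0 0| <= `|M1 - M2|.
  by have := mx_entry_le (M1 - M2) 0 0; rewrite !mxE.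
exact: entry.
Qed.

Lemma ubar_admissible : admissible T ubar.
Proof.
have [W0 bW0 [fW0 W0P W0Phi]] := limit_fixpoint H sol.
have bub : bmeas 0 T ubar.
  apply: bmeas_ext (stack_control_bmeas (coef_bmeas_id H) bW0) => s sT'.
  move: (sT'); rewrite in_itv/= => /andP[s0 sT''].
  by rewrite /ubar (W0Phi s 0 (lexx 0) s0 sT'') -(W0P s sT').
move=> i; have [mu _] := bub; split; first exact: mu.
(* The square of the i-th entry is a diagonal entry of u u^T, read off by [delta_mx i 0]; thus it is
   bounded and measurable, hence integrable. *)
have b2 := bmeas_mul (bmeas_mul bub (bmeas_tr bub))
  (bmeas_cst 0 T (delta_mx i (0 : 'I_1))).
have := bmeas_integrable i 0 b2; congr (_.-integrable _ _).
apply/funext => s /=; congr (_%:E).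
rewrite mxE (bigD1 i)//= big1 ?addr0; last first.
  by move=> j ji; rewrite [delta_mx _ _ _ _]mxE (negbTE ji) mulr0.
rewrite [delta_mx _ _ _ _]mxE !eqxx mulr1 mxE big_ord1 [(ubar s)^T _ _]mxE.
by rewrite expr2.
Qed.

End Quantitative.

(** * From O(mesh) bounds to limits of supremum norms *)

Section SupNormLimit.
Context {K : realType} (T : K).

Lemma supnorm_le (I : Type) p q (S : set I) (f : I -> 'M[K]_(p, q)) (c : K) :
  (forall i, S i -> `|f i| <= c) -> (supnorm S f <= c%:E)%E.
Proof. by move=> fc; apply: ge_ereal_sup => _ [i Si <-]; rewrite lee_fin fc. Qed.

Lemma supnorm_ge0 (I : Type) p q (S : set I) (f : I -> 'M[K]_(p, q)) :
  S !=set0 -> (0 <= supnorm S f)%E.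
Proof.
move=> [i Si]; apply: (@le_trans _ _ (`|f i|)%:E); first by rewrite lee_fin.
by apply: ereal_sup_ubound; exists i.
Qed.

#[local] Instance mesh_to0_filter : Filter (mesh_to0 T).
Proof.
apply: filter_from_filter; first by exists 1 => /=.
move=> d d' /= d0 d'0; exists (Num.min d d') => /=; first by rewrite lt_min d0.
by move=> D [Dp]; rewrite lt_min => /andP[].
Qed.

Lemma near_mesh (h0 : K) (S : seq K -> Prop) : 0 < h0 ->
  (forall D, itv_partition 0 T D -> mesh D <= h0 -> S D) ->
  \forall D \near mesh_to0 T, S D.
Proof. by move=> h00 hS; exists h0 => // D [Dp /ltW]; exact: hS. Qed.

(** Squeeze between 0 and C mesh. The upper bound is only asked for fine partitions, where the
    choice behind the game solution is under control. *)
Lemma mesh_cvg0 (f : seq K -> \bar K) (C h0 : K) : 0 <= C -> 0 < h0 ->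
  (forall D, (0 <= f D)%E) ->
  (forall D, itv_partition 0 T D -> mesh D <= h0 -> (f D <= (C * mesh D)%:E)%E) ->
  f D @[D --> mesh_to0 T] --> 0%E.
Proof.
move=> C0 h00 f0 fC.
have hlim : (C * mesh D)%:E @[D --> mesh_to0 T] --> 0%E.
  apply: cvg_EFin; first by apply: nearW.
  apply/cvgrPdist_le => eps eps0 /=.
  apply: (@near_mesh (eps / (C + 1))); first by rewrite divr_gt0// ltr_wpDl.
  move=> D Dp Dm; rewrite sub0r normrN ger0_norm ?mulr_ge0 ?mesh_ge0//.
  apply: (@le_trans _ _ ((C + 1) * mesh D)).
    by rewrite ler_wpM2r ?mesh_ge0// lerDl.
  by rewrite mulrC -ler_pdivlMr// ltr_wpDl.
apply: (@squeeze_cvge _ _ _ _ (cst 0%E) f (fun D => (C * mesh D)%:E)) hlim.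
  by apply: (near_mesh h00) => D Dp Dm /=; rewrite f0 fC.
exact: cvg_cst.
Qed.

End SupNormLimit.

Theorem mainTheorem2 (K : realType) (n m : nat) (T : K)
    (A : K -> K -> 'M[K]_n) (B : K -> K -> 'M[K]_(n, m))
    (Q : K -> K -> 'M[K]_n) (R : K -> K -> 'M[K]_m) (G : K -> 'M[K]_n)
    (L delta : K) (Phi : K -> K -> 'M[K]_n) (P : K -> 'M[K]_n)
    (x : 'cV[K]_n)
    (T_gt0 : 0 < T)
    (Q_sym : forall t s, t \in `[0, T] -> s \in `[0, T] -> symm (Q t s))
    (R_sym : forall t s, t \in `[0, T] -> s \in `[0, T] -> symm (R t s))
    (G_sym : forall t, t \in `[0, T] -> symm (G t))
    (A_cont : {within square T, continuous (fun p : K * K => A p.1 p.2)})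
    (B_cont : {within square T, continuous (fun p : K * K => B p.1 p.2)})
    (Q_cont : {within square T, continuous (fun p : K * K => Q p.1 p.2)})
    (R_cont : {within square T, continuous (fun p : K * K => R p.1 p.2)})
    (G_cont : {within `[0, T], continuous G})
    (L_gt0 : 0 < L) (delta_gt0 : 0 < delta)
    (lip : forall s t r, s \in `[0, T] -> t \in `[0, T] -> r \in `[0, T] ->
       `|A t s - A r s| + `|B t s - B r s| + `|Q t s - Q r s|
         + `|R t s - R r s| + `|G t - G r| <= L * `|t - r|)
    (Q_psd : forall t s, t \in `[0, T] -> s \in `[0, T] -> psd_le 0 (Q t s))
    (G_psd : forall t, t \in `[0, T] -> psd_le 0 (G t))
    (R_pd : forall t s, t \in `[0, T] -> s \in `[0, T] ->
       psd_le delta%:M (R t s))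
    (mono : forall t r s, 0 <= t -> t <= r -> r <= s -> s <= T ->
       [/\ psd_le (G t) (G r), psd_le (Q t s) (Q r s)
         & psd_le (R t s) (R r s)])
    (sol : volterra_sol T A B Q R G Phi P)
    (uniq_sol : forall Phi' P', volterra_sol T A B Q R G Phi' P' ->
       (forall t, t \in `[0, T] -> P' t = P t) /\
       (forall s t, 0 <= t -> t <= s -> s <= T -> Phi' s t = Phi s t)) :
  let Xbar := fun s : K => Phi s 0 *m x in
  let ubar := fun s : K =>
    - (invmx (R s s) *m (B s s)^T *m P s *m Phi s 0 *m x) in
  let PDelta := PD T A B Q R G in
  let PhiDelta := PhiD T A B Q R G in
  let XDelta := fun D => XD T A B Q R G D x in
  let uDelta := fun D => uD T A B Q R G D x in
  let J := fun D k u => cost T A B Q R G D x k u in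
  [/\ supnorm `[0, T] (fun t => PDelta D t - P t)
        @[D --> mesh_to0 T] --> 0%E,
      supnorm (triangle T)
          (fun p : K * K => PhiDelta D p.1 p.2 - Phi p.1 p.2)
        @[D --> mesh_to0 T] --> 0%E,
      (supnorm `[0%R, T] (fun s => XDelta D s - Xbar s)%R
         + supnorm `[0%R, T] (fun s => uDelta D s - ubar s)%R)%E
        @[D --> mesh_to0 T] --> 0%E,
      equilibrium_control T A B Q R G x ubar
    & exists2 C : K, 0 < C &
        forall e : K, 0 < e -> exists2 d : K, 0 < d &
          forall D, itv_partition 0 T D -> mesh D < d ->
          forall k, (0 < k <= size D)%N ->
            J D k ubar <= J D k (uDelta D) + C * mesh D /\
            J D k (uDelta D) + C * mesh D < J D k (uDelta D) + e].
Proof.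
move=> Xbar ubar PDelta PhiDelta XDelta uDelta J.
have H : lq_hyps T A B Q R G L delta by exact: LqHyps.
have [C [h0 [C0 h00 hq]]] := quantitative_convergence H x sol.
have T0 : 0 <= T by exact: ltW.
have itv0 : ([set` `[0, T]] : set K) !=set0 by exists 0; rewrite /= in_itv/= lexx.
have tri0 : triangle T !=set0 by exists (0, 0).
(* Only one side of the absolute cost estimate is kept. *)
have CJ D k : itv_partition 0 T D -> mesh D <= h0 -> (0 < k <= size D)%N ->
    J D k ubar <= J D k (uDelta D) + C * mesh D.
  move=> Dp Dm kD; have [_ _ _ _ hk] := hq D Dp Dm.
  by have := hk k kD; rewrite ler_norml => /andP[_]; rewrite lerBlDl.
have small eps : 0 < eps -> exists2 d : K, 0 < d & forall D, mesh D < d ->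
    mesh D <= h0 /\ C * mesh D < eps.
  move=> eps0; have C1 : 0 < C + 1 by rewrite ltr_wpDl.
  exists (Num.min h0 (eps / (C + 1))); first by rewrite lt_min h00 divr_gt0.
  move=> D; rewrite lt_min => /andP[/ltW -> De]; split => //.
  apply: (@le_lt_trans _ _ ((C + 1) * mesh D)).
    by rewrite ler_wpM2r ?mesh_ge0// lerDl.
  by rewrite mulrC -ltr_pdivlMr.
split.
- apply: (mesh_cvg0 C0 h00) => [D|D Dp Dm]; first exact: supnorm_ge0 itv0.
  by apply: supnorm_le => t tT; have [h _ _ _ _] := hq D Dp Dm; exact: h.
- apply: (mesh_cvg0 C0 h00) => [D|D Dp Dm]; first exact: supnorm_ge0 tri0.
  apply: supnorm_le => p [p0 [p1 p2]].
  by have [_ h _ _ _] := hq D Dp Dm; exact: h.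
- apply: (@mesh_cvg0 _ T _ (C + C) h0) => // [|D|D Dp Dm]; first exact: addr_ge0.
    by apply: adde_ge0; exact: supnorm_ge0 itv0.
  have [_ _ hX hu _] := hq D Dp Dm.
  rewrite mulrDl EFinD; apply: leeD; apply: supnorm_le => s sT.
    exact: hX.
  exact: hu.
- split; first exact (ubar_admissible H x sol).
  move=> eps eps0; have [d d0 hd] := small eps eps0; exists d => // D Dp Dd k kD.
  have [Dm De] := hd D Dd; apply: le_trans (CJ D k Dp Dm kD) _.
  by rewrite lerD2l ltW.
(* The constant must be strictly positive while [C] may vanish; the threshold e/(C + 1) is adapted
   to it. *)
- exists (C + 1); first by rewrite ltr_wpDl.
  move=> eps eps0.
  have C2 : 0 < C + 1 by rewrite ltr_wpDl.
  exists (Num.min h0 (eps / (C + 1))); first by rewrite lt_min h00 divr_gt0.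
  move=> D Dp; rewrite lt_min => /andP[/ltW Dm De] k kD; split.
    apply: le_trans (CJ D k Dp Dm kD) _.
    by rewrite lerD2l ler_wpM2r ?mesh_ge0// lerDl.
  by rewrite ltrD2l mulrC -ltr_pdivlMr.
Qed.
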